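(* Let $p$ be a prime number and let $K$ be a finite extension of $\mathbb{Q}_p$ with ring of integers $\mathcal{O}_K$. Let $f, u \in X\mathcal{O}_K[\![X]\!]$ be power series without constant term such that $f \circ u = u \circ f$. Assume that $f'(0)$ is a uniformizer in $\mathbb{Z}_p$, that $u'(0) \in \mathbb{Z}_p^\times$ is nontorsion (i.e. not a root of unity), that the roots in $\mathfrak{m}_{\mathbb{C}_p}$ of $f$ and of all of its iterates $f^{\circ n}$ ($n \geqslant 1$) are simple, and that $\operatorname{wideg}(f) = p$. Then there exists a formal group $F$ defined over $\mathcal{O}_K$ such that $f, u \in \operatorname{End}_{\mathcal{O}_K}(F)$.
   Context: $\mathbb{C}_p$ is the $p$-adic completion of a fixed algebraic closure of $\mathbb{Q}_p$ containing $K$, and $\mathfrak{m}_{\mathbb{C}_p}$ is its open unit disk. $\mathfrak{m}_K$ is the maximal ideal of $\mathcal{O}_K$. The Weierstrass degree $\operatorname{wideg}(s)$ of $s \in X\mathcal{O}_K[\![X]\!]$ is the $X$-adic valuation of $s(X) \bmod \mathfrak{m}_K$. For $n \geqslant 0$, $f^{\circ n}$ denotes the $n$-fold composition of $f$ with itself. A formal group means a one-dimensional commutative formal group law $F(X,Y) \in \mathcal{O}_K[\![X,Y]\!]$; $\operatorname{End}_{\mathcal{O}_K}(F)$ is the set of $s \in X\mathcal{O}_K[\![X]\!]$ with $s(F(X,Y)) = F(s(X), s(Y))$. *)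

(* Defs.v *)
From HB Require Import structures.
From mathcomp Require Import all_boot all_order all_algebra all_field.
From mathcomp Require Import reals.
From mathcomp Require Import mpoly.

Set Implicit Arguments.
Unset Strict Implicit.
Unset Printing Implicit Defensive.

Import Order.TTheory GRing.Theory Num.Theory.
Local Open Scope ring_scope.

Section ValuedFields.
Variable R : realType.

Record nonarch_abs (E : fieldType) (v : E -> R) : Prop := NonarchAbs {
  abs_ge0 : forall x, 0 <= v x;
  abs_eq0 : forall x, v x = 0 <-> x = 0;
  abs_mul : forall x y, v (x * y) = v x * v y;
  abs_add : forall x y, v (x + y) <= Num.max (v x) (v y) }.

Definition cvg_abs (E : fieldType) (v : E -> R) (w : nat -> E) (l : E) : Prop :=
  forall e : R, 0 < e -> exists N, forall n, (N <= n)%N -> v (w n - l) < e.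

Definition cauchy_abs (E : fieldType) (v : E -> R) (w : nat -> E) : Prop :=
  forall e : R, 0 < e ->
    exists N, forall m n, (N <= m)%N -> (N <= n)%N -> v (w m - w n) < e.

(* (E', v') is a completion of (E, v) via h; this determines (E', v', h) up to
   a unique isometric isomorphism. *)
Record completion (E E' : fieldType) (v : E -> R) (v' : E' -> R)
    (h : {rmorphism E -> E'}) : Prop := Completion {
  completion_abs : nonarch_abs v';
  completion_isometry : forall x, v' (h x) = v x;
  completion_dense : forall (y : E') (e : R), 0 < e ->
    exists x, v' (y - h x) < e;
  completion_complete : forall w : nat -> E', cauchy_abs v' w ->
    exists l, cvg_abs v' w l }.

(* Normalised by |p| = 1/p. *)
Definition padic_abs (p : nat) (x : rat) : R :=
  if x == 0 then 0
  else p%:R ^+ logn p `|denq x|%N / p%:R ^+ logn p `|numq x|%N.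

Definition vring (E : fieldType) (v : E -> R) (x : E) : Prop := v x <= 1.
Definition vmax (E : fieldType) (v : E -> R) (x : E) : Prop := v x < 1.

Definition uniformizer (E : fieldType) (v : E -> R) (pi : E) : Prop :=
  vmax v pi /\ forall x, vmax v x -> exists2 y, vring v y & x = y * pi.

(* (A, v') with j is an algebraic closure of (E, v) containing the finite
   extension K of E, with an absolute value extending that of E. *)
Record valued_alg_closure (E : fieldType) (K : fieldExtType E) (A : fieldType)
    (v : E -> R) (v' : A -> R) (j : {rmorphism K -> A}) : Prop :=
  ValuedAlgClosure {
  vac_closed : GRing.closed_field_axiom A;
  vac_algebraic : forall x : A, algebraicOver (fun a : E => j a%:A) x;
  vac_abs : nonarch_abs v';
  vac_extends : forall a : E, v' (j a%:A) = v a }.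

End ValuedFields.

(* The series sum_k s_k X^k is represented by the function k |-> s_k. *)
Definition pseries (A : Type) := nat -> A.

Section PowerSeries.
Variable A : comNzRingType.
Implicit Types s t : pseries A.

Definition ps_trunc (d : nat) s : {poly A} := \poly_(k < d) s k.

(* The coefficient of X^n in s(t(X)) only depends on s and t modulo X^(n+1)
   as soon as t 0 = 0, the only case in which this is meaningful. *)
Definition ps_comp s t : pseries A :=
  fun n => (ps_trunc n.+1 s \Po ps_trunc n.+1 t)`_n.

Definition ps_X : pseries A := fun k => (k == 1%N)%:R.

Definition ps_iter (n : nat) s : pseries A := iter n (ps_comp s) ps_X.

Definition ps_deriv s : pseries A := fun k => s k.+1 *+ k.+1.

(* Power series in n variables, as functions of the exponent. *)
Definition mseries (n : nat) := 'X_{1..n} -> A.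

Definition ms_trunc (n d : nat) (F : mseries n) : {mpoly A[n]} :=
  \sum_(m : 'X_{1..n < d}) F m *: 'X_[m].

(* F(G_0, ..., G_(k-1)), where the G_i have no constant term. *)
Definition ms_subst (k n : nat) (F : mseries k) (G : 'I_k -> mseries n) :
    mseries n :=
  fun m => (ms_trunc (mdeg m).+1 F
              \mPo [tuple ms_trunc (mdeg m).+1 (G i) | i < k])@_m.

Definition ms_var (n : nat) (i : 'I_n) : mseries n :=
  fun m => (m == U_(i)%MM)%:R.

Definition ms_zero (n : nat) : mseries n := fun=> 0.

Definition ms_uni s : mseries 1 := fun m => s (mdeg m).

(* s(G) and F(G, H) *)
Definition ms_app1 (n : nat) s (G : mseries n) : mseries n :=
  ms_subst (ms_uni s) (fun=> G).
Definition ms_app2 (n : nat) (F : mseries 2) (G H : mseries n) : mseries n :=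
  ms_subst F (fun i => if i == 0 then G else H).

End PowerSeries.

Section FormalGroups.
Variables (A : comNzRingType) (O : A -> Prop).

Record formal_group (F : mseries A 2) : Prop := FormalGroup {
  fg_int : forall m, O (F m);
  fg_X0 : let X := @ms_var A 1 0 in ms_app2 F X (@ms_zero A 1) =1 X;
  fg_0Y : let Y := @ms_var A 1 0 in ms_app2 F (@ms_zero A 1) Y =1 Y;
  fg_assoc :
    let X := @ms_var A 3 0 in
    let Y := @ms_var A 3 1 in
    let Z := @ms_var A 3 (inord 2) in
    ms_app2 F (ms_app2 F X Y) Z =1 ms_app2 F X (ms_app2 F Y Z);
  fg_comm :
    let X := @ms_var A 2 0 in
    let Y := @ms_var A 2 1 in
    ms_app2 F X Y =1 ms_app2 F Y X }.

(* s belongs to X O[[X]] *)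
Definition ps_int0 (s : pseries A) : Prop := s 0%N = 0 /\ forall k, O (s k).

Record fg_End (F : mseries A 2) (s : pseries A) : Prop := FgEnd {
  fg_End_int0 : ps_int0 s;
  fg_End_morph :
    let X := @ms_var A 2 0 in
    let Y := @ms_var A 2 1 in
    ms_app1 s (ms_app2 F X Y) =1 ms_app2 F (ms_app1 s X) (ms_app1 s Y) }.

(* The X-adic valuation of s modulo the ideal given by M is d. *)
Definition has_wideg (M : A -> Prop) (s : pseries A) (d : nat) : Prop :=
  (forall k, (k < d)%N -> M (s k)) /\ ~ M (s d).

End FormalGroups.

Section Roots.
Variables (R : realType) (C : fieldType) (v : C -> R).

(* s(x) converges to y *)
Definition ps_eval_to (s : pseries C) (x y : C) : Prop :=
  cvg_abs v (fun N => \sum_(k < N) s k * x ^+ k) y.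

Definition simple_roots_in_disk (s : pseries C) : Prop :=
  forall x, vmax v x -> ps_eval_to s x 0 -> ~ ps_eval_to (ps_deriv s) x 0.

End Roots.

(* Main.v *)
Require Import Defs.
From HB Require Import structures.
From mathcomp Require Import all_boot all_order all_algebra all_field.
From mathcomp Require Import reals boolp mpoly.
From mathcomp Require Import zify ring.

Set Implicit Arguments.
Unset Strict Implicit.
Unset Printing Implicit Defensive.

Import Order.TTheory GRing.Theory Num.Theory.
Local Open Scope ring_scope.

(** Let [L] be the power series with [L(f) = pi L], where [pi = f'(0)]; the
    formal group sought is [F = L^-1(L(X) + L(Y))], and only the integrality of
    its coefficients is at stake.

    A zero of [f'] in the open disk has a finite orbit under [u], so some point
    of the orbit is fixed by an iterate of [u], hence killed by an iterate of
    [f], against the simplicity of the roots. Therefore [f' / pi] is a unit and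
    [L'] is integral.

    Over the integers of an algebraic closure, [f] can be conjugated so that
    [f = X^p] modulo [pi]; then [u] has its coefficients in [F_p] modulo [pi].
    As [u] is not torsion modulo [pi], only constants are invariant under [u]
    modulo [pi], and the uniqueness of the solution [L'] of
    [L'(u) u' = u'(0) L'] makes it fixed by Frobenius. Inductively, for every
    [J] the pair [(f, u)] is conjugate to one with coefficients in
    [Z_p + pi^J O]. For such an [f] the Lubin-Tate induction on the degree
    shows that the coefficients of [F] of degree at most [J] are integral. *)

(** * The ring of power series *)

(** The ring [O] may be ramified with a large residue field, so [f] need not be [X^p] modulo [pi],
    its coefficients need not be fixed by Frobenius, and the Lubin-Tate induction cannot be run on
    [f] itself. In [Z_p + pi^J O] with [J > 0], on the other hand, [c^p = c] modulo [pi], nothing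
    lies strictly between a unit and a multiple of [pi], and a division by [pi] costs one level of
    [J]. As the induction divides by [pi] in each degree, a coefficient of degree [n] requires a
    stage [J] beyond [n]; a separate conjugation is made for each degree and no limit over [J] is
    taken. This is harmless: conjugating by an integral series composes [L] with an integral
    invertible series, which does not affect the integrality of [F]. Since [pi] is a uniformizer of
    [Z_p], [|p| = |pi|], and the freshman's dream holds modulo [pi]. The absolute value of an
    algebraic closure is not discrete, so congruences are expressed by real radii; the discreteness
    of [K] enters once, to divide [f'] by a largest coefficient. *)

Section SeriesRing.
Variable A : comNzRingType.
Implicit Types s t r : pseries A.

HB.instance Definition _ := gen_eqMixin (pseries A).
HB.instance Definition _ := gen_choiceMixin (pseries A).

Definition ps_add s t : pseries A := fun n => s n + t n.
Definition ps_opp s : pseries A := fun n => - s n.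
Definition ps_zero : pseries A := fun=> 0.
Definition ps_one : pseries A := fun n => (n == 0%N)%:R.
Definition ps_mul s t : pseries A :=
  fun n => \sum_(i < n.+1) s i * t (n - i)%N.

Lemma psP s t : s =1 t -> s = t.
Proof. exact: funext. Qed.

Lemma coef_ps_trunc N s n : (ps_trunc N s)`_n = if (n < N)%N then s n else 0.
Proof. by rewrite /ps_trunc coef_poly. Qed.

Lemma ps_mul_trunc N s t n : (n < N)%N ->
  ps_mul s t n = (ps_trunc N s * ps_trunc N t)`_n.
Proof.
move=> ltnN; rewrite coefM; apply: eq_bigr => i _.
by rewrite !coef_ps_trunc !(leq_ltn_trans _ ltnN) ?leq_subr ?leq_ord.
Qed.

Lemma ps_mulC : commutative ps_mul.
Proof.
by move=> s t; apply: psP => n; rewrite !(ps_mul_trunc _ _ (ltnSn n)) mulrC.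
Qed.

Lemma coefM_eq (p p' q q' : {poly A}) n :
  (forall i, (i <= n)%N -> p`_i = p'`_i) ->
  (forall i, (i <= n)%N -> q`_i = q'`_i) -> (p * q)`_n = (p' * q')`_n.
Proof.
move=> Hp Hq; rewrite !coefM; apply: eq_bigr => i _.
by rewrite Hp ?leq_ord // Hq ?leq_subr.
Qed.

Lemma ps_mulA : associative ps_mul.
Proof.
move=> s t r; apply: psP => n.
rewrite !(ps_mul_trunc _ _ (ltnSn n)).
rewrite (@coefM_eq _ (ps_trunc n.+1 s) _ (ps_trunc n.+1 t * ps_trunc n.+1 r)) //.
  rewrite mulrA; apply: coefM_eq => // i lein.
  by rewrite coef_ps_trunc ltnS lein (@ps_mul_trunc n.+1).
by move=> i lein; rewrite coef_ps_trunc ltnS lein (@ps_mul_trunc n.+1).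
Qed.

Lemma ps_mul1 : left_id ps_one ps_mul.
Proof.
move=> s; apply: psP => n; rewrite /ps_mul big_ord_recl subn0 /ps_one /= mul1r.
by rewrite big1 ?addr0 // => i _; rewrite mul0r.
Qed.

Lemma ps_mulDl : left_distributive ps_mul ps_add.
Proof.
move=> s t r; apply: psP => n; rewrite /ps_add /ps_mul -big_split /=.
by apply: eq_bigr => i _; rewrite mulrDl.
Qed.

Lemma ps_addA : associative ps_add.
Proof. by move=> s t r; apply: psP => n; rewrite /ps_add addrA. Qed.
Lemma ps_addC : commutative ps_add.
Proof. by move=> s t; apply: psP => n; rewrite /ps_add addrC. Qed.
Lemma ps_add0 : left_id ps_zero ps_add.
Proof. by move=> s; apply: psP => n; rewrite /ps_add add0r. Qed.
Lemma ps_addN : left_inverse ps_zero ps_opp ps_add.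
Proof. by move=> s; apply: psP => n; rewrite /ps_add addNr. Qed.
Lemma ps_one_neq0 : ps_one != ps_zero.
Proof. by apply/eqP => /(congr1 (@^~ 0%N)) /eqP; rewrite oner_eq0. Qed.

HB.instance Definition _ := GRing.isZmodule.Build (pseries A)
  ps_addA ps_addC ps_add0 ps_addN.
HB.instance Definition _ := GRing.Zmodule_isComNzRing.Build (pseries A)
  ps_mulA ps_mulC ps_mul1 ps_mulDl ps_one_neq0.

Lemma psD s t n : (s + t) n = s n + t n. Proof. by []. Qed.
Lemma psN s n : (- s) n = - s n. Proof. by []. Qed.
Lemma psB s t n : (s - t) n = s n - t n. Proof. by []. Qed.
Lemma ps0 n : (0 : pseries A) n = 0. Proof. by []. Qed.
Lemma ps1 n : (1 : pseries A) n = (n == 0%N)%:R. Proof. by []. Qed.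
Lemma psM s t n : (s * t) n = \sum_(i < n.+1) s i * t (n - i)%N.
Proof. by []. Qed.
Lemma psM_trunc N s t n : (n < N)%N ->
  (s * t) n = (ps_trunc N s * ps_trunc N t)`_n.
Proof. exact: ps_mul_trunc. Qed.
Lemma psM0 s t : (s * t) 0%N = s 0%N * t 0%N.
Proof. by rewrite psM big_ord1. Qed.

Lemma ps_sum I (l : seq I) (P : pred I) (F : I -> pseries A) n :
  (\sum_(i <- l | P i) F i) n = \sum_(i <- l | P i) F i n.
Proof. by elim/big_rec2: _ => //= i y1 y2 _ <-; rewrite psD. Qed.

Definition ps_const (c : A) : pseries A := fun n => if n is 0 then c else 0.

Lemma ps_const_mul c s n : (ps_const c * s) n = c * s n.
Proof.
rewrite psM big_ord_recl subn0 big1 ?addr0 // => i _.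
by rewrite /= mul0r.
Qed.

Lemma psX0 s k : (s ^+ k) 0%N = s 0%N ^+ k.
Proof. by elim: k => [|k IH]; rewrite ?expr0 ?ps1 // !exprS psM0 IH. Qed.

Lemma psX_trunc N s k n : (n < N)%N -> (s ^+ k) n = (ps_trunc N s ^+ k)`_n.
Proof.
move=> ltnN; elim: k n ltnN => [|k IH] n ltnN.
  by rewrite !expr0 ps1 coef1.
rewrite !exprS (psM_trunc _ _ ltnN); apply: coefM_eq => // i lein.
rewrite coef_ps_trunc (leq_ltn_trans lein ltnN) IH //.
exact: leq_ltn_trans ltnN.
Qed.

Definition ps_ord s m := forall i, (i < m)%N -> s i = 0.

Lemma ps_ordM s t m n : ps_ord s m -> ps_ord t n -> ps_ord (s * t) (m + n).
Proof.
move=> Hs Ht k ltk; rewrite psM big1 // => i _.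
have [ltim|leim] := ltnP i m; first by rewrite Hs ?mul0r.
by rewrite Ht ?mulr0 //; have := leq_ord i; lia.
Qed.

Lemma ps_ordX s m k : ps_ord s m -> ps_ord (s ^+ k) (m * k).
Proof.
move=> Hs; elim: k => [|k IH]; first by move=> i; rewrite muln0.
by rewrite exprS mulnS; apply: ps_ordM.
Qed.

Lemma ps_ord1 s : s 0%N = 0 -> ps_ord s 1.
Proof. by move=> H [|]. Qed.

Lemma psX_lt s k n : s 0%N = 0 -> (n < k)%N -> (s ^+ k) n = 0.
Proof. by move=> H; have := @ps_ordX s 1 k (ps_ord1 H); rewrite mul1n; apply. Qed.

Lemma psX_diag s k : s 0%N = 0 -> (s ^+ k) k = s 1%N ^+ k.
Proof.
move=> H; elim: k => [|k IH]; first by rewrite !expr0 ps1.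
rewrite !exprS psM big_ord_recl H mul0r add0r big_ord_recl /=.
rewrite /bump /= subn1 /= IH big1 ?addr0 // => i _.
rewrite psX_lt ?mulr0 // /bump /=; have := ltn_ord i; lia.
Qed.

Lemma ps_compE s t n :
  t 0%N = 0 -> ps_comp s t n = \sum_(k < n.+1) s k * (t ^+ k) n.
Proof.
move=> t0; rewrite /ps_comp /ps_trunc coef_comp_poly.
rewrite (big_ord_widen_cond n.+1 xpredT (fun i => (\poly_(k < n.+1) s k)`_i *
  ((\poly_(k < n.+1) t k) ^+ i)`_n)) ?size_poly //=.
rewrite big_mkcond /=; apply: eq_bigr => i _.
rewrite (psX_trunc _ _ (ltnSn n)) /ps_trunc.
case: ltnP => [ltis|leis]; first by rewrite coef_poly ltn_ord.
suff -> : s i = 0 by rewrite mul0r.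
by move: (nth_default 0 leis); rewrite coef_poly ltn_ord.
Qed.

Lemma ps_compEw N s t n : t 0%N = 0 -> (n < N)%N ->
  ps_comp s t n = \sum_(k < N) s k * (t ^+ k) n.
Proof.
move=> t0 ltnN; rewrite ps_compE //.
rewrite (big_ord_widen N (fun k => s k * (t ^+ k) n)) // big_mkcond /=.
apply: eq_bigr => i _; case: ltnP => // lt.
by rewrite psX_lt ?mulr0.
Qed.

Lemma ps_comp0 s t : t 0%N = 0 -> ps_comp s t 0%N = s 0%N.
Proof. by move=> t0; rewrite ps_compE // big_ord1 expr0 ps1 mulr1. Qed.

Lemma ps_comp_00 s t : s 0%N = 0 -> t 0%N = 0 -> ps_comp s t 0%N = 0.
Proof. by move=> s0 t0; rewrite ps_comp0. Qed.

Lemma ps_comp_1 s t : t 0%N = 0 -> ps_comp s t 1%N = s 1%N * t 1%N.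
Proof.
move=> t0; rewrite ps_compE // !big_ord_recl big_ord0 expr0 ps1 mulr0 add0r.
by rewrite expr1 addr0.
Qed.

Lemma ps_compD s s' t : t 0%N = 0 ->
  ps_comp (s + s') t = ps_comp s t + ps_comp s' t.
Proof.
move=> t0; apply: psP => n; rewrite psD !ps_compE // -big_split /=.
by apply: eq_bigr => i _; rewrite psD mulrDl.
Qed.

Lemma ps_compN s t : t 0%N = 0 -> ps_comp (- s) t = - ps_comp s t.
Proof.
move=> t0; apply: psP => n; rewrite psN !ps_compE // -sumrN.
by apply: eq_bigr => i _; rewrite psN mulNr.
Qed.

Lemma ps_compB s s' t : t 0%N = 0 ->
  ps_comp (s - s') t = ps_comp s t - ps_comp s' t.
Proof. by move=> t0; rewrite ps_compD ?ps_compN. Qed.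

(** Both sides are sums of [s i * s' j * t ^+ (i + j)]: the product gives all [i, j <= n], the
    composition only [i + j <= n]. The excess is invisible at index [n], since [t ^+ k] has order at
    least [k]. *)
Lemma ps_compM s s' t : t 0%N = 0 ->
  ps_comp (s * s') t = ps_comp s t * ps_comp s' t.
Proof.
move=> t0; apply: psP => n.
have -> : (ps_comp s t * ps_comp s' t) n
   = (\sum_(i < n.+1) \sum_(j < n.+1) ps_const (s i * s' j) * t ^+ (i + j)) n.
  rewrite psM (eq_bigr (fun a : 'I_n.+1 =>
    (\sum_(i < n.+1) \sum_(j < n.+1)
       (s i * (t ^+ i) a) * (s' j * (t ^+ j) (n - a)%N)))); last first.
    move=> a _; rewrite !(@ps_compEw n.+1) ?ltnS ?leq_subr ?leq_ord //.
    by rewrite big_distrlr.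
  rewrite exchange_big ps_sum; apply: eq_bigr => i _.
  rewrite exchange_big ps_sum; apply: eq_bigr => j _.
  rewrite ps_const_mul exprD psM mulr_sumr; apply: eq_bigr => a _.
  by rewrite mulrACA.
rewrite ps_compE // ps_sum.
transitivity (\sum_(k < n.+1) \sum_(i < n.+1 | (i <= k)%N)
                 s i * s' (k - i)%N * (t ^+ k) n).
  apply: eq_bigr => k _; rewrite psM mulr_suml.
  rewrite (big_ord_widen n.+1 (fun i => s i * s' (k - i)%N * (t ^+ k) n)) //.
rewrite (exchange_big_dep xpredT) //=; apply: eq_bigr => i _.
rewrite ps_sum -(big_geq_mkord i n.+1 xpredT
  (fun k => s i * s' (k - i)%N * (t ^+ k) n)).
rewrite -{1}[nat_of_ord i]add0n big_addn.
rewrite [RHS](bigID (fun j : 'I_n.+1 => (j < n.+1 - i)%N)) /=.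
rewrite [X in _ + X]big1 ?addr0; last first.
  by move=> j H; rewrite ps_const_mul psX_lt ?mulr0 //; lia.
rewrite -(big_ord_widen n.+1 (fun j => (ps_const (s i * s' j) * t ^+ (i + j)) n)
  (leq_subr _ _)) big_mkord.
by apply: eq_bigr => j _; rewrite ps_const_mul addnK addnC.
Qed.

Lemma ps_comp1 t : t 0%N = 0 -> ps_comp 1 t = 1.
Proof.
move=> t0; apply: psP => n; rewrite ps_compE // big_ord_recl expr0 !ps1 mul1r.
by rewrite big1 ?addr0 // => i _; rewrite ps1 mul0r.
Qed.

Lemma ps_compX s t k : t 0%N = 0 -> ps_comp (s ^+ k) t = ps_comp s t ^+ k.
Proof.
by move=> t0; elim: k => [|k IH]; rewrite ?expr0 ?ps_comp1 // !exprS ps_compM ?IH.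
Qed.

Lemma ps_comp_const c t : t 0%N = 0 -> ps_comp (ps_const c) t = ps_const c.
Proof.
move=> t0; apply: psP => n; rewrite ps_compE // big_ord_recl expr0 ps1 /=.
rewrite big1 ?addr0; last by move=> i _; rewrite mul0r.
by case: n => [|n]; rewrite ?mulr1 ?mulr0.
Qed.

Lemma ps_compA s t r : t 0%N = 0 -> r 0%N = 0 ->
  ps_comp (ps_comp s t) r = ps_comp s (ps_comp t r).
Proof.
move=> t0 r0; apply: psP => n.
rewrite ps_compE // [RHS]ps_compE ?ps_comp_00 //.
under [RHS]eq_bigr => k _ do rewrite -ps_compX // ps_compE // mulr_sumr.
rewrite exchange_big /=; apply: eq_bigr => j _.
rewrite (@ps_compEw n.+1) // mulr_suml; apply: eq_bigr => k _.
by rewrite mulrA.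
Qed.

Lemma ps_XX k n : ((ps_X A) ^+ k) n = (n == k)%:R.
Proof.
elim: k n => [|k IH] n; first by rewrite expr0 ps1.
rewrite exprS psM; case: n => [|n].
  by rewrite big_ord1 /ps_X mul0r.
rewrite !big_ord_recl /ps_X /= mul0r add0r mul1r subn1 /= IH eqSS.
by rewrite big1 ?addr0 // => i _; rewrite mul0r.
Qed.

Lemma ps_comp_X s : ps_comp s (ps_X A) = s.
Proof.
apply: psP => n; rewrite ps_compE // (bigD1 ord_max) //= ps_XX eqxx mulr1.
rewrite big1 ?addr0 // => i ne; rewrite ps_XX.
case: eqP => [e|]; last by rewrite mulr0.
by case/eqP: ne; apply: val_inj.
Qed.

Lemma ps_Xcomp t : t 0%N = 0 -> ps_comp (ps_X A) t = t.
Proof.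
move=> t0; apply: psP => n; rewrite (@ps_compEw n.+2) //.
rewrite !big_ord_recl /ps_X /= mul0r add0r mul1r expr1 big1 ?addr0 // => i _.
by rewrite mul0r.
Qed.

Lemma ps_deriv_comp s t : t 0%N = 0 ->
  ps_deriv (ps_comp s t) = ps_comp (ps_deriv s) t * ps_deriv t.
Proof.
have dM x y : ps_deriv (x * y) = ps_deriv x * y + x * ps_deriv y.
  apply: psP => n; rewrite /ps_deriv (psM_trunc _ _ (ltnSn n.+1)) -coef_deriv.
  rewrite derivM coefD psD !(@psM_trunc n.+1) //.
  by congr (_ + _); apply: coefM_eq => i lein;
    rewrite ?coef_deriv !coef_ps_trunc ?ltnS ?lein ?(leqW lein) //;
    rewrite /ps_deriv ltnS ?lein.
have dX x k : ps_deriv (x ^+ k.+1) = (x ^+ k * ps_deriv x) *+ k.+1.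
  elim: k => [|k IH]; first by rewrite expr0 mul1r.
  rewrite exprS dM IH [in RHS]mulrS; congr (_ + _); first exact: mulrC.
  by rewrite exprS mulrnAr mulrA.
move=> t0; apply: psP => n.
rewrite {1}/ps_deriv ps_compE // -sumrMnl.
rewrite big_ord_recl expr0 ps1 mulr0 mul0rn add0r.
transitivity (\sum_(k < n.+1) ps_deriv s k * ((t ^+ k) * ps_deriv t) n).
  apply: eq_bigr => k _; rewrite -mulrnAr.
  have := congr1 (@^~ n) (dX t k); rewrite {1}/ps_deriv => ->.
  have psMn (x : pseries A) m i : (x *+ m) i = x i *+ m.
    by elim: m => [|m IH]; rewrite ?mulr0n // !mulrS psD IH.
  by rewrite psMn /ps_deriv mulrnAl -mulrnAr.
rewrite psM.
under [RHS]eq_bigr => i _ do rewrite (@ps_compEw n.+1) // mulr_suml.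
rewrite exchange_big /=; apply: eq_bigr => k _; rewrite psM mulr_sumr.
by apply: eq_bigr => i _; rewrite mulrA.
Qed.

End SeriesRing.

(** * Triangular recursions, valuations and congruences *)

Section Recursion.

(** Course-of-values recursion, used for every series obtained by solving for its coefficients one
    after the other. The list [l n] stores the first [n] values; the default [d] read beyond them
    does not matter, because [G n] only looks below [n]. *)
Lemma series_rec (T : Type) (d : T) (G : nat -> (nat -> T) -> T) :
  (forall n s s', (forall k, (k < n)%N -> s k = s' k) -> G n s = G n s') ->
  exists s, forall n, s n = G n s.
Proof.
move=> HG.
pose fix l n : seq T :=
  if n is m.+1 then rcons (l m) (G m (nth d (l m))) else [::].
have sz n : size (l n) = n by elim: n => //= n IH; rewrite size_rcons IH.
have lE m n : (n < m)%N -> nth d (l m) n = G n (nth d (l n)).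
  elim: m => //= m IH; rewrite ltnS leq_eqVlt nth_rcons sz.
  case/orP => [/eqP ->|lt]; first by rewrite ltnn eqxx.
  by rewrite lt IH.
exists (fun n => nth d (l n.+1) n) => n; rewrite lE //; apply: HG => k lt.
by rewrite !lE.
Qed.

(** A predicate rather than a bundled subring, so that the same closure lemmas serve the integers,
    the image of [Z_p], the rings [Z_p + pi^J O], rings of polynomials with such coefficients, and
    the whole field. *)
Definition subring_pred (A : comNzRingType) (P : A -> Prop) :=
  [/\ P 1, forall x y, P x -> P y -> P (x - y)
     & forall x y, P x -> P y -> P (x * y)].

Variable A : comNzRingType.
Implicit Types s t : pseries A.

Section Sub.
Variable P : A -> Prop.
Hypothesis hP : subring_pred P.

Lemma sp1 : P 1. Proof. by case: hP. Qed.
Lemma spB x y : P x -> P y -> P (x - y). Proof. by case: hP => _ + _; apply. Qed.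
Lemma spM x y : P x -> P y -> P (x * y). Proof. by case: hP => _ _; apply. Qed.
Lemma sp0 : P 0. Proof. by rewrite -(subrr 1); apply: spB; apply: sp1. Qed.
Lemma spN x : P x -> P (- x).
Proof. by move=> Px; rewrite -(sub0r x); apply: spB => //; apply: sp0. Qed.
Lemma spD x y : P x -> P y -> P (x + y).
Proof. by move=> Px Py; rewrite -(opprK y); apply: spB => //; apply: spN. Qed.
Lemma spX x n : P x -> P (x ^+ n).
Proof.
move=> Px; elim: n => [|n IH]; first exact: sp1.
by rewrite exprS; apply: spM.
Qed.
Lemma sp_sum I (l : seq I) (Q : pred I) (F : I -> A) :
  (forall i, Q i -> P (F i)) -> P (\sum_(i <- l | Q i) F i).
Proof. by move=> H; apply: big_ind => //; [exact: sp0|exact: spD]. Qed.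
Lemma sp_nat n : P n%:R.
Proof. by rewrite -[n]card_ord -sumr_const; apply: sp_sum => i _; apply: sp1. Qed.

Lemma sp_psM s t : (forall n, P (s n)) -> (forall n, P (t n)) ->
  forall n, P ((s * t) n).
Proof. by move=> Hs Ht n; rewrite psM; apply: sp_sum => i _; apply: spM. Qed.

Lemma sp_psX s k : (forall n, P (s n)) -> forall n, P ((s ^+ k) n).
Proof.
move=> Hs; elim: k => [|k IH] n; last by rewrite exprS; apply: sp_psM.
by rewrite expr0 ps1; apply: sp_nat.
Qed.

Lemma sp_comp s t : t 0%N = 0 -> (forall n, P (s n)) -> (forall n, P (t n)) ->
  forall n, P (ps_comp s t n).
Proof.
move=> t0 Hs Ht n; rewrite ps_compE //; apply: sp_sum => i _.
by apply: spM => //; apply: sp_psX.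
Qed.

Lemma sp_deriv s : (forall n, P (s n)) -> forall n, P (ps_deriv s n).
Proof.
by move=> Hs n; rewrite /ps_deriv -mulr_natr; apply: spM => //; apply: sp_nat.
Qed.

End Sub.

Lemma subring_predT : subring_pred (fun _ : A => True).
Proof. by []. Qed.
End Recursion.

Section Inverse.
Variable E : fieldType.
Implicit Types s t : pseries E.

Lemma ps_linv (P : E -> Prop) s : subring_pred P -> (forall n, P (s n)) ->
  s 0%N = 0 -> s 1%N != 0 -> P (s 1%N)^-1 ->
  exists t, [/\ t 0%N = 0, t 1%N = (s 1%N)^-1, forall n, P (t n)
              & ps_comp t s = ps_X E].
Proof.
move=> hP Ps s0 s1 Pi.
have [t Ht] := @series_rec E 0 (fun n t => ((n == 1%N)%:R -
   \sum_(k < n) t k * (s ^+ k) n) / s 1%N ^+ n) (fun n s1 s2 H => congr1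
   (fun z => ((n == 1%N)%:R - z) / s 1%N ^+ n)
   (eq_bigr _ (fun i _ => congr1 (fun z => z * _) (H _ (ltn_ord i))))).
have t0 : t 0%N = 0 by rewrite Ht big_ord0 subr0 mul0r.
exists t; split => //.
- by rewrite Ht big_ord1 t0 mul0r subr0 mul1r expr1.
- elim/ltn_ind => n IH; rewrite Ht -exprVn; apply: spM => //; last exact: spX.
  apply: spB => //; first exact: sp_nat.
  by apply: sp_sum => // i _; apply: spM; [|exact: IH|exact: sp_psX].
- apply: psP => n; rewrite ps_compE // big_ord_recr /= psX_diag //.
  by rewrite Ht divfK ?expf_neq0 // addrC subrK.
Qed.

(** The left inverse [t] has a left inverse [r] of its own, and [s = r(t(s)) = r]. No integrality is
    asked of [r], whence the trivial predicate. *)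
Lemma ps_inv (P : E -> Prop) s : subring_pred P -> (forall n, P (s n)) ->
  s 0%N = 0 -> s 1%N != 0 -> P (s 1%N)^-1 ->
  exists t, [/\ t 0%N = 0, t 1%N = (s 1%N)^-1, forall n, P (t n),
              ps_comp t s = ps_X E & ps_comp s t = ps_X E].
Proof.
move=> hP Ps s0 s1 Pi; have [t [t0 t1 Pt ts]] := ps_linv hP Ps s0 s1 Pi.
exists t; split=> //.
have t1n : t 1%N != 0 by rewrite t1 invr_eq0.
have [r [r0 _ _ rt]] := ps_linv (@subring_predT E) (fun=> I) t0 t1n I.
have -> : s = r; last by [].
by rewrite -(ps_Xcomp s0) -rt ps_compA // ts ps_comp_X.
Qed.

End Inverse.

Section Valued.
Variables (R : realType) (E : fieldType) (v : E -> R).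
Hypothesis hv : nonarch_abs v.
Implicit Types (s t : pseries E) (x y : E) (r : R).

Lemma v_ge0 x : 0 <= v x. Proof. exact: abs_ge0. Qed.
Lemma v0 : v 0 = 0. Proof. exact/(abs_eq0 hv). Qed.
Lemma vM x y : v (x * y) = v x * v y. Proof. exact: abs_mul. Qed.
Lemma v_eq0 x : (v x == 0) = (x == 0).
Proof. by apply/eqP/eqP => /(abs_eq0 hv). Qed.
Lemma v_gt0 x : (0 < v x) = (x != 0).
Proof. by rewrite lt_neqAle v_ge0 andbT eq_sym v_eq0. Qed.
Lemma v1 : v 1 = 1.
Proof.
have n1 : v 1 != 0 by rewrite v_eq0 oner_eq0.
by apply: (mulfI n1); rewrite -vM !mulr1.
Qed.
Lemma vX x n : v (x ^+ n) = v x ^+ n.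
Proof. by elim: n => [|n IH]; rewrite ?expr0 ?v1 // !exprS vM IH. Qed.
Lemma vV x : v x^-1 = (v x)^-1.
Proof.
have [->|n0] := eqVneq x 0; first by rewrite invr0 v0 invr0.
have n1 : v x != 0 by rewrite v_eq0.
by apply: (mulfI n1); rewrite -vM !divff ?v1.
Qed.
Lemma vN x : v (- x) = v x.
Proof.
have : v (-1) ^+ 2 = 1 by rewrite -vX sqrrN expr1n v1.
move/eqP; rewrite sqrf_eq1 => /orP[] /eqP H.
  by rewrite -mulN1r vM H mul1r.
by have := v_ge0 (-1); rewrite H oppr_ge0 lt_geF.
Qed.
Lemma vB_sym x y : v (x - y) = v (y - x).
Proof. by rewrite -vN opprB. Qed.
Lemma vD_le r x y : v x <= r -> v y <= r -> v (x + y) <= r.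
Proof. by move=> hx hy; apply: (le_trans (abs_add hv x y)); rewrite ge_max hx. Qed.
Lemma vD_lt r x y : v x < r -> v y < r -> v (x + y) < r.
Proof. by move=> hx hy; apply: (le_lt_trans (abs_add hv x y)); rewrite gt_max hx. Qed.
Lemma vB_le r x y : v x <= r -> v y <= r -> v (x - y) <= r.
Proof. by move=> hx hy; apply: vD_le; rewrite ?vN. Qed.
Lemma vB_lt r x y : v x < r -> v y < r -> v (x - y) < r.
Proof. by move=> hx hy; apply: vD_lt; rewrite ?vN. Qed.
Lemma vD_eq x y : v y < v x -> v (x + y) = v x.
Proof.
move=> lt; apply/eqP; rewrite eq_le vD_le ?(ltW lt) //=.
rewrite leNgt; apply/negP => lt2.
by have := vB_lt lt2 lt; rewrite addrK ltxx.
Qed.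
Lemma v_sum r I (l : seq I) (Q : pred I) (F : I -> E) : 0 <= r ->
  (forall i, Q i -> v (F i) <= r) -> v (\sum_(i <- l | Q i) F i) <= r.
Proof.
move=> r0 H; apply: (big_ind (fun x => v x <= r)) => //; first by rewrite v0.
by move=> x y; apply: vD_le.
Qed.

Definition vint x := v x <= 1.
Lemma subring_vint : subring_pred vint.
Proof.
split; first by rewrite /vint v1.
  by move=> x y; apply: vB_le.
by move=> x y hx hy; rewrite /vint vM mulr_ile1 ?v_ge0.
Qed.
Lemma v_nat n : v n%:R <= 1.
Proof. exact: (sp_nat subring_vint). Qed.

(** Radii stand for ideals: [v pi ^+ J] for the ideal generated by [pi^J], and [1] for the ring of
    integers. *)
Definition ps_le r s := forall n, v (s n) <= r.
Definition ps_cong r s t := forall n, v (s n - t n) <= r.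

Lemma ps_le_ge0 r s : ps_le r s -> 0 <= r.
Proof. by move=> H; apply: le_trans (H 0%N); apply: v_ge0. Qed.
Lemma ps_leW r r' s : r <= r' -> ps_le r s -> ps_le r' s.
Proof. by move=> h H n; apply: le_trans h. Qed.
Lemma ps_leD r s t : ps_le r s -> ps_le r t -> ps_le r (s + t).
Proof. by move=> hs ht n; apply: vD_le. Qed.
Lemma ps_leB r s t : ps_le r s -> ps_le r t -> ps_le r (s - t).
Proof. by move=> hs ht n; apply: vB_le. Qed.
Lemma ps_leM r r' s t : ps_le r s -> ps_le r' t -> ps_le (r * r') (s * t).
Proof.
move=> hs ht n; have r0 := ps_le_ge0 hs; have r0' := ps_le_ge0 ht.
rewrite psM; apply: v_sum => [|i _]; first exact: mulr_ge0.
by rewrite vM ler_pM ?v_ge0.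
Qed.
Lemma ps_leMl r s t : ps_le 1 s -> ps_le r t -> ps_le r (s * t).
Proof. by move=> hs ht; rewrite -[r]mul1r; apply: ps_leM. Qed.
Lemma ps_leMr r s t : ps_le r s -> ps_le 1 t -> ps_le r (s * t).
Proof. by move=> hs ht; rewrite -[r]mulr1; apply: ps_leM. Qed.
Lemma ps_leX s k : ps_le 1 s -> ps_le 1 (s ^+ k).
Proof. by move=> hs; exact: (sp_psX subring_vint). Qed.
Lemma ps_le_comp r s t : t 0%N = 0 -> ps_le r s -> ps_le 1 t ->
  ps_le r (ps_comp s t).
Proof.
move=> t0 hs ht n; rewrite ps_compE //.
apply: v_sum => [|i _]; first exact: ps_le_ge0 hs.
by rewrite vM -[r]mulr1 ler_pM ?v_ge0 //; apply: ps_leX.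
Qed.
Lemma ps_le_deriv r s : ps_le r s -> ps_le r (ps_deriv s).
Proof.
move=> hs n; rewrite /ps_deriv -mulr_natr vM -[r]mulr1.
by rewrite ler_pM ?v_ge0 ?v_nat.
Qed.

Lemma congP r s t : ps_cong r s t <-> ps_le r (s - t).
Proof. by []. Qed.
Lemma cong_refl r s : 0 <= r -> ps_cong r s s.
Proof. by move=> r0 n; rewrite subrr v0. Qed.
Lemma cong_sym r s t : ps_cong r s t -> ps_cong r t s.
Proof. by move=> H n; rewrite vB_sym. Qed.
Lemma cong_trans r t s w : ps_cong r s t -> ps_cong r t w -> ps_cong r s w.
Proof.
move=> H1 H2 n; have -> : s n - w n = (s n - t n) + (t n - w n) by ring.
exact: vD_le.
Qed.
Lemma congW r r' s t : r <= r' -> ps_cong r s t -> ps_cong r' s t.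
Proof. by move=> h H n; apply: le_trans h. Qed.
Lemma cong_le r r' s t : r <= r' -> ps_cong r s t -> ps_le r' t -> ps_le r' s.
Proof.
move=> h H Ht n; rewrite -(subrK (t n) (s n)); apply: vD_le => //.
exact: le_trans h.
Qed.
Lemma congD r s s' t t' : ps_cong r s s' -> ps_cong r t t' ->
  ps_cong r (s + t) (s' + t').
Proof.
move=> H1 H2 n; rewrite !psD.
have -> : s n + t n - (s' n + t' n) = (s n - s' n) + (t n - t' n) by ring.
exact: vD_le.
Qed.
Lemma congB r s s' t t' : ps_cong r s s' -> ps_cong r t t' ->
  ps_cong r (s - t) (s' - t').
Proof.
move=> H1 H2 n; rewrite !psB.
have -> : s n - t n - (s' n - t' n) = (s n - s' n) - (t n - t' n) by ring.
exact: vB_le.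
Qed.
Lemma congM r s s' t t' : ps_le 1 s -> ps_le 1 t' ->
  ps_cong r s s' -> ps_cong r t t' -> ps_cong r (s * t) (s' * t').
Proof.
move=> hs ht' /congP H1 /congP H2; apply/congP.
have -> : s * t - s' * t' = s * (t - t') + (s - s') * t' by ring.
by apply: ps_leD; [apply: ps_leMl|apply: ps_leMr].
Qed.
Lemma congX r s s' k : r <= 1 -> ps_le 1 s' -> ps_cong r s s' ->
  ps_cong r (s ^+ k) (s' ^+ k).
Proof.
move=> r1 hs' H; have hs := cong_le r1 H hs'.
elim: k => [|k IH]; first by rewrite !expr0; apply: cong_refl; exact: ps_le_ge0 H.
by rewrite !exprS; apply: congM => //; apply: ps_leX.
Qed.
Lemma cong_comp_l r s s' t : t 0%N = 0 -> ps_le 1 t -> ps_cong r s s' ->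
  ps_cong r (ps_comp s t) (ps_comp s' t).
Proof.
by move=> t0 ht /congP H; apply/congP; rewrite -ps_compB //; apply: ps_le_comp.
Qed.
Lemma cong_comp_r r s t t' : r <= 1 -> t 0%N = 0 -> t' 0%N = 0 ->
  ps_le 1 s -> ps_le 1 t' -> ps_cong r t t' ->
  ps_cong r (ps_comp s t) (ps_comp s t').
Proof.
move=> r1 t0 t0' hs ht' H n; rewrite !ps_compE // -sumrB.
apply: v_sum => [|i _]; first exact: ps_le_ge0 H.
rewrite -mulrBr vM -[r]mul1r ler_pM ?v_ge0 //.
exact: congX.
Qed.

(* The first order term of [f (t + e) - f t] carries the factor [f'], all the
   others are multiples of [e ^ 2]. *)
Lemma cong_comp_small (c rho : R) s t (e : pseries E) : t 0%N = 0 -> e 0%N = 0 ->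
  ps_le 1 s -> ps_le c (ps_deriv s) -> ps_le 1 t -> ps_le rho e -> rho <= c ->
  rho <= 1 -> ps_cong (c * rho) (ps_comp s (t + e)) (ps_comp s t).
Proof.
move=> t0 e0 hs hs' ht he rc r1 n.
have te0 : (t + e) 0%N = 0 by rewrite psD t0 e0 addr0.
have c0 := ps_le_ge0 hs'; have rho0 := ps_le_ge0 he.
have he1 := ps_leW r1 he.
rewrite !ps_compE // -sumrB; apply: v_sum => [|i _]; first exact: mulr_ge0.
case: i => -[|i] ilt /=; first by rewrite !expr0 subrr v0 mulr_ge0.
(* Binomial expansion to second order with an integral remainder [q]. The factor [i.+1] of the
   linear term is then absorbed into the coefficient of [s], giving one of [s']. *)
have [q [hq ->]] : exists q, ps_le 1 q /\
    (t + e) ^+ i.+1 = t ^+ i.+1 + (t ^+ i * e) *+ i.+1 + e ^+ 2 * q.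
  elim: i {ilt} => [|i [q [hq IH]]].
    by exists 0; split; [move=> k; rewrite v0|rewrite !expr1 expr0; ring].
  exists ((t ^+ i) *+ i.+1 + (t + e) * q); split.
    apply: ps_leD; last by apply: ps_leMl => //; apply: ps_leD.
    move=> k; rewrite -mulr_natr; apply: (sp_psM subring_vint).
      exact: ps_leX.
    move=> j; have : ps_le 1 (1 *+ i.+1 : pseries E).
      elim: (i.+1) => [|m IHm]; first by move=> l; rewrite mulr0n v0.
      rewrite mulrS; apply: ps_leD => // l; rewrite ps1; exact: v_nat.
    exact.
  rewrite exprS IH -[(t ^+ i.+1 * e) *+ i.+2]mulr_natl -[i.+2%:R]natr1 !exprS.
  rewrite -[(t ^+ i * e) *+ i.+1]mulr_natl -[(t ^+ i) *+ i.+1]mulr_natl.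
  by move: (i.+1%:R : pseries E) (t ^+ i) => a b; ring.
have psMn (x : pseries E) m : (x *+ m) n = x n *+ m.
  by elim: m => [|m IH]; rewrite ?mulr0n // !mulrS psD IH.
rewrite -mulrBr !psD psMn.
have -> : (t ^+ i.+1) n + (t ^+ i * e) n *+ i.+1 + (e ^+ 2 * q) n
   - (t ^+ i.+1) n = (t ^+ i * e) n *+ i.+1 + (e ^+ 2 * q) n by ring.
rewrite mulrDr; apply: vD_le.
  rewrite mulrnAr -mulrnAl vM ler_pM ?v_ge0 //; first exact: hs'.
  by apply: ps_leMl => //; apply: ps_leX.
rewrite vM -[c * rho]mul1r ler_pM ?v_ge0 //.
(* The quadratic part has radius [rho * rho], and [rho <= c]. *)
apply: (ps_leW (r := rho * rho)); first by rewrite ler_wpM2r.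
apply: ps_leMr => //; rewrite expr2; exact: ps_leM.
Qed.

End Valued.

(** * Freshman's dream and the subrings [Z_p + pi^J O] *)

Section Freshman.
Variables (A : comNzRingType) (P I : A -> Prop) (p : nat).
Hypotheses (hP : subring_pred P) (hp : prime p).
Hypotheses (I0 : I 0) (ID : forall x y, I x -> I y -> I (x + y)).
Hypotheses (IM : forall x y, P x -> I y -> I (x * y)) (Ip : I p%:R).

(** The inner binomial coefficients are multiples of [p]. The subring [P] and the ideal [I] are kept
    abstract because the result is applied to scalars, to polynomials in one and in several
    variables, and to power series. *)
Lemma freshman x y : P x -> P y -> I ((x + y) ^+ p - (x ^+ p + y ^+ p)).
Proof.
move=> Px Py; case: p hp Ip => [//|q] hq Iq.
rewrite exprDn big_ord_recl big_ord_recr /= bin0 binn subn0 subnn !expr0.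
rewrite /bump /= add1n !mulr1n mulr1 mul1r.
set S := \sum_(i < q) _.
have -> : x ^+ q.+1 + (S + y ^+ q.+1) - (x ^+ q.+1 + y ^+ q.+1) = S by ring.
apply: big_ind => // i _; rewrite /bump /= add1n.
have /dvdnP[m ->] : (q.+1 %| 'C(q.+1, i.+1))%N by rewrite prime_dvd_bin //= ltnS ltn_ord.
rewrite -mulr_natr natrM mulrA; apply: IM => //.
by apply: spM => //; [apply: spM => //; apply: spX|apply: sp_nat].
Qed.

Lemma freshman_sum J (l : seq J) (F : J -> A) : (forall i, P (F i)) ->
  I ((\sum_(i <- l) F i) ^+ p - \sum_(i <- l) F i ^+ p).
Proof.
move=> PF; elim: l => [|a l IH].
  by rewrite !big_nil expr0n; case: p hp => //= *; rewrite subr0.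
rewrite !big_cons.
have := ID (freshman (PF a) (sp_sum hP l (Q := xpredT) (fun i _ => PF i))) IH.
by congr I; ring.
Qed.
End Freshman.

Section Frame.
Variables (R : realType) (E : fieldType) (v : E -> R).
Hypothesis hv : nonarch_abs v.
Variables (p : nat) (Z : E -> Prop) (pi : E).

(* [Z] plays the role of the image of the p-adic integers in [E] *)
Record zp_frame : Prop := ZpFrame {
  zf_prime : prime p;
  zf_sub : subring_pred Z;
  zf_int : forall z, Z z -> v z <= 1;
  zf_pi : Z pi;
  zf_pi1 : v pi < 1;
  zf_pi0 : pi != 0;
  zf_p : v p%:R = v pi;
  zf_nat : forall k, ~~ (p %| k)%N -> v k%:R = 1;
  zf_inv : forall z, Z z -> v z = 1 -> Z z^-1;
  zf_div : forall z, Z z -> v z <= v pi -> Z (z / pi);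
  zf_res : forall z, Z z -> exists n : nat, v (z - n%:R) <= v pi }.

Hypothesis hf : zp_frame.
Let hp := zf_prime hf.

Implicit Types (s t : pseries E) (c d : E).

Lemma vpi_gt0 : 0 < v pi. Proof. by rewrite (v_gt0 hv) (zf_pi0 hf). Qed.
Lemma vpi_ge0 : 0 <= v pi. Proof. exact: ltW vpi_gt0. Qed.
Lemma vpi_le1 : v pi <= 1. Proof. exact: ltW (zf_pi1 hf). Qed.
Lemma vpiX_gt0 J : 0 < v pi ^+ J. Proof. exact/exprn_gt0/vpi_gt0. Qed.
Lemma vpiX_ge0 J : 0 <= v pi ^+ J. Proof. exact/ltW/vpiX_gt0. Qed.
Lemma vpiX_le1 J : v pi ^+ J <= 1.
Proof. by rewrite exprn_ile1 ?vpi_ge0 ?vpi_le1. Qed.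
Lemma vpiX_leS J : v pi ^+ J.+1 <= v pi ^+ J.
Proof. by rewrite exprS ler_piMl ?vpi_le1 ?vpiX_ge0. Qed.
Lemma vpiX_leW i J : (i <= J)%N -> v pi ^+ J <= v pi ^+ i.
Proof. by move=> h; rewrite ler_wiXn2l ?vpi_ge0 ?vpi_le1. Qed.

(** The ring [Z_p + pi^J O]: it is all of [O] for [J = 0], and for [J = 1] it consists of the
    elements whose class modulo [pi] comes from [F_p]. *)
Definition zpmod J c := exists2 z, Z z & v (c - z) <= v pi ^+ J.

Lemma zpmod_int J c : zpmod J c -> v c <= 1.
Proof.
case=> z Zz H; rewrite -(subrK z c); apply: (vD_le hv); last exact: (zf_int hf).
exact: le_trans H (vpiX_le1 J).
Qed.
Lemma zpmodZ J c : Z c -> zpmod J c.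
Proof. by move=> Zc; exists c => //; rewrite subrr (v0 hv) vpiX_ge0. Qed.
Lemma zpmod_small J c : v c <= v pi ^+ J -> zpmod J c.
Proof. by move=> H; exists 0; [exact: (sp0 (zf_sub hf))|rewrite subr0]. Qed.
Lemma zpmod0 c : v c <= 1 -> zpmod 0 c.
Proof. by move=> H; apply: zpmod_small; rewrite expr0. Qed.
Lemma zpmod_congr J c d : zpmod J c -> v (c - d) <= v pi ^+ J -> zpmod J d.
Proof.
case=> z Zz H H'; exists z => //; have -> : d - z = (c - z) - (c - d) by ring.
exact: (vB_le hv).
Qed.
Lemma zpmodW i J c : (i <= J)%N -> zpmod J c -> zpmod i c.
Proof. by move=> h [z Zz H]; exists z => //; apply: le_trans H (vpiX_leW h). Qed.
Lemma zpmod_sub J : subring_pred (zpmod J).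
Proof.
split; first by apply/zpmodZ/(sp1 (zf_sub hf)).
  move=> x y [a Za Ha] [b Zb Hb]; exists (a - b); first exact: (spB (zf_sub hf)).
  have -> : x - y - (a - b) = (x - a) - (y - b) by ring.
  exact: (vB_le hv).
move=> x y hx [b Zb Hb]; have vx := zpmod_int hx.
have [a Za Ha] := hx; exists (a * b); first exact: (spM (zf_sub hf)).
have -> : x * y - a * b = x * (y - b) + (x - a) * b by ring.
apply: (vD_le hv); rewrite (vM hv).
  by rewrite -[X in _ <= X]mul1r ler_pM ?(v_ge0 hv).
by rewrite -[X in _ <= X]mulr1 ler_pM ?(v_ge0 hv) // (zf_int hf).
Qed.
(** The representative in [Z] of [c] is itself divisible by [pi], so both parts can be divided. The
    level lost here governs the precision needed in the Lubin-Tate induction. *)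
Lemma zpmod_div J c : zpmod J.+1 c -> v c <= v pi -> zpmod J (c / pi).
Proof.
case=> z Zz H Hc.
have Hz : v z <= v pi.
  have -> : z = c - (c - z) by ring.
  apply: (vB_le hv) => //; apply: le_trans H _.
  by rewrite exprS ler_piMr ?vpi_ge0 ?vpiX_le1.
exists (z / pi); first exact: (zf_div hf).
rewrite -mulrBl (vM hv) (vV hv) ler_pdivrMr ?vpi_gt0 //.
by rewrite -exprSr.
Qed.
Lemma zpmod_divX i J c :
  zpmod (i + J) c -> v c <= v pi ^+ i -> zpmod J (c / pi ^+ i).
Proof.
elim: i J c => [|i IH] J c; first by rewrite expr0 divr1.
rewrite addSnnS => H Hc; rewrite exprSr invfM mulrA.
apply: zpmod_div; first by apply: IH => //; apply: le_trans Hc (vpiX_leS i).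
by rewrite (vM hv) (vV hv) (vX hv) ler_pdivrMr ?vpiX_gt0 // -exprS.
Qed.
Lemma zpmod_mulX i J c : zpmod J c -> zpmod (i + J) (pi ^+ i * c).
Proof.
case=> z Zz H; exists (pi ^+ i * z).
  apply: (spM (zf_sub hf)) => //; apply: (spX (zf_sub hf)); exact: (zf_pi hf).
by rewrite -mulrBr (vM hv) (vX hv) exprD ler_wpM2l ?vpiX_ge0.
Qed.

Lemma v_freshman c d : v c <= 1 -> v d <= 1 ->
  v ((c + d) ^+ p - (c ^+ p + d ^+ p)) <= v pi.
Proof.
apply: (@freshman E (vint v) (fun x => v x <= v pi) p (subring_vint hv) hp).
- by rewrite (v0 hv) vpi_ge0.
- by move=> x y; apply: (vD_le hv).
- move=> x y hx hy; rewrite (vM hv) -[v pi]mul1r.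
  by rewrite ler_pM ?(v_ge0 hv).
- by rewrite (zf_p hf).
Qed.

(** Little Fermat: natural numbers by induction through the freshman's dream, then any [c], which is
    congruent to a natural number modulo [pi]. *)
Lemma v_fermat c : zpmod 1 c -> v (c ^+ p - c) <= v pi.
Proof.
have nat_case n : v (n%:R ^+ p - n%:R) <= v pi.
  elim: n => [|n IH].
    by rewrite expr0n; case: p hp => //= *; rewrite subrr (v0 hv) vpi_ge0.
  rewrite -natr1.
  have -> : (n%:R + 1) ^+ p - (n%:R + 1) = ((n%:R + 1) ^+ p -
     (n%:R ^+ p + 1 ^+ p)) + (n%:R ^+ p - n%:R) :> E by rewrite expr1n; ring.
  apply: (vD_le hv) => //; apply: v_freshman; first exact: (v_nat hv).
  exact: (sp1 (subring_vint hv)).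
case=> z Zz H.
have [n Hn] := zf_res hf Zz.
have Hcn : v (c - n%:R) <= v pi.
  have -> : c - n%:R = (c - z) + (z - n%:R) by ring.
  exact: (vD_le hv).
have -> : c ^+ p - c = (c ^+ p - n%:R ^+ p) + (n%:R ^+ p - n%:R) - (c - n%:R).
  by ring.
apply: (vB_le hv) => //; apply: (vD_le hv) => //.
rewrite subrXX (vM hv) -[v pi]mulr1 ler_pM ?(v_ge0 hv) //.
apply: (sp_sum (subring_vint hv)) => i _.
apply: (spM (subring_vint hv)); apply: (spX (subring_vint hv)).
  rewrite /vint -(subrK n%:R c); apply: (vD_le hv); last exact: (v_nat hv).
  exact: le_trans Hcn vpi_le1.
exact: (v_nat hv).
Qed.

Lemma v_int_int (m : int) : v m%:~R <= 1.
Proof.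
by case: m => n; rewrite ?NegzE ?mulrNz ?(vN hv); exact: (v_nat hv).
Qed.

(** Over [F_p] the difference of the monic polynomials [prod (X - i)] and [X^p - X] has degree less
    than [p] and vanishes at all [p] points, so it is zero. The integer polynomial [q] therefore has
    its coefficients divisible by [p]. *)
Lemma prod_shift_cong c : v c <= 1 ->
  v (\prod_(i < p) (c - i%:R) - (c ^+ p - c)) <= v pi.
Proof.
move=> vc.
pose q : {poly int} := \prod_(i < p) ('X - i%:R%:P) - ('X ^+ p - 'X).
have q0 : map_poly (fun m : int => m%:~R : 'F_p) q = 0.
  pose P := \prod_(i < p) ('X - (i%:R : 'F_p)%:P).
  have -> : map_poly (fun m : int => m%:~R : 'F_p) q = P - ('X ^+ p - 'X).
    rewrite rmorphB rmorph_prod /= rmorphB /= map_polyXn map_polyX.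
    congr (_ - _); apply: eq_bigr => i _.
    by rewrite rmorphB /= map_polyX map_polyC /= rmorph_nat.
  apply: (roots_geq_poly_eq0 (rs := enum 'F_p)); last first.
  - rewrite -cardE card_Fp //.
    have mP : P \is monic by rewrite monic_prod_XsubC.
    have sP : size P = p.+1.
      by rewrite /P size_prod_XsubC -[RHS](card_ord p.+1) /index_enum -enumT size_enum_ord card_ord.
    have sX : size ('X : {poly 'F_p}) = 2 by rewrite size_polyX.
    have p1 := prime_gt1 hp.
    have -> : P - ('X^p - 'X) = (P - 'X^p) + 'X by ring.
    apply/leq_sizeP => j lej; rewrite coefD coefB coefXn coefX.
    have -> : (j == 1)%N = false by lia.
    have [->|ne] := eqVneq j p.
      move: mP; rewrite monicE lead_coefE sP /= => /eqP ->.
      by rewrite subrr addr0.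
    by rewrite nth_default ?subr0 ?addr0 // sP; lia.
  - exact: enum_uniq.
  apply/allP => x _; rewrite rootE !hornerE ?hornerXn.
  have -> : x ^+ p = x by rewrite -{2}(expf_card x) card_Fp.
  have lt : (val x < p)%N by have := ltn_ord x; rewrite [X in (_ < X)%N -> _](Fp_cast hp).
  rewrite /P horner_prod (bigD1 (Ordinal lt)) //= !hornerE.
  by rewrite natr_Zp subrr mul0r subrr.
have -> : \prod_(i < p) (c - i%:R) - (c ^+ p - c)
   = (map_poly (fun m : int => m%:~R : E) q).[c].
  rewrite rmorphB rmorph_prod /= rmorphB /= map_polyXn map_polyX.
  rewrite !hornerE ?hornerXn horner_prod; congr (_ - _).
  apply: eq_bigr => i _.
  by rewrite rmorphB /= map_polyX map_polyC /= rmorph_nat !hornerE.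
rewrite horner_coef; apply: (v_sum hv); first exact: vpi_ge0.
move=> i _; rewrite (vM hv) (vX hv) -[v pi]mulr1 ler_pM ?(v_ge0 hv) //.
- by rewrite exprn_ge0 ?(v_ge0 hv).
- move/polyP/(_ i): q0; rewrite coef0 !coef_map /= => H.
  have /dvdzP[m ->] : (p %| q`_i)%Z.
    by rewrite (dvdz_pcharf (pchar_Fp hp)) H.
  rewrite intrM (vM hv) mulrC -(zf_p hf) -[X in _ <= X]mulr1.
  by rewrite ler_pM ?(v_ge0 hv) // v_int_int.
by rewrite exprn_ile1 ?(v_ge0 hv).
Qed.

(** The product of the [c - i] is small, so one factor [y = c - n] is not a unit. In a ramified ring
    this alone says too little; but [y^p - y] is also divisible by [pi], and [|y^p| < |y|] makes [y]
    the dominant term. *)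
Lemma zpmod1_fermat c : v c <= 1 -> v (c ^+ p - c) <= v pi -> zpmod 1 c.
Proof.
move=> vc H.
have prod_le : v (\prod_(i < p) (c - i%:R)) <= v pi.
  rewrite -(subrK (c ^+ p - c) (\prod_(i < p) _)).
  by apply: (vD_le hv) => //; apply: prod_shift_cong.
have [n Hn] : exists n : nat, v (c - n%:R) < 1.
  apply/not_existsP => Hn.
  have : v (\prod_(i < p) (c - i%:R)) = 1.
    apply: (big_ind (fun x => v x = 1)) => [|x y hx hy|i _]; first exact: (v1 hv).
      by rewrite (vM hv) hx hy mulr1.
    apply/eqP; rewrite eq_le [X in _ && X]leNgt; apply/andP; split.
      by apply: (vB_le hv) => //; apply: v_nat.
    by apply/negP.
  by move=> e; move: prod_le; rewrite e leNgt (zf_pi1 hf).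
set y := c - n%:R in Hn.
have vy : v (y ^+ p - y) <= v pi.
  have -> : y ^+ p - y = (c ^+ p - c) - ((y + n%:R) ^+ p -
    (y ^+ p + n%:R ^+ p)) - (n%:R ^+ p - n%:R).
    by rewrite /y subrK; ring.
  apply: (vB_le hv).
    apply: (vB_le hv) => //; apply: v_freshman; first exact: ltW.
    exact: (v_nat hv).
  exact/v_fermat/zpmodZ/(sp_nat (zf_sub hf)).
exists n%:R; first exact: (sp_nat (zf_sub hf)).
rewrite expr1 -/y; have [->|y0] := eqVneq y 0; first by rewrite (v0 hv) vpi_ge0.
have lt : v (- y ^+ p) < v y.
  rewrite (vN hv) (vX hv); case: p (prime_gt1 hp) => [|[|k]] // _.
  by rewrite exprS gtr_pMr ?(v_gt0 hv) // exprn_ilt1 ?(v_ge0 hv).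
by move: vy; rewrite (vB_sym hv) (vD_eq hv).
Qed.

Definition frob s : pseries E := fun n => s n ^+ p.
Definition ps_XP : pseries E := ps_X E ^+ p.

Lemma p_gt0 : (0 < p)%N. Proof. exact: prime_gt0. Qed.

Lemma ps_XP0 : ps_XP 0%N = 0.
Proof. by rewrite /ps_XP ps_XX; case: p p_gt0. Qed.

Lemma ps_comp_XP s n :
  ps_comp s ps_XP n = if (p %| n)%N then s (n %/ p)%N else 0.
Proof.
rewrite ps_compE ?ps_XP0 //; under eq_bigr => k _ do
  rewrite /ps_XP -exprM ps_XX.
case: ifP => [/dvdnP[m ->]|Hn].
  rewrite mulnK ?p_gt0 //.
  have lt : (m < (m * p).+1)%N by rewrite ltnS leq_pmulr ?p_gt0.
  rewrite (bigD1 (Ordinal lt)) //= [(p * m)%N]mulnC eqxx mulr1.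
  rewrite big1 ?addr0 // => i ne.
  case: eqP => [e|]; last by rewrite mulr0.
  case/eqP: ne; apply: val_inj => /=; move/eqP: e.
  by rewrite [(p * i)%N]mulnC eqn_pmul2r ?p_gt0 // => /eqP e; apply: esym.
rewrite big1 // => i _; case: eqP => [e|]; last by rewrite mulr0.
by move: Hn; rewrite [X in (_ %| X)%N]e dvdn_mulr.
Qed.

Lemma ps_le_XP : ps_le v 1 ps_XP.
Proof. by move=> n; rewrite /ps_XP ps_XX (v_nat hv). Qed.

Lemma cong_XP_inj r s t :
  ps_cong v r (ps_comp s ps_XP) (ps_comp t ps_XP) -> ps_cong v r s t.
Proof.
by move=> H n; have := H (n * p)%N; rewrite !ps_comp_XP dvdn_mull // mulnK ?p_gt0.
Qed.

(** The freshman's dream for a sum of monomials. It applies to finite sums, so [s] is truncated and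
    the ideal is taken in the polynomials with integral coefficients. *)
Lemma cong_frob s : ps_le v 1 s -> ps_cong v (v pi) (s ^+ p) (ps_comp (frob s) ps_XP).
Proof.
move=> Hs n.
rewrite (psX_trunc _ _ (ltnSn n)) /ps_trunc poly_def.
have hP : subring_pred (fun q : {poly E} => forall i, v q`_i <= 1).
  split=> [i|x y hx hy i|x y hx hy i].
  - by rewrite coef1; exact: (v_nat hv).
  - by rewrite coefB; apply: (vB_le hv).
  - rewrite coefM; apply: (sp_sum (subring_vint hv)) => j _.
    by apply: (spM (subring_vint hv)); [exact: hx|exact: hy].
set I := fun q : {poly E} => forall i, v q`_i <= v pi.
have I0 : I 0 by move=> i; rewrite coef0 (v0 hv) vpi_ge0.
have ID x y : I x -> I y -> I (x + y).
  by move=> hx hy i; rewrite coefD; apply: (vD_le hv).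
have IM (x y : {poly E}) : (forall i, v x`_i <= 1) -> I y -> I (x * y).
  move=> hx hy i; rewrite coefM; apply: (v_sum hv) => [|j _].
    exact: vpi_ge0.
  by rewrite (vM hv) -[v pi]mul1r ler_pM ?(v_ge0 hv).
have Ip : I p%:R.
  by move=> i; rewrite coefMn coef1 -mulrnA; case: (i == 0%N);
    rewrite ?mul0n ?(v0 hv) ?vpi_ge0 // mul1n (zf_p hf).
have hs i j : v (s i *: 'X^i)`_j <= 1.
  rewrite coefZ coefXn.
  by apply: (spM (subring_vint hv)); [exact: Hs|exact: (v_nat hv)].
have -> : ps_comp (frob s) ps_XP n = (\sum_(i < n.+1) (s i *: 'X^i) ^+ p)`_n.
  rewrite coef_sum ps_compE ?ps_XP0 //; apply: eq_bigr => i _.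
  by rewrite exprZn coefZ /ps_XP -!exprM coefXn ps_XX mulnC.
rewrite -coefB.
exact: (freshman_sum hP hp I0 ID IM Ip (index_enum 'I_n.+1) (F := fun i => s i *: 'X^i)).
Qed.

Lemma frob_zpmod1 s : (forall n, zpmod 1 (s n)) -> ps_cong v (v pi) (frob s) s.
Proof. by move=> H n; apply: v_fermat. Qed.

Lemma cong_expp s : (forall n, zpmod 1 (s n)) ->
  ps_cong v (v pi) (s ^+ p) (ps_comp s ps_XP).
Proof.
move=> H; have Hs : ps_le v 1 s by move=> n; apply: zpmod_int (H n).
apply: (cong_trans hv (cong_frob Hs)).
apply: (cong_comp_l hv); [exact: ps_XP0|exact: ps_le_XP|exact: frob_zpmod1].
Qed.

End Frame.

(** * The logarithm and the invariants of [u] modulo [pi] *)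

Section Iterates.
Variable A : comNzRingType.
Implicit Types s t : pseries A.

Lemma ps_iterS n s : ps_iter n.+1 s = ps_comp s (ps_iter n s).
Proof. by []. Qed.

Lemma ps_iter0 n s : s 0%N = 0 -> ps_iter n s 0%N = 0.
Proof. by move=> s0; elim: n => // n IH; rewrite ps_iterS ps_comp_00. Qed.

Lemma ps_iter1 n s : s 0%N = 0 -> ps_iter n s 1%N = s 1%N ^+ n.
Proof.
move=> s0; elim: n => [|n IH]; first by rewrite expr0.
by rewrite ps_iterS ps_comp_1 ?ps_iter0 // IH exprS.
Qed.

Lemma ps_iter_comm n s t : s 0%N = 0 -> t 0%N = 0 ->
  ps_comp s t = ps_comp t s -> ps_comp s (ps_iter n t) = ps_comp (ps_iter n t) s.
Proof.
move=> s0 t0 st; elim: n => [|n IH]; first by rewrite ps_comp_X ps_Xcomp.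
by rewrite ps_iterS -ps_compA ?ps_iter0 // st !ps_compA ?ps_iter0 // IH.
Qed.

Lemma ps_iterSr n s : s 0%N = 0 -> ps_iter n.+1 s = ps_comp (ps_iter n s) s.
Proof. by move=> s0; rewrite ps_iterS ps_iter_comm. Qed.

Lemma ps_iterD m n s : s 0%N = 0 ->
  ps_iter (m + n) s = ps_comp (ps_iter m s) (ps_iter n s).
Proof.
move=> s0; elim: m => [|m IH]; first by rewrite ps_Xcomp ?ps_iter0.
by rewrite addSn !ps_iterS IH ps_compA ?ps_iter0.
Qed.

Lemma ps_iterM m n s : s 0%N = 0 -> ps_iter (m * n) s = ps_iter m (ps_iter n s).
Proof.
by move=> s0; elim: m => // m IH; rewrite mulSn ps_iterD // IH.
Qed.

Lemma ps_comp_scale c s t : t 0%N = 0 ->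
  ps_comp (ps_const c * s) t = ps_const c * ps_comp s t.
Proof. by move=> t0; rewrite ps_compM // ps_comp_const. Qed.

Lemma ps_constMM c d : ps_const (c * d) = ps_const c * ps_const d :> pseries A.
Proof.
by apply: psP => n; rewrite ps_const_mul; case: n => [|n] //=; rewrite mulr0.
Qed.

Lemma ps_const1 : ps_const 1 = 1 :> pseries A.
Proof. by apply: psP => -[|n]; rewrite ps1. Qed.

Lemma ps_deriv_scale c s : ps_deriv (ps_const c * s) = ps_const c * ps_deriv s.
Proof. by apply: psP => n; rewrite /ps_deriv !ps_const_mul mulrnAr. Qed.

Lemma ps_mulE_comp s t r n : t 0%N = 0 ->
  (ps_comp s t * r) n = \sum_(k < n.+1) s k * (t ^+ k * r) n.
Proof.
move=> t0; rewrite psM.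
under eq_bigr => i _ do rewrite (@ps_compEw _ n.+1) // mulr_suml.
rewrite exchange_big /=; apply: eq_bigr => k _; rewrite psM mulr_sumr.
by apply: eq_bigr => i _; rewrite mulrA.
Qed.

Lemma coef_psXn_mul m s n :
  (ps_X A ^+ m * s) n = if (n < m)%N then 0 else s (n - m)%N.
Proof.
rewrite psM; case: ltnP => h.
  by rewrite big1 // => i _; rewrite ps_XX; case: eqP => [e|]; rewrite ?mul0r //;
    have := leq_ord i; lia.
rewrite (bigD1 (Ordinal (h : (m < n.+1)%N))) //= ps_XX eqxx mul1r.
rewrite big1 ?addr0 // => i ne; rewrite ps_XX; case: eqP => [e|]; rewrite ?mul0r //.
by case/eqP: ne; apply: val_inj.
Qed.

End Iterates.

Section Archimedean.
Variable R : realType.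

(** Bernoulli's inequality for [r^-1 = 1 + h], combined with the archimedean property. *)
Lemma exp_small (r e : R) : 0 <= r -> r < 1 -> 0 < e -> exists n, r ^+ n < e.
Proof.
move=> r0 r1 e0; have [->|rn0] := eqVneq r 0.
  by exists 1%N; rewrite expr1.
have rp : 0 < r by rewrite lt_neqAle eq_sym rn0.
set h := r^-1 - 1.
have h0 : 0 < h by rewrite subr_gt0 invf_gt1.
have B n : n%:R * h <= r^-1 ^+ n.
  elim: n => [|n IH]; first by rewrite mul0r expr0.
  have r1' : 1 <= r^-1 ^+ n by rewrite exprn_ege1 // ltW // invf_gt1.
  rewrite exprS -natr1 mulrDl mul1r.
  have -> : r^-1 * r^-1 ^+ n = r^-1 ^+ n + h * r^-1 ^+ n by rewrite /h; ring.
  by rewrite lerD // ler_peMr // ltW.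
have := archi_boundP (ltW (divr_gt0 (ltr01 : 0 < 1 :> R) (mulr_gt0 e0 h0))).
set N := Num.bound _ => HN; exists N.
have := B N; rewrite exprVn => HB.
have : e^-1 < (r ^+ N)^-1.
  apply: lt_le_trans HB; move: HN; rewrite div1r invfM.
  by rewrite ltr_pdivrMr.
by rewrite ltf_pV2 // posrE exprn_gt0.
Qed.

Lemma le_exp_eq0 (r x : R) : 0 <= r -> r < 1 -> 0 <= x ->
  (forall n, x <= r ^+ n) -> x = 0.
Proof.
move=> r0 r1 x0 H; apply/eqP; rewrite eq_le x0 andbT leNgt; apply/negP => xp.
by have [n Hn] := exp_small r0 r1 xp; have := H n; rewrite leNgt Hn.
Qed.
End Archimedean.

Section Dynamics.
Variables (R : realType) (E : fieldType) (v : E -> R).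
Hypothesis hv : nonarch_abs v.
Variables (p : nat) (Z : E -> Prop) (pi : E).
Hypothesis hf : zp_frame v p Z pi.
Let hp := zf_prime hf.
Implicit Types (s t : pseries E) (c d : E).
Notation XP := (ps_XP E p).
Notation vpi0 := (vpi_ge0 hv hf).
Notation vpi1 := (vpi_le1 hf).

(** In this bundle [dyn_f'] is what remains of the simplicity of the roots. All of it survives
    conjugation by an invertible integral series and isometric extension of the field. *)
Record dyn (f u : pseries E) : Prop := Dyn {
  dyn_f0 : f 0%N = 0; dyn_u0 : u 0%N = 0;
  dyn_f : ps_le v 1 f; dyn_u : ps_le v 1 u;
  dyn_f1 : f 1%N = pi; dyn_u1 : Z (u 1%N); dyn_vu1 : v (u 1%N) = 1;
  dyn_nt : forall n, (0 < n)%N -> u 1%N ^+ n <> 1;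
  dyn_comm : ps_comp f u = ps_comp u f;
  dyn_f' : ps_le v (v pi) (ps_deriv f) }.

Lemma natr_neq0 n : (n.+1%:R : E) != 0.
Proof.
elim/ltn_ind: n => n IH.
have [/dvdnP[m e]|nd] := boolP (p %| n.+1)%N; last first.
  by rewrite -(v_eq0 hv) (zf_nat hf nd) oner_eq0.
rewrite e natrM mulf_neq0 //; last by rewrite -(v_eq0 hv) (zf_p hf) (v_eq0 hv) (zf_pi0 hf).
case: m e => // m e; apply: IH.
by have := prime_gt1 hp; nia.
Qed.

Lemma deriv_inj s t : s 0%N = t 0%N -> ps_deriv s = ps_deriv t -> s = t.
Proof.
move=> e0 e; apply: psP => -[//|n].
have := congr1 (@^~ n) e; rewrite /ps_deriv => en.
by apply: (mulIf (natr_neq0 n)); rewrite !mulr_natr.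
Qed.

Section Log.
Variables f u : pseries E.
Hypothesis hd : dyn f u.
Let f0 := dyn_f0 hd.
Let u0 := dyn_u0 hd.

(** The series [f' / pi], integral by [dyn_f'] and with constant term 1, hence a unit. *)
Definition dlam : pseries E := ps_const pi^-1 * ps_deriv f.
Lemma dlamE : ps_deriv f = ps_const pi * dlam.
Proof.
by rewrite /dlam mulrA -ps_constMM divff ?(zf_pi0 hf) // ps_const1 mul1r.
Qed.
Lemma dlam_int : ps_le v 1 dlam.
Proof.
move=> n; rewrite /dlam ps_const_mul (vM hv) (vV hv).
by rewrite mulrC ler_pdivrMr ?(vpi_gt0 hv hf) // mul1r (dyn_f' hd).
Qed.
Lemma dlam0 : dlam 0%N = 1.
Proof. by rewrite /dlam ps_const_mul /ps_deriv mulr1n (dyn_f1 hd) mulVf ?(zf_pi0 hf). Qed.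

Lemma v_1subpi n : v (1 - pi ^+ n.+1) = 1.
Proof.
rewrite (vD_eq hv) (v1 hv) // (vN hv) (vX hv) exprn_ilt1 ?vpi0 //.
exact: zf_pi1 hf.
Qed.

(** The equation is the derivative of [L(f) = pi L]. Working with [ell = L'] avoids the denominators
    of [L]: the coefficient of index [n] of [f^n * dlam] is [pi^n], so [ell n] is found by dividing
    by [1 - pi^n], a unit for [n > 0], while [ell 0] is free and set to 1. *)
Lemma dlog_exists : exists ell : pseries E, [/\ ell 0%N = 1, ps_le v 1 ell
  & ps_comp ell f * dlam = ell].
Proof.
have [ell H] := @series_rec E 0 (fun n ell => if n is m.+1 then
   (\sum_(k < n) ell k * (f ^+ k * dlam) n) / (1 - pi ^+ n) else 1)
   (fun n s1 s2 H => match n return (forall k, (k < n)%N -> s1 k = s2 k) ->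
     (if n is m.+1 then (\sum_(k < n) s1 k * (f ^+ k * dlam) n) / (1 - pi ^+ n)
      else 1) =
     (if n is m.+1 then (\sum_(k < n) s2 k * (f ^+ k * dlam) n) / (1 - pi ^+ n)
      else 1) with
   | 0 => fun _ => erefl
   | m.+1 => fun H => congr1 (fun z => z / (1 - pi ^+ m.+1))
      (eq_bigr _ (fun i _ => congr1 (fun z => z * _) (H _ (ltn_ord i)))) end H).
exists ell; split; first by rewrite H.
  elim/ltn_ind => -[|n] IH; rewrite H; first by rewrite (v1 hv).
  rewrite (vM hv) (vV hv) v_1subpi invr1 mulr1.
  apply: (sp_sum (subring_vint hv)) => i _; apply: (spM (subring_vint hv)).
    exact: IH.
  apply: (sp_psM (subring_vint hv)); last exact: dlam_int.
  exact: (ps_leX hv _ (dyn_f hd)).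
apply: psP => n; rewrite ps_mulE_comp // big_ord_recr /=.
have -> : (f ^+ n * dlam) n = pi ^+ n.
  rewrite psM big_ord_recr /= subnn dlam0 mulr1 psX_diag // (dyn_f1 hd).
  by rewrite big1 ?add0r // => i _; rewrite psX_lt // mul0r.
case: n => [|n]; first by rewrite big_ord0 add0r expr0 mulr1.
have n0 : 1 - pi ^+ n.+1 != 0 by rewrite -(v_eq0 hv) v_1subpi oner_eq0.
have -> : \sum_(i < n.+1) ell i * (f ^+ i * dlam) n.+1
   = ell n.+1 * (1 - pi ^+ n.+1) by rewrite [ell n.+1]H divfK.
by ring.
Qed.

(** If the coefficients below [n >= 2] vanish, index [n] reads [s n * pi^n = pi * s n], and [pi^n]
    differs from [pi]. This is the uniqueness of the logarithm once its linear coefficient is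
    given. *)
Lemma ps_semilinear_eq0 s : s 0%N = 0 -> s 1%N = 0 ->
  ps_comp s f = ps_const pi * s -> s = 0.
Proof.
move=> s0 s1 e; apply: psP => n; rewrite ps0.
elim/ltn_ind: n => -[|[|n]] IH //.
have := congr1 (@^~ n.+2) e; rewrite ps_const_mul ps_compE // big_ord_recr /=.
rewrite big1 ?add0r; last by move=> i _; rewrite IH // mul0r.
rewrite psX_diag // (dyn_f1 hd) => e1.
have : s n.+2 * pi * (1 - pi ^+ n.+1) = 0.
  have -> : s n.+2 * pi * (1 - pi ^+ n.+1) = pi * s n.+2 - s n.+2 * pi ^+ n.+2.
    by rewrite [in RHS]exprS; ring.
  by rewrite e1 subrr.
move/eqP; rewrite !mulf_eq0 (negbTE (zf_pi0 hf)) orbF => /orP[/eqP //|].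
by rewrite -(v_eq0 hv) v_1subpi oner_eq0.
Qed.

Lemma log_exists : exists L : pseries E, [/\ L 0%N = 0, L 1%N = 1, ps_le v 1 (ps_deriv L),
  ps_comp L f = ps_const pi * L & ps_comp L u = ps_const (u 1%N) * L].
Proof.
have [ell [l0 l1 le]] := dlog_exists.
pose L : pseries E := fun n => if n is m.+1 then ell m / n%:R else 0.
have L' : ps_deriv L = ell.
  by apply: psP => n; rewrite /ps_deriv /L -[LHS]mulr_natr divfK ?natr_neq0.
have L1 : L 1%N = 1 by rewrite /L l0 divr1.
have Lf : ps_comp L f = ps_const pi * L.
  apply: deriv_inj; first by rewrite ps_comp_00 // ps_const_mul mulr0.
  by rewrite ps_deriv_comp // ps_deriv_scale L' dlamE mulrCA le.
exists L; split=> //; first by rewrite L'.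
(* As [u] commutes with [f], the difference [L(u) - u'(0) L] satisfies the same equation as [L]; it
   has no linear term, so it is zero. *)
apply/eqP; rewrite -subr_eq0; apply/eqP; apply: ps_semilinear_eq0.
- by rewrite psB ps_comp_00 // ps_const_mul mulr0 subrr.
- by rewrite psB ps_comp_1 // ps_const_mul L1 mul1r mulr1 subrr.
rewrite ps_compB // ps_comp_scale // Lf mulrBr !mulrA [ps_const (u 1%N) * _]mulrC.
congr (_ - _).
by rewrite ps_compA // -(dyn_comm hd) -ps_compA // Lf ps_comp_scale.
Qed.

Lemma dlog_props : exists ell : pseries E, [/\ ell 0%N = 1, ps_le v 1 ell,
  ps_comp ell f * dlam = ell &
  ps_comp ell u * ps_deriv u = ps_const (u 1%N) * ell].
Proof.
have [L [L0 L1 L' Lf Lu]] := log_exists.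
exists (ps_deriv L); split => //.
- have pi0 : ps_const pi * ps_const pi^-1 = 1 :> pseries E.
    by rewrite -ps_constMM divff ?(zf_pi0 hf) // ps_const1.
  have := congr1 (@ps_deriv E) Lf; rewrite ps_deriv_comp // ps_deriv_scale.
  rewrite dlamE mulrCA => /(congr1 (fun z => ps_const pi^-1 * z)).
  by rewrite !mulrA [_ * ps_const pi]mulrC pi0 !mul1r.
- by have := congr1 (@ps_deriv E) Lu; rewrite ps_deriv_comp // ps_deriv_scale.
Qed.

End Log.

Section Invariants.
Variables f u : pseries E.
Hypothesis hd : dyn f u.
Let f0 := dyn_f0 hd.
Let u0 := dyn_u0 hd.
Hypothesis hX : ps_cong v (v pi) f XP.

Lemma ps_div_pi k s : ps_le v (v pi ^+ k) s ->
  exists t, ps_le v 1 t /\ s = ps_const (pi ^+ k) * t.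
Proof.
move=> H; exists (ps_const (pi ^+ k)^-1 * s); split.
  move=> n; rewrite ps_const_mul (vM hv) (vV hv) (vX hv).
  by rewrite mulrC ler_pdivrMr ?(vpiX_gt0 hv hf) // mul1r.
by rewrite mulrA -ps_constMM divff ?expf_neq0 ?(zf_pi0 hf) // ps_const1 mul1r.
Qed.

Lemma ps_le_scale c r s : ps_le v r s -> ps_le v (v c * r) (ps_const c * s).
Proof.
by move=> H n; rewrite ps_const_mul (vM hv) ler_wpM2l ?(v_ge0 hv).
Qed.

Lemma ps_le_unscale c r s : c != 0 -> ps_le v (v c * r) (ps_const c * s) -> ps_le v r s.
Proof.
move=> c0 H n; have := H n; rewrite ps_const_mul (vM hv).
by rewrite ler_pM2l // (v_gt0 hv).
Qed.

Lemma cong_comp_f s : ps_le v 1 s -> ps_cong v (v pi) (ps_comp s f) (ps_comp s XP).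
Proof.
move=> hs; apply: (cong_comp_r hv) => //; first exact: vpi1.
  exact: (ps_XP0 hf).
exact: (ps_le_XP hv _).
Qed.

(* [f = X ^ p] modulo [pi], and substituting [X ^ p] is injective. *)
Lemma cong_comp_f_inj k s : ps_le v (v pi ^+ k) s ->
  ps_le v (v pi ^+ k.+1) (ps_comp s f) -> ps_le v (v pi ^+ k.+1) s.
Proof.
move=> /ps_div_pi[t [ht ->]] H.
rewrite exprSr -(vX hv); apply: ps_le_scale.
rewrite ps_comp_scale // exprSr -(vX hv) in H.
have {}H := ps_le_unscale (expf_neq0 _ (zf_pi0 hf)) H.
have : ps_cong v (v pi) (ps_comp t XP) (ps_comp 0 XP).
  apply: (cong_trans hv (cong_sym hv (cong_comp_f ht))) => n.
  have -> : ps_comp 0 XP n = 0 by rewrite (ps_comp_XP hf) if_same.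
  by rewrite subr0.
by move/(cong_XP_inj hf) => h n; have := h n; rewrite subr0.
Qed.

(** If [pi^k] divides [w - X], then [pi^(k+1)] divides [f(w) - f(X)], because [pi] divides [f'].
    This difference is also [(w - X)(f)], and composition with [f] is injective modulo [pi], so
    [w - X] gains a factor [pi], indefinitely. *)
Lemma comm_cong_X (w : pseries E) : w 0%N = 0 -> ps_le v 1 w -> ps_comp f w = ps_comp w f ->
  ps_cong v (v pi) w (ps_X E) -> w = ps_X E.
Proof.
move=> w0 hw fw H.
have X1 : ps_le v 1 (ps_X E) by move=> n; exact: (v_nat hv).
have Hk k : ps_le v (v pi ^+ k.+1) (w - ps_X E).
  elim: k => [|k IH]; first by rewrite expr1.
  apply: cong_comp_f_inj => //.
  rewrite ps_compB // ps_Xcomp // -fw -{2}(ps_comp_X f) exprS.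
  have -> : w = ps_X E + (w - ps_X E) by ring.
  apply: (cong_comp_small hv) => //.
  - by rewrite psB w0 subr0.
  - exact: dyn_f hd.
  - exact: dyn_f' hd.
  - by rewrite exprS ler_piMr ?vpi0 // (vpiX_le1 hv hf).
  - exact: (vpiX_le1 hv hf).
apply: psP => n; apply/eqP; rewrite -subr_eq0 -(v_eq0 hv); apply/eqP.
apply: (le_exp_eq0 vpi0 (zf_pi1 hf)) => [|k]; first exact: (v_ge0 hv).
exact: le_trans (Hk k n) (vpiX_leS hv hf k).
Qed.

Hypothesis hu : forall n, zpmod v Z pi 1 (u n).

(** Modulo [pi] the element is a natural number [n], which is a unit or a multiple of [p]; a
    ramified [O] does have absolute values in between. *)
Lemma zpmod1_unit c : zpmod v Z pi 1 c -> v pi < v c -> v c = 1.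
Proof.
case=> z Zz; rewrite expr1 => Hz lt; have [n Hn] := zf_res hf Zz.
have Hc : v (c - n%:R) <= v pi.
  have -> : c - n%:R = (c - z) + (z - n%:R) by ring.
  exact: (vD_le hv).
have [/dvdnP[m e]|nd] := boolP (p %| n)%N.
  have : v c <= v pi.
    rewrite -(subrK n%:R c); apply: (vD_le hv) => //.
    rewrite e natrM (vM hv) (zf_p hf) -[X in _ <= X]mul1r.
    by rewrite ler_pM ?(v_ge0 hv) ?vpi0 // (v_nat hv).
  by rewrite leNgt lt.
rewrite -(subrK n%:R c) addrC (vD_eq hv) (zf_nat hf nd) //.
exact: le_lt_trans Hc (zf_pi1 hf).
Qed.

Lemma zpmod1_iter N n : zpmod v Z pi 1 (ps_iter N u n).
Proof.
elim: N n => [|N IH] n.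
  apply: (zpmodZ hv hf); rewrite /ps_iter /= /ps_X; exact: (sp_nat (zf_sub hf)).
by rewrite ps_iterS; apply: (sp_comp (zpmod_sub hv hf 1)); rewrite ?ps_iter0.
Qed.

Lemma iter_neqX N : (0 < N)%N -> exists i, v pi < v (ps_iter N u i - ps_X E i).
Proof.
move=> N0; apply/not_existsP => H.
have : ps_iter N u = ps_X E.
  apply: comm_cong_X.
  - by rewrite ps_iter0.
  - by move=> n; apply: (zpmod_int hv hf (zpmod1_iter N n)).
  - by rewrite ps_iter_comm // (dyn_comm hd).
  - by move=> n; rewrite leNgt; apply/negP.
move/(congr1 (@^~ 1%N)); rewrite ps_iter1 // /ps_X eqxx.
exact: (dyn_nt hd N0).
Qed.

(** The ramification filtration of the group of series under composition, taken modulo [pi]. *)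
Definition near_id r (w : pseries E) :=
  forall i, (i <= r)%N -> v (w i - ps_X E i) <= v pi.

(** On a graded piece of the filtration, composition becomes addition of the first coefficients that
    can differ from those of [X]. *)
Lemma near_id_comp r (w y : pseries E) : (0 < r)%N -> w 0%N = 0 -> ps_le v 1 w -> ps_le v 1 y ->
  near_id r w -> near_id r y ->
  near_id r (ps_comp y w) /\
  v (ps_comp y w r.+1 - (w r.+1 + y r.+1)) <= v pi.
Proof.
move=> r0 w0 hw hy nw ny.
have Hdiff i : (i <= r.+1)%N ->
   v (ps_comp y w i - (w i + (i == r.+1)%:R * y r.+1)) <= v pi.
  case: r r0 nw ny => // q _ nw ny ir; rewrite (@ps_compEw _ q.+3) // big_ord_recr /=.
  rewrite big_ord_recl big_ord_recl /= /bump /=.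
  have h1 : v (y 1%N - 1) <= v pi by have := ny 1%N isT; rewrite /ps_X.
  have h0 : v (y 0%N) <= v pi by have := ny 0%N (leq0n _); rewrite /ps_X subr0.
  have w1 : v (w 1%N - 1) <= v pi by have := nw 1%N isT; rewrite /ps_X.
  set S := \sum_(_ < _) _.
  have hS : v S <= v pi.
    apply: (v_sum hv) => [|j _]; first exact: vpi0.
    rewrite (vM hv) -[v pi]mulr1 ler_pM ?(v_ge0 hv) //; last exact: (ps_leX hv).
    by have := ny (1 + (1 + j))%N; rewrite /ps_X /= subr0; apply; have := ltn_ord j; lia.
  rewrite addn0 expr1.
  have hl : v ((w ^+ q.+2) i - (i == q.+2)%:R) <= v pi.
    move: ir; rewrite leq_eqVlt => /orP[/eqP ->|lt].
      rewrite eqxx psX_diag // subrX1 (vM hv) -[v pi]mulr1.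
      rewrite ler_pM ?(v_ge0 hv) //.
      apply: (sp_sum (subring_vint hv)) => j _; apply: (spX (subring_vint hv)).
      exact: hw.
    by rewrite psX_lt // ltn_eqF // subrr (v0 hv) vpi0.
  have -> : y 0%N * (w ^+ 0) i + (y 1%N * w i + S) + y q.+2 * (w ^+ q.+2) i
     - (w i + (i == q.+2)%:R * y q.+2)
    = y 0%N * (w ^+ 0) i + ((y 1%N - 1) * w i + S)
      + y q.+2 * ((w ^+ q.+2) i - (i == q.+2)%:R) by ring.
  apply: (vD_le hv); last first.
    by rewrite (vM hv) -[v pi]mul1r ler_pM ?(v_ge0 hv).
  apply: (vD_le hv).
    by rewrite (vM hv) -[v pi]mulr1 ler_pM ?(v_ge0 hv) //; apply: (ps_leX hv).
  apply: (vD_le hv) => //.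
  by rewrite (vM hv) -[v pi]mulr1 ler_pM ?(v_ge0 hv).
split; last by have := Hdiff r.+1 (leqnn _); rewrite eqxx mul1r.
move=> i ir; have := Hdiff i (leqW ir); rewrite ltn_eqF ?ltnS // mul0r addr0 => H.
rewrite -(subrK (w i) (ps_comp y w i)) -addrA; apply: (vD_le hv) => //.
exact: nw.
Qed.

(** By Fermat [u'(0)^(p-1) = 1] modulo [pi], which explains the initial [p.-1]. After that, a
    [p]-fold iterate multiplies the next coefficient by [p], which kills it modulo [pi]. *)
Lemma near_id_iter r : exists2 N, (0 < N)%N & near_id r.+1 (ps_iter N u).
Proof.
elim: r => [|r [N N0 IH]].
  exists p.-1; first by have := prime_gt1 hp; lia.
  move=> [|[|//]] _; first by rewrite ps_iter0 // subrr (v0 hv) vpi0.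
  rewrite ps_iter1 // /ps_X eqxx.
  have := v_fermat hv hf (zpmodZ hv hf 1 (dyn_u1 hd)).
  case: p (prime_gt1 hp) => // q _ /=.
  have -> : u 1%N ^+ q.+1 - u 1%N = u 1%N * (u 1%N ^+ q - 1) by rewrite exprS; ring.
  by rewrite (vM hv) (dyn_vu1 hd) mul1r.
set w := ps_iter N u in IH.
have w0 : w 0%N = 0 by rewrite /w ps_iter0.
have hw n : ps_le v 1 (ps_iter n w).
  by move=> i; rewrite -ps_iterM //; apply: (zpmod_int hv hf (zpmod1_iter _ i)).
have hw1 : ps_le v 1 w by move=> i; apply: (zpmod_int hv hf (zpmod1_iter _ i)).
have Hm m : near_id r.+1 (ps_iter m w) /\
   v (ps_iter m w r.+2 - m%:R * w r.+2) <= v pi.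
  elim: m => [|m [H1 H2]].
    split; first by move=> i _; rewrite subrr (v0 hv) vpi0.
    by rewrite mul0r subr0 (v0 hv) vpi0.
  rewrite ps_iterSr //.
  have [H3 H4] := near_id_comp (ltn0Sn r) w0 hw1 (hw m) IH H1.
  split=> //.
  have -> : ps_comp (ps_iter m w) w r.+2 - m.+1%:R * w r.+2 =
    (ps_comp (ps_iter m w) w r.+2 - (w r.+2 + ps_iter m w r.+2))
    + (ps_iter m w r.+2 - m%:R * w r.+2) by rewrite -natr1; ring.
  exact: (vD_le hv).
exists (p * N)%N; first by rewrite muln_gt0 (prime_gt0 hp).
rewrite ps_iterM // => i; rewrite leq_eqVlt => /orP[/eqP ->|lt].
  rewrite /ps_X subr0 -(subrK (p%:R * w r.+2) (ps_iter p w r.+2)).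
  apply: (vD_le hv); first by case: (Hm p).
  rewrite (vM hv) (zf_p hf) -[X in _ <= X]mulr1 ler_pM ?(v_ge0 hv) //.
by case: (Hm p) => H _; apply: H.
Qed.

Lemma exp_add1 (A : comNzRingType) (x : A) i :
  exists q, (1 + x) ^+ i = 1 + i%:R * x + x ^+ 2 * q.
Proof.
elim: i => [|i [q IH]]; first by exists 0; rewrite expr0; ring.
exists (i%:R + (1 + x) * q); rewrite exprS IH -natr1; ring.
Qed.

(** Modulo [pi], [w = X (1 + X^r y)], so [w^i = X^i + i X^(i+r) y] up to terms of order [i + 2r],
    beyond the indices considered. *)
Lemma near_id_exp r (w : pseries E) i j : (0 < r)%N -> ps_le v 1 w -> near_id r w ->
  (j <= i + r)%N ->
  v ((w ^+ i) j - (j == i)%:R - ((j == i + r)%N%:R * (i%:R * w r.+1))) <= v pi.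
Proof.
move=> r0 hw nw ji.
pose y : pseries E := fun n => w (n + r.+1)%N.
have cw : ps_cong v (v pi) w (ps_X E * (1 + ps_X E ^+ r * y)).
  move=> n.
  have -> : ps_X E * (1 + ps_X E ^+ r * y) = ps_X E + ps_X E ^+ r.+1 * y.
    by rewrite exprS; ring.
  rewrite psD coef_psXn_mul; case: ltnP => h; first by rewrite addr0; apply: nw.
  rewrite /y subnK // /ps_X; have -> : (n == 1%N) = false by lia.
  by rewrite add0r subrr (v0 hv) vpi0.
have X1 : ps_le v 1 (ps_X E) by move=> n; exact: (v_nat hv).
have := congX hv i vpi1 hw (cong_sym hv cw) => /(_ j).
rewrite exprMn; have [q ->] := exp_add1 (ps_X E ^+ r * y) i.
have -> : ps_X E ^+ i * (1 + i%:R * (ps_X E ^+ r * y) + (ps_X E ^+ r * y) ^+ 2 * q)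
  = ps_X E ^+ i + ps_X E ^+ (i + r) * (i%:R * y)
    + ps_X E ^+ (i + r + r) * (y ^+ 2 * q).
  by rewrite !exprD; ring.
rewrite !psD !coef_psXn_mul ps_XX; have -> : (j < i + r + r)%N by lia.
rewrite addr0 (vB_sym hv).
have -> : (if (j < i + r)%N then 0 else (i%:R * y) (j - (i + r))%N)
  = (j == i + r)%N%:R * (i%:R * w r.+1).
  case: ltnP => h; first by rewrite ltn_eqF // mul0r.
  have -> : j = (i + r)%N by lia.
  rewrite eqxx subnn mul1r psM0 /y add0n; congr (_ * _).
  by elim: i {ji cw h q} => [|i IH] //; rewrite -natr1 psD IH ps1 -natr1.
by rewrite opprD addrA.
Qed.

(** Indices prime to [p] come first ([claimA]), by comparing one well chosen coefficient of [h(w)]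
    and [h] for an iterate [w] of [u]. Then [h] is a series in [X^p] modulo [pi], whose root is
    again invariant, and the index is divided by [p]. *)
Lemma invariant_const (h : pseries E) : ps_le v 1 h ->
  ps_cong v (v pi) (ps_comp h u) h -> forall n, (0 < n)%N -> v (h n) <= v pi.
Proof.
have invN (g : pseries E) N : ps_le v 1 g -> ps_cong v (v pi) (ps_comp g u) g ->
    ps_cong v (v pi) (ps_comp g (ps_iter N u)) g.
  move=> hg H; elim: N => [|N IH].
    by rewrite ps_comp_X; apply: (cong_refl hv); exact: vpi0.
  rewrite ps_iterSr // -ps_compA ?ps_iter0 //.
  apply: (cong_trans hv (cong_comp_l hv u0 (dyn_u hd) IH) H).
have claimA (g : pseries E) : ps_le v 1 g -> ps_cong v (v pi) (ps_comp g u) g ->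
    forall n, ~~ (p %| n)%N -> v (g n) <= v pi.
  move=> hg Hg; elim/ltn_ind => n IH nd.
  (* Modulo [pi], the iterate [w] agrees with [X] up to degree [n + 1], and [r > n] is its exact
     depth: finite because no iterate of [u] is [X] modulo [pi]. The coefficient [w r.+1] is then a
     unit. *)
  have [N N0 HN] := near_id_iter n.
  set w := ps_iter N u in HN.
  have w0 : w 0%N = 0 by rewrite /w ps_iter0.
  have wZ i : zpmod v Z pi 1 (w i) by apply: zpmod1_iter.
  have hw : ps_le v 1 w by move=> i; apply: (zpmod_int hv hf (wZ i)).
  have exi : exists i, v pi < v (w i - ps_X E i) by apply: iter_neqX.
  case: (ex_minnP exi) => m Hm minm.
  have mn : (n.+1 < m)%N.
    by rewrite ltnNge; apply/negP => le; have := HN m le; rewrite leNgt Hm.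
  have [r em rn] : exists2 r, m = r.+1 & (n < r)%N.
    by exists m.-1; case: m mn {Hm minm}.
  have nr : near_id r w.
    move=> i ir; rewrite leNgt; apply/negP => /minm; rewrite em; lia.
  have vw : v (w r.+1) = 1.
    apply: zpmod1_unit => //; move: Hm; rewrite em /ps_X.
    have er : (r == 0)%N = false by lia.
    by rewrite eqSS er subr0.
  have r0 : (0 < r)%N by lia.
  have n0 : (0 < n)%N by case: n nd {IH HN mn rn} => //; rewrite dvdn0.
  have := invN g N hg Hg (n + r)%N; rewrite -/w.
  (* At index [n + r] of [g(w) - g], the term [i = n] gives [n * g n * w r.+1] modulo [pi]; all
     others, gathered in [S], are shown to be small. *)
  rewrite -{2}(ps_comp_X g) !ps_compE // -sumrB.
  have ltn : (n < (n + r).+1)%N by lia.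
  rewrite (bigD1 (Ordinal ltn)) //=; set S := \sum_(_ < _ | _) _ => H.
  have hS : v S <= v pi.
    apply: (v_sum hv) => [|i ne]; first exact: vpi0.
    rewrite -mulrBr ps_XX.
    have nei : (i : nat) <> n by move=> e; case/eqP: ne; apply: val_inj.
    (* For [i > n], modulo [pi] the series [w^i - X^i] only starts at degree [i + r]. *)
    have [ltni|] := ltnP n i.
      rewrite (vM hv) -[v pi]mul1r ler_pM ?(v_ge0 hv) //.
      have := near_id_exp (j := (n + r)%N) (i := i) r0 hw nr.
      have -> : (n + r == i + r)%N = false by lia.
      by rewrite mul0r subr0; apply; lia.
    move=> lein; have ltin : (i < n)%N by lia.
    have [dpi|ndi] := boolP (p %| i)%N; last first.
      rewrite (vM hv) -[v pi]mulr1 ler_pM ?(v_ge0 hv) //; first exact: IH.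
      by apply: (vB_le hv); [apply: (ps_leX hv)|apply: (v_nat hv)].
    rewrite (vM hv) -[v pi]mul1r ler_pM ?(v_ge0 hv) //.
    have -> : (n + r == i)%N = false by lia.
    rewrite subr0; move: (nat_of_ord i) ltin dpi {ne nei lein} => {}i ltin.
    (* For [i = k * p] the induction says nothing about [g i]. Instead [w^i = w^k(X^p)] modulo [pi]:
       if [n + r = l * p], the coefficient needed is the one of [w^k] at [l], and [k < l < k + r]
       (as [n < r]) makes it vanish. *)
    case/dvdnP=> k ek.
    have [k0|k0] := posnP k.
      have e0 : (n + r == 0)%N = false by lia.
      by rewrite ek k0 mul0n expr0 ps1 e0 (v0 hv) vpi0.
    have wkZ j : zpmod v Z pi 1 ((w ^+ k) j) by apply: (sp_psX (zpmod_sub hv hf 1)).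
    have := cong_expp hv hf wkZ (n + r)%N; rewrite -exprM -ek (ps_comp_XP hf).
    have p1 := prime_gt1 hp.
    case: ifP => [/dvdnP[l el]|_]; last by rewrite subr0.
    rewrite el mulnK ?(prime_gt0 hp) // => H1.
    have kl : (k < l)%N by rewrite -(ltn_pmul2r (prime_gt0 hp)) -el -ek; lia.
    have lk : (l < k + r)%N by rewrite -(ltn_pmul2r (prime_gt0 hp)) mulnDl -el -ek; nia.
    have H2 := near_id_exp (j := l) (i := k) r0 hw nr (ltnW lk).
    rewrite -(subrK ((w ^+ k) l) ((w ^+ i) (l * p)%N)); apply: (vD_le hv) => //.
    move: H2; rewrite (gtn_eqF kl) (ltn_eqF lk) mul0r !subr0; exact.
  have {}H : v (g n * (w ^+ n) (n + r)%N - g n * (ps_X E ^+ n) (n + r)%N) <= v pi.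
    by rewrite -[X in v X](addrK S); apply: (vB_le hv).
  have H2 := near_id_exp (j := (n + r)%N) (i := n) r0 hw nr (leqnn _).
  rewrite eqxx mul1r in H2.
  rewrite -mulrBr ps_XX in H.
  have : v (g n * (n%:R * w r.+1)) <= v pi.
    have -> : g n * (n%:R * w r.+1) = g n * ((w ^+ n) (n + r)%N - (n + r == n)%N%:R)
      - g n * ((w ^+ n) (n + r)%N - (n + r == n)%N%:R - n%:R * w r.+1) by ring.
    apply: (vB_le hv) => //.
    by rewrite (vM hv) -[v pi]mul1r ler_pM ?(v_ge0 hv).
  by rewrite !(vM hv) vw (zf_nat hf nd) !mulr1.
move=> hh Hh n; elim/ltn_ind: n h hh Hh => n IH h hh Hh n0.
have [/dvdnP[m em]|nd] := boolP (p %| n)%N; last exact: claimA.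
have p1 := prime_gt1 hp.
pose g : pseries E := fun i => h (i * p)%N.
have hg : ps_le v 1 g by move=> i; apply: hh.
have gh : ps_cong v (v pi) (ps_comp g XP) h.
  move=> i; rewrite (ps_comp_XP hf); case: ifPn => [/dvdnP[l ->]|nd].
    by rewrite mulnK ?(prime_gt0 hp) // subrr (v0 hv) vpi0.
  by rewrite sub0r (vN hv); apply: claimA.
rewrite em; apply: (IH m _ g) => //; [nia| |lia].
apply: (cong_XP_inj hf).
have XP0 := ps_XP0 hf; have XPi := ps_le_XP hv p.
rewrite ps_compA //.
(* Modulo [pi]: [g(u(X^p)) = g(u^p) = (g(X^p))(u) = h(u) = h = g(X^p)], after which [X^p] is
   cancelled. *)
apply: (cong_trans hv (t := ps_comp g (u ^+ p))).
  apply: (cong_comp_r hv) => //; first exact: vpi1.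
  - by rewrite ps_comp_00.
  - by rewrite psX0 u0 expr0n; case: (p) p1.
  - exact: (ps_leX hv _ (dyn_u hd)).
  - exact: (cong_sym hv (cong_expp hv hf hu)).
have -> : ps_comp g (u ^+ p) = ps_comp (ps_comp g XP) u.
  by rewrite ps_compA // /ps_XP ps_compX // ps_Xcomp.
apply: (cong_trans hv (cong_comp_l hv u0 (dyn_u hd) gh)).
exact: (cong_trans hv Hh (cong_sym hv gh)).
Qed.

End Invariants.
End Dynamics.

(** * Conjugation into [Z_p + pi^J O] *)

Section Descent.
Variables (R : realType) (E : fieldType) (v : E -> R).
Hypothesis hv : nonarch_abs v.
Variables (p : nat) (Z : E -> Prop) (pi : E).
Hypothesis hf : zp_frame v p Z pi.
Let hp := zf_prime hf.
Implicit Types (s t : pseries E) (c d : E).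
Notation XP := (ps_XP E p).
Notation vpi0 := (vpi_ge0 hv hf).
Notation vpi1 := (vpi_le1 hf).
Notation dyn := (dyn v Z pi).
Notation zpm J s := (forall n, zpmod v Z pi J (s n)).

Lemma ps_unit (P : E -> Prop) s : subring_pred P -> (forall n, P (s n)) ->
  s 0%N = 1 -> exists t, [/\ t 0%N = 1, forall n, P (t n) & s * t = 1].
Proof.
move=> hP Ps s0.
have [t Ht] := @series_rec E 0 (fun n t => (n == 0%N)%:R -
   \sum_(k < n) s (n - k)%N * t k) (fun n s1 s2 H => congr1
   (fun z => (n == 0%N)%:R - z)
   (eq_bigr _ (fun i _ => congr1 (fun z => _ * z) (H _ (ltn_ord i))))).
exists t; split.
- by rewrite Ht big_ord0 subr0.
- elim/ltn_ind => n IH; rewrite Ht; apply: (spB hP); first exact: (sp_nat hP).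
  by apply: (sp_sum hP) => i _; apply: (spM hP); [exact: Ps|exact: IH].
- apply: psP => n; rewrite mulrC psM big_ord_recr /= subnn s0 mulr1 Ht ps1.
  rewrite addrC -addrA [X in _ + X]addrC.
  under eq_bigr => i _ do rewrite mulrC.
  by rewrite subrr addr0.
Qed.

Lemma ps_freshman s t : ps_le v 1 s -> ps_le v 1 t ->
  ps_cong v (v pi) ((s + t) ^+ p) (s ^+ p + t ^+ p).
Proof.
have hP : subring_pred (ps_le v 1).
  split=> [n|x y|x y]; first by rewrite ps1; exact: (v_nat hv).
    exact: (ps_leB hv).
  by move=> hx hy; apply: (ps_leMl hv).
apply: (freshman hP hp (I := ps_le v (v pi))).
- by move=> n; rewrite ps0 (v0 hv) vpi0.
- by move=> x y; apply: (ps_leD hv).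
- by move=> x y; apply: (ps_leMl hv).
- move=> n; have -> : (p%:R : pseries E) n = p%:R * (n == 0%N)%:R.
    elim: (p) => [|q IH]; first by rewrite mul0r.
    by rewrite -!natr1 psD IH ps1; ring.
  by rewrite (vM hv) (zf_p hf) -[X in _ <= X]mulr1 ler_pM ?(v_ge0 hv) ?(v_nat hv).
Qed.

Definition good J (f u : pseries E) :=
  [/\ dyn f u, ps_cong v (v pi) f XP, zpm J f & zpm J u].

Definition conj_by (F G s : pseries E) := ps_comp F (ps_comp s G).

Record mutually_inverse (F G : pseries E) : Prop := MutuallyInverse {
  mi_F0 : F 0%N = 0; mi_G0 : G 0%N = 0;
  mi_F : ps_le v 1 F; mi_G : ps_le v 1 G;
  mi_FG : ps_comp F G = ps_X E; mi_GF : ps_comp G F = ps_X E }.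

Lemma inverse_exists (F : pseries E) : F 0%N = 0 -> ps_le v 1 F -> v (F 1%N) = 1 ->
  exists G, mutually_inverse F G.
Proof.
move=> F0 hF F1.
have F1n : F 1%N != 0 by rewrite -(v_eq0 hv) F1 oner_eq0.
have Fi : vint v (F 1%N)^-1 by rewrite /vint (vV hv) F1 invr1.
have [G [G0 _ hG GF FG]] := ps_inv (subring_vint hv) hF F0 F1n Fi.
by exists G.
Qed.

Section Conj.
Variables F G : pseries E.
Hypothesis hm : mutually_inverse F G.
Let F0 := mi_F0 hm.
Let G0 := mi_G0 hm.

Lemma conj_by0 s : s 0%N = 0 -> conj_by F G s 0%N = 0.
Proof. by move=> s0; rewrite /conj_by !ps_comp_00. Qed.
Lemma conj_by_int s : s 0%N = 0 -> ps_le v 1 s -> ps_le v 1 (conj_by F G s).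
Proof.
move=> s0 hs; rewrite /conj_by; apply: (ps_le_comp hv); first by rewrite ps_comp_00.
  exact: mi_F hm.
apply: (ps_le_comp hv) => //; exact: mi_G hm.
Qed.
Lemma mi_FG1 : F 1%N * G 1%N = 1.
Proof. by rewrite -ps_comp_1 // (mi_FG hm). Qed.
Lemma conj_by1 s : s 0%N = 0 -> conj_by F G s 1%N = s 1%N.
Proof.
move=> s0; rewrite /conj_by ps_comp_1 ?ps_comp_00 // ps_comp_1 //.
by rewrite mulrCA mi_FG1 mulr1.
Qed.
Lemma conj_byF s : s 0%N = 0 -> ps_comp (conj_by F G s) F = ps_comp F s.
Proof.
move=> s0; rewrite /conj_by ps_compA ?ps_comp_00 // (ps_compA s) // (mi_GF hm).
by rewrite ps_comp_X.
Qed.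
Lemma conj_by_comp s t : s 0%N = 0 -> t 0%N = 0 ->
  ps_comp (conj_by F G s) (conj_by F G t) = conj_by F G (ps_comp s t).
Proof.
move=> s0 t0; rewrite /conj_by -(@ps_compA _ _ F) ?ps_comp_00 //.
by rewrite -/(conj_by F G s) conj_byF // !ps_compA ?ps_comp_00.
Qed.
Lemma dyn_conj (f u : pseries E) : dyn f u -> dyn (conj_by F G f) (conj_by F G u).
Proof.
move=> hd; have f0 := dyn_f0 hd; have u0 := dyn_u0 hd.
have hf1 := dyn_f hd; have hu1 := dyn_u hd.
split; rewrite ?conj_by1 ?conj_by0 //.
- exact: conj_by_int.
- exact: conj_by_int.
- exact: dyn_f1 hd.
- exact: dyn_u1 hd.
- exact: dyn_vu1 hd.
- exact: dyn_nt hd.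
- by rewrite !conj_by_comp // (dyn_comm hd).
rewrite /conj_by ps_deriv_comp ?ps_comp_00 // ps_deriv_comp //.
have hF' : ps_le v 1 (ps_deriv F) by apply: (ps_le_deriv hv); exact: mi_F hm.
have hG' : ps_le v 1 (ps_deriv G) by apply: (ps_le_deriv hv); exact: mi_G hm.
have hG := mi_G hm.
apply: (ps_leMl hv).
  apply: (ps_le_comp hv) => //; first by rewrite ps_comp_00.
  exact: (ps_le_comp hv).
apply: (ps_leMr hv) => //; apply: (ps_le_comp hv) => //.
exact: dyn_f' hd.
Qed.
End Conj.

(** The conjugating series may depend on [J]; no compatibility between the stages is required. *)
Definition reach J (f u : pseries E) := exists F G, mutually_inverse F G /\
  good J (conj_by F G f) (conj_by F G u).

Lemma reach_trans (F G : pseries E) J (f u : pseries E) : mutually_inverse F G -> dyn f u ->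
  reach J (conj_by F G f) (conj_by F G u) -> reach J f u.
Proof.
move=> h1 hd [F' [G' [h2 H]]].
have F0 := mi_F0 h1; have G0 := mi_G0 h1.
have F0' := mi_F0 h2; have G0' := mi_G0 h2.
have f0 := dyn_f0 hd; have u0 := dyn_u0 hd.
have e s : s 0%N = 0 -> conj_by (ps_comp F' F) (ps_comp G G') s =
   conj_by F' G' (conj_by F G s).
  by move=> s0; rewrite /conj_by !ps_compA ?ps_comp_00.
exists (ps_comp F' F), (ps_comp G G'); split; last by rewrite !e.
split; rewrite ?ps_comp_00 //.
- exact: (ps_le_comp hv F0 (mi_F h2) (mi_F h1)).
- exact: (ps_le_comp hv G0' (mi_G h1) (mi_G h2)).
- rewrite ps_compA ?ps_comp_00 // -(@ps_compA _ F) // (mi_FG h1) ps_Xcomp //.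
  exact: mi_FG h2.
- rewrite ps_compA ?ps_comp_00 // -(@ps_compA _ G') // (mi_GF h2) ps_Xcomp //.
  exact: mi_GF h1.
Qed.

(** The constant term is kept exactly, so that lifts of [f] and [u] can still be composed and a lift
    of [ell] still starts with 1. *)
Lemma zpmod_choice J s (c0 : E) : zpm J s -> Z c0 -> s 0%N = c0 ->
  exists z : pseries E, [/\ forall n, Z (z n), z 0%N = c0 & ps_cong v (v pi ^+ J) s z].
Proof.
move=> H Zc e.
have /choice[z Hz] : forall n, exists c, Z c /\ v (s n - c) <= v pi ^+ J.
  by move=> n; have [c Zc' Hc] := H n; exists c.
exists (fun n => if n is 0 then c0 else z n); split=> // -[|n]; rewrite ?e ?subrr ?(v0 hv) //.
- by case: (Hz n.+1).
- exact: (vpiX_ge0 hv hf).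
- by case: (Hz n.+1).
Qed.

(** * One step of the descent, from [Z_p + pi^J O] to [Z_p + pi^(J+1) O] *)

Section Step.
Variables (J : nat) (f u : pseries E).
Hypotheses (J0 : (0 < J)%N) (hg : good J f u).
Let hd : dyn f u. Proof. by case: hg. Qed.
Let hX : ps_cong v (v pi) f XP. Proof. by case: hg. Qed.
Let hfJ : zpm J f. Proof. by case: hg. Qed.
Let huJ : zpm J u. Proof. by case: hg. Qed.
Let f0 := dyn_f0 hd.
Let u0 := dyn_u0 hd.
Let hu := dyn_u hd.
Let hfi := dyn_f hd.
Let XP0 := ps_XP0 hf.
Let XPi := ps_le_XP hv p.

Lemma zpm_deriv i s : zpm i s -> zpm i (ps_deriv s).
Proof. by apply: (sp_deriv (zpmod_sub hv hf i)). Qed.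

Lemma v_const_int c : v c <= 1 -> ps_le v 1 (ps_const c).
Proof. by move=> hc [|n] //=; rewrite (v0 hv) ler01. Qed.

(* The relation [W] has coefficients fixed by Frobenius modulo [pi], so the
   Frobenius twist of [mu] satisfies it too; the difference of the two
   solutions is [ell] times an invariant of [u]. *)
Lemma dlog_descent (ell mu : pseries E) : ell 0%N = 1 -> ps_le v 1 ell ->
  ps_comp ell u * ps_deriv u = ps_const (u 1%N) * ell ->
  mu 0%N = 0 -> ps_le v 1 mu ->
  zpm 1 (ps_comp mu u * ps_deriv u - ps_const (u 1%N) * mu) -> zpm 1 mu.
Proof.
move=> l0 hl lu m0 hm; set W := _ - _ => hW.
set a := u 1%N in lu W hW *.
have va : v a <= 1 by rewrite (dyn_vu1 hd).
have u1Z : zpm 1 u by move=> n; apply: (zpmodW hv hf) (huJ n).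
have u'Z := zpm_deriv u1Z.
have hu' : ps_le v 1 (ps_deriv u) by apply: (ps_le_deriv hv).
have hmu : ps_le v 1 (ps_comp mu u) by apply: (ps_le_comp hv).
have hfr : ps_le v 1 (frob p mu).
  by move=> n; rewrite /frob (vX hv) exprn_ile1 ?(v_ge0 hv).
have hWi : ps_le v 1 W by move=> n; apply: (zpmod_int hv hf (hW n)).
have ham : ps_le v 1 (ps_const a * mu).
  by apply: (ps_leMl hv) => //; apply: v_const_int.
have ca : ps_le v 1 (ps_const a) by apply: v_const_int.
have hup : ps_le v 1 (ps_comp u XP) by apply: (ps_le_comp hv).
have uXP0 : ps_comp u XP 0%N = 0 by rewrite ps_comp_00.
have up0 : (u ^+ p) 0%N = 0 by rewrite psX0 u0 expr0n; case: (p) (prime_gt0 hp).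
(* The relation [mu(u) u' = W + a mu] is raised to the power [p]. Modulo [pi] both sides become
   series in [X^p], where only [mu] is twisted because [u], [u'], [W] and [a] have residues in
   [F_p]; [c5] cancels the [X^p]. *)
have c1 : ps_cong v (v pi) (ps_comp mu u ^+ p) (ps_comp (ps_comp (frob p mu) u) XP).
  rewrite -ps_compX //.
  apply: (cong_trans hv (cong_comp_l hv u0 hu (cong_frob hv hf hm))).
  rewrite !ps_compA //.
  have -> : ps_comp XP u = u ^+ p by rewrite /ps_XP ps_compX // ps_Xcomp.
  apply: (cong_comp_r hv) => //; first exact: vpi1.
  exact: (cong_expp hv hf).
have c2 : ps_cong v (v pi) ((ps_comp mu u * ps_deriv u) ^+ p)
    (ps_comp (ps_comp (frob p mu) u * ps_deriv u) XP).
  rewrite exprMn ps_compM //; apply: (congM hv) => //.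
  - exact: (ps_leX hv).
  - exact: (ps_le_comp hv).
  - exact: (cong_expp hv hf).
have c3 : ps_cong v (v pi) ((ps_const a * mu) ^+ p)
    (ps_comp (ps_const a * frob p mu) XP).
  rewrite exprMn ps_compM // ps_comp_const //; apply: (congM hv) => //.
  - exact: (ps_leX hv).
  - exact: (ps_le_comp hv).
  - have -> : ps_const a ^+ p = ps_const (a ^+ p).
      elim: (p) => [|k IH]; first by rewrite !expr0 ps_const1.
      by rewrite !exprS ps_constMM IH.
    move=> [|n] /=; last by rewrite subrr (v0 hv) vpi0.
    apply: (v_fermat hv hf); apply: (zpmodZ hv hf); exact: dyn_u1 hd.
  - exact: (cong_frob hv hf).
have c4 : ps_cong v (v pi) ((ps_comp mu u * ps_deriv u) ^+ p)
    (ps_comp W XP + ps_comp (ps_const a * frob p mu) XP).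
  have -> : ps_comp mu u * ps_deriv u = W + ps_const a * mu by rewrite /W subrK.
  apply: (cong_trans hv (ps_freshman hWi ham)).
  by apply: (congD hv) => //; apply: (cong_expp hv hf).
have c5 : ps_cong v (v pi) (ps_comp (frob p mu) u * ps_deriv u)
    (W + ps_const a * frob p mu).
  apply: (cong_XP_inj hf); rewrite ps_compD //.
  exact: (cong_trans hv (cong_sym hv c2) c4).
pose nu := frob p mu - mu.
have hnu : ps_le v 1 nu by apply: (ps_leB hv).
have c6 : ps_cong v (v pi) (ps_comp nu u * ps_deriv u) (ps_const a * nu).
  have := congB hv c5 (cong_refl hv (ps_comp mu u * ps_deriv u) vpi0).
  by congr (ps_cong _ _ _ _); rewrite /nu /W ?ps_compB //; ring.
have [t [t0 ht lt1]] := ps_unit (subring_vint hv) hl l0.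
(* The quotient of [nu] by [ell], two solutions modulo [pi] of the same homogeneous equation, is
   invariant under [u]. Its constant term is zero, so [h], and with it [nu], vanishes modulo
   [pi]. *)
pose h := nu * t.
have hh : ps_le v 1 h by apply: (ps_leMl hv).
have nuE : nu = ell * h by rewrite /h mulrCA lt1 mulr1.
have aV : ps_const a^-1 * ps_const a = 1.
  rewrite -ps_constMM mulVf ?ps_const1 //.
  by rewrite -(v_eq0 hv) (dyn_vu1 hd) oner_eq0.
have c7 : ps_cong v (v pi) (ps_comp h u) h.
  have hc : ps_le v 1 (ps_const a^-1 * t).
    apply: (ps_leMl hv) => //; apply: v_const_int.
    by rewrite (vV hv) (dyn_vu1 hd) invr1.
  have : ps_le v (v pi) (ps_const a^-1 * t *
      (ps_comp nu u * ps_deriv u - ps_const a * nu)) by apply: (ps_leMl hv).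
  congr (ps_le _ _ _); rewrite nuE ps_compM //.
  have -> : ps_comp ell u * ps_comp h u * ps_deriv u = ps_const a * ell * ps_comp h u.
    by rewrite -lu; ring.
  have -> : ps_const a^-1 * t * (ps_const a * ell * ps_comp h u - ps_const a * (ell * h))
    = (ps_const a^-1 * ps_const a) * (ell * t) * (ps_comp h u - h) by ring.
  by rewrite aV lt1 !mul1r.
have hc := invariant_const hv hf hd hX u1Z hh c7.
have h0 : h 0%N = 0.
  rewrite /h psM0 /nu psB /frob m0 expr0n subr0.
  by case: (p) (prime_gt0 hp) => // *; rewrite mul0r.
have hpi : ps_le v (v pi) h.
  by case=> [|n]; [rewrite h0 (v0 hv) vpi0|exact: hc].
move=> n; apply: (zpmod1_fermat hv hf) => //.
by have := ps_leMl hv hl hpi n; rewrite -nuE.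
Qed.

(** Induction on the level [i]: write [ell = z + pi^i mu] with [z] over [Z_p]. The defect of [mu] in
    the equation is, up to [pi^i], that of [z], which is known in [Z_p + pi^(i+1) O] since [i < J];
    so [dlog_descent] puts [mu] in [Z_p + pi O], one level more for [ell]. *)
Lemma dlog_zpmod (ell : pseries E) : ell 0%N = 1 -> ps_le v 1 ell ->
  ps_comp ell u * ps_deriv u = ps_const (u 1%N) * ell -> zpm J ell.
Proof.
move=> l0 hl lu.
suff H i : (i <= J)%N -> zpm i ell by apply: H.
elim: i => [|i IH] iJ n; first exact: (zpmod0 hf).
have hi := IH (ltnW iJ).
have [z [hz z0 cz]] := zpmod_choice hi (sp1 (zf_sub hf)) l0.
have [mu [hmu emu]] := ps_div_pi hv hf (k := i) (s := ell - z) cz.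
have pin : pi ^+ i != 0 by rewrite expf_neq0 ?(zf_pi0 hf).
have mu0 : mu 0%N = 0.
  apply: (mulfI pin); have := congr1 (@^~ 0%N) emu.
  by rewrite ps_const_mul psB l0 z0 subrr mulr0 => <-.
have ellE : ell = z + ps_const (pi ^+ i) * mu by rewrite -emu; ring.
have : zpm 1 mu.
  apply: (dlog_descent l0 hl lu mu0 hmu) => k.
  set W := _ - _.
  have WE : ps_const (u 1%N) * z - ps_comp z u * ps_deriv u
     = ps_const (pi ^+ i) * W.
    move: lu; rewrite ellE ps_compD // ps_comp_scale // /W => e.
    rewrite mulrBr.
    have -> : ps_const (pi ^+ i) * (ps_comp mu u * ps_deriv u) =
      (ps_comp z u + ps_const (pi ^+ i) * ps_comp mu u) * ps_deriv u
      - ps_comp z u * ps_deriv u by ring.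
    by rewrite e; ring.
  have -> : W k = (ps_const (pi ^+ i) * W) k / pi ^+ i.
    by rewrite ps_const_mul mulrC mulKf.
  apply: (zpmod_divX hv hf).
    rewrite -WE addn1; set i1 := i.+1.
    have sub := zpmod_sub hv hf i1.
    have zZ m : zpmod v Z pi i1 (z m) by apply: (zpmodZ hv hf).
    have uZ m : zpmod v Z pi i1 (u m) by apply: (zpmodW hv hf) (huJ m).
    rewrite psB; apply: (spB sub).
      by rewrite ps_const_mul; apply: (spM sub).
    by apply: (sp_psM sub); [apply: (sp_comp sub)|apply: (sp_deriv sub)].
  rewrite ps_const_mul (vM hv) (vX hv) ler_piMr ?(vpiX_ge0 hv hf) //.
  apply: (vB_le hv).
    apply: (sp_psM (subring_vint hv)); first exact: (ps_le_comp hv).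
    exact: (ps_le_deriv hv).
  rewrite ps_const_mul; apply: (spM (subring_vint hv)); last exact: hmu.
  by rewrite /vint (dyn_vu1 hd).
move=> hm1; rewrite ellE psD ps_const_mul -addn1.
apply: (spD (zpmod_sub hv hf (i + 1))); first exact: (zpmodZ hv hf).
exact: (zpmod_mulX hv hf).
Qed.

(** From [ell(f) f'/pi = ell], the series [f'/pi] has its coefficients in [Z_p + pi^J O].
    Multiplying by [pi] gains a level, and the factor [n] in [n * f n] is invertible. *)
Lemma step_coprime n : ~~ (p %| n)%N -> zpmod v Z pi J.+1 (f n).
Proof.
move=> nd; have n0 : (0 < n)%N by case: n nd => //; rewrite dvdn0.
have [ell [l0 hl lf lu]] := dlog_props hv hf hd.
have hlJ := dlog_zpmod l0 hl lu.
have sub := zpmod_sub hv hf J.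
have hlfJ := sp_comp sub f0 hlJ hfJ.
have lf0 : ps_comp ell f 0%N = 1 by rewrite ps_comp0.
have [t [t0 ht lt1]] := ps_unit sub hlfJ lf0.
have lamJ : zpm J (dlam pi f).
  have -> : dlam pi f = ell * t by rewrite -{1}lf mulrAC lt1 mul1r.
  exact: (sp_psM sub).
have : zpmod v Z pi J.+1 (ps_deriv f n.-1).
  rewrite (dlamE hf) ps_const_mul -add1n -[pi]expr1.
  exact: (zpmod_mulX hv hf).
rewrite /ps_deriv prednK // => H.
have nn : (n%:R : E) != 0 by rewrite -(v_eq0 hv) (zf_nat hf nd) oner_eq0.
have -> : f n = (f n *+ n) * n%:R^-1 by rewrite -[_ *+ n]mulr_natr mulfK.
apply: (spM (zpmod_sub hv hf J.+1)) => //; apply: (zpmodZ hv hf).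
apply: (zf_inv hf); last exact: (zf_nat hf nd).
exact: (sp_nat (zf_sub hf)).
Qed.

Lemma cong_scaled_comp_f (g s : pseries E) k : g 0%N = 0 -> ps_le v 1 g -> ps_cong v (v pi) g XP ->
  ps_le v (v pi ^+ k) s ->
  ps_cong v (v pi ^+ k.+1) (ps_comp s g) (ps_comp s XP).
Proof.
move=> g0 hgi hgX /(ps_div_pi hv hf)[t [ht ->]].
rewrite !ps_comp_scale //; apply/congP; rewrite -mulrBr exprSr -(vX hv).
apply: (ps_le_scale hv).
apply: (cong_comp_r hv) => //; exact: vpi1.
Qed.

(** Conjugation by [X + D], with [pi^J] dividing [D], adds [D(X^p)] to [f] modulo [pi^(J+1)]. It can
    thus correct exactly the coefficients whose index is divisible by [p], and the others are right
    by [step_coprime]. The commutation with [f] then improves [u]. *)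
Lemma descent_step : reach J.+1 f u.
Proof.
have vJ1 := vpiX_le1 hv hf J.
have vJ0 := vpiX_ge0 hv hf J.
have vJpi : v pi ^+ J <= v pi by have := vpiX_leW hv hf J0; rewrite expr1.
have vJS : v pi * v pi ^+ J = v pi ^+ J.+1 by rewrite exprS.
have Z0 := sp0 (zf_sub hf).
have [z [hz z0 cz]] := zpmod_choice hfJ Z0 f0.
pose D : pseries E := fun n => z (n * p)%N - f (n * p)%N.
have hD : ps_le v (v pi ^+ J) D.
  by move=> n; rewrite /D (vB_sym hv); apply: cz.
have D0 : D 0%N = 0 by rewrite /D z0 f0 subrr.
have hDi := ps_leW vJ1 hD.
pose F := ps_X E + D.
have X1 : ps_le v 1 (ps_X E) by move=> n; exact: (v_nat hv).
have F0 : F 0%N = 0 by rewrite /F psD D0 addr0.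
have hF : ps_le v 1 F by apply: (ps_leD hv).
have F1 : v (F 1%N) = 1.
  rewrite /F psD (vD_eq hv) ?(v1 hv) //; apply: le_lt_trans (hD 1%N) _.
  exact: le_lt_trans vJpi (zf_pi1 hf).
have [G hm] := inverse_exists F0 hF F1.
exists F, G; split=> //.
set f1 := conj_by F G f; set u1 := conj_by F G u.
have hd1 : dyn f1 u1 by apply: dyn_conj.
have f10 := dyn_f0 hd1; have u10 := dyn_u0 hd1.
have hf1 := dyn_f hd1; have hu1 := dyn_u hd1.
(* On one side [f1(X + D) = f1] modulo [pi^(J+1)], as [pi] divides [f1']; on the other
   [f1(F) = F(f) = f + D(f)], and [D(f) = D(X^p)] to the same precision. *)
have c1 : ps_cong v (v pi ^+ J.+1) f1 (f + ps_comp D XP).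
  apply: (cong_trans hv (t := ps_comp f1 F)).
    apply: (cong_sym hv); rewrite -{2}(ps_comp_X f1) -vJS.
    by apply: (cong_comp_small hv) => //; exact: dyn_f' hd1.
  rewrite conj_byF // ps_compD // ps_Xcomp //.
  apply: (congD hv); first exact/(cong_refl hv)/(vpiX_ge0 hv hf).
  exact: cong_scaled_comp_f.
have f1Z : zpm J.+1 f1.
  move=> n; apply: (zpmod_congr hv (c := (f + ps_comp D XP) n)); last first.
    by rewrite (vB_sym hv).
  rewrite psD (ps_comp_XP hf); case: ifPn => [/dvdnP[m ->]|nd].
    rewrite mulnK ?(prime_gt0 hp) // /D addrC subrK; exact: (zpmodZ hv hf).
  by rewrite addr0; apply: step_coprime.
have f1X : ps_cong v (v pi) f1 XP.
  have l1 : v pi ^+ J.+1 <= v pi by rewrite (le_trans _ vJpi) // (vpiX_leS hv hf).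
  apply: (cong_trans hv (congW l1 c1)).
  rewrite -[X in ps_cong _ _ _ X]addr0; apply: (congD hv) => // n.
  by rewrite subr0; apply: (ps_leW vJpi); apply: (ps_le_comp hv).
have u1J : zpm J u1.
  have c : ps_cong v (v pi ^+ J) u1 u.
    apply: (cong_trans hv (t := ps_comp u1 F)).
      apply: (cong_sym hv); rewrite -{2}(ps_comp_X u1).
      apply: (cong_comp_r hv) => // n; rewrite /F psD addrC addKr; exact: hD.
    rewrite conj_byF // ps_compD // ps_Xcomp // => n.
    by rewrite psD addrC addKr; apply: (ps_le_comp hv).
  by move=> n; apply: (zpmod_congr hv (huJ n)); rewrite (vB_sym hv).
split=> //.
have [y [hy y0 cy]] := zpmod_choice u1J Z0 u10.
set e := u1 - y.
have he : ps_le v (v pi ^+ J) e by [].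
have e0 : e 0%N = 0 by rewrite /e psB u10 y0 subrr.
have u1E : u1 = y + e by rewrite /e; ring.
have hyi : ps_le v 1 y by move=> n; apply: (zf_int hf).
(* The error [e] of the lift [y] of [u1] is read off from [f1(y + e) = (y + e)(f1)]: the left side
   is [f1(y)] since [pi] divides [f1'], and [e(f1) = e(X^p)]. What remains only involves [f1] and
   [y], already at level [J + 1]. *)
have c2 : ps_cong v (v pi ^+ J.+1) (ps_comp e XP) (ps_comp f1 y - ps_comp y f1).
  apply: (cong_trans hv (t := ps_comp e f1)).
    exact/(cong_sym hv)/cong_scaled_comp_f.
  have -> : ps_comp e f1 = ps_comp f1 (y + e) - ps_comp y f1.
    by rewrite -u1E (dyn_comm hd1) {1}u1E ps_compD //; ring.
  apply: (congB hv); last exact/(cong_refl hv)/(vpiX_ge0 hv hf).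
  rewrite -vJS; apply: (cong_comp_small hv) => //; exact: dyn_f' hd1.
have sub := zpmod_sub hv hf J.+1.
have yZ n : zpmod v Z pi J.+1 (y n) by apply: (zpmodZ hv hf).
move=> n; rewrite u1E; apply: (spD sub) => //.
have -> : e n = ps_comp e XP (n * p)%N.
  by rewrite (ps_comp_XP hf) dvdn_mull // mulnK ?(prime_gt0 hp).
apply: (zpmod_congr hv (c := (ps_comp f1 y - ps_comp y f1) (n * p)%N)).
  by rewrite psB; apply: (spB sub); apply: (sp_comp sub).
by rewrite (vB_sym hv).
Qed.
End Step.

(** * Base of the descent: making [f] equal to [X^p] modulo [pi] over an algebraically closed
    field *)

Section Base.
Hypothesis closed : GRing.closed_field_axiom E.
Variables f u : pseries E.
Hypotheses (hd : dyn f u) (hfp : v (f p) = 1).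
Let f0 := dyn_f0 hd.
Let u0 := dyn_u0 hd.
Let XP0 := ps_XP0 hf.
Let XPi := ps_le_XP hv p.

Lemma artin_schreier_root c b : exists x, x ^+ p = c * x + b.
Proof.
have [x Hx] := closed (fun i => if i is 0 then b else if i is 1 then c else 0)
  (prime_gt0 hp).
exists x; rewrite Hx; case: (p) (prime_gt1 hp) => [|[|n]] // _.
rewrite !big_ord_recl /= expr0 expr1 mulr1 big1 ?addr0 1?addrC // => i _.
by rewrite mul0r.
Qed.

(** Index [n] reads [s_n^p = g_1^n s_n + b] with [b] made of earlier coefficients. For [n = 1] the
    nonzero solutions, with [s_1^(p-1) = g_1], make [s] invertible. A solution with [|s_n| > 1] is
    impossible, since its power [p] would outgrow the right side. *)
Lemma frobenius_twist_solution (g : pseries E) : g 0%N = 0 -> ps_le v 1 g -> v (g 1%N) = 1 ->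
  exists s, [/\ s 0%N = 0, ps_le v 1 s, v (s 1%N) = 1 & ps_comp s g = frob p s].
Proof.
move=> g0 hgi g1.
have p1 := prime_gt1 hp.
have /choice[rt Hrt] : forall cb : E * E, exists x, x ^+ p = cb.1 * x + cb.2.
  by move=> cb; apply: artin_schreier_root.
have [x1 Hx1] : exists x, x ^+ p.-1 = g 1%N.
  have [|x Hx] := closed (n := p.-1) (fun i => if i is 0 then g 1%N else 0).
    by case: (p) p1 => [|[]].
  have pp : (0 < p.-1)%N by lia.
  exists x; rewrite Hx; case: (p.-1) pp => // n _.
  rewrite big_ord_recl /= expr0 mulr1 big1 ?addr0 // => i _.
  by rewrite mul0r.
have [s Hs] := @series_rec E 0 (fun n s =>
   if n is 0 then 0 else if n is 1 then x1 else
   rt (g 1%N ^+ n, \sum_(k < n) s k * (g ^+ k) n))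
   (fun n s1 s2 H => match n return (forall k, (k < n)%N -> s1 k = s2 k) ->
     (if n is 0 then 0 else if n is 1 then x1 else
        rt (g 1%N ^+ n, \sum_(k < n) s1 k * (g ^+ k) n)) =
     (if n is 0 then 0 else if n is 1 then x1 else
        rt (g 1%N ^+ n, \sum_(k < n) s2 k * (g ^+ k) n)) with
   | 0 => fun _ => erefl
   | 1 => fun _ => erefl
   | m.+2 => fun H => congr1 (fun z => rt (g 1%N ^+ m.+2, z))
      (eq_bigr _ (fun i _ => congr1 (fun z => z * _) (H _ (ltn_ord i)))) end H).
have s0 : s 0%N = 0 by rewrite Hs.
have s1 : s 1%N = x1 by rewrite Hs.
have sE n : s n ^+ p = g 1%N ^+ n * s n + \sum_(k < n) s k * (g ^+ k) n.
  case: n => [|[|n]].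
  - by rewrite s0 big_ord0 mulr0 addr0 expr0n; case: (p) p1.
  - rewrite big_ord1 s0 mul0r addr0 expr1 s1 -Hx1.
    by case: (p) p1 => // q _; rewrite exprSr.
  - by rewrite [s n.+2]Hs Hrt.
exists s; split=> //.
- elim/ltn_ind => n IH.
  have hb : v (\sum_(k < n) s k * (g ^+ k) n) <= 1.
    apply: (sp_sum (subring_vint hv)) => i _.
    by apply: (spM (subring_vint hv)); [exact: IH|exact: (ps_leX hv)].
  rewrite leNgt; apply/negP => lt.
  have : v (s n ^+ p) <= v (s n).
    rewrite sE; apply: (vD_le hv); last exact: le_trans hb (ltW lt).
    rewrite (vM hv) (vX hv) g1 expr1n mul1r //.
  rewrite (vX hv) leNgt => /negP; apply.
  by rewrite -{1}[v (s n)]expr1 ltr_eXn2l.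
- rewrite s1; apply/eqP.
  have : v x1 ^+ p.-1 == 1 by rewrite -(vX hv) Hx1 g1.
  by rewrite pexpr_eq1 ?(v_ge0 hv) //; lia.
- apply: psP => n; rewrite ps_compE // big_ord_recr /= psX_diag // addrC.
  by rewrite /frob sE [s n * _]mulrC.
Qed.

(** As [pi] divides [f'], [f = g(X^p)] modulo [pi]. With [F(g)] the Frobenius twist of [F], one gets
    [F(f) = F^p] modulo [pi], so the conjugate of [f] is [X^p]. A series commuting with [X^p] modulo
    [pi] equals its own twist, which puts [u1] over [F_p]. *)
Lemma descent_base : reach 1 f u.
Proof.
pose g : pseries E := fun n => f (n * p)%N.
have fi := dyn_f hd.
have gi : ps_le v 1 g by move=> n; apply: fi.
have g0 : g 0%N = 0 by rewrite /g mul0n f0.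
have g1 : v (g 1%N) = 1 by rewrite /g mul1n.
have gXPi : ps_le v 1 (ps_comp g XP) by apply: (ps_le_comp hv).
have fg : ps_cong v (v pi) f (ps_comp g XP).
  move=> n; rewrite (ps_comp_XP hf); case: ifPn => [/dvdnP[m ->]|nd].
    by rewrite mulnK ?(prime_gt0 hp) // subrr (v0 hv) vpi0.
  rewrite subr0; case: n nd => [|n nd]; first by rewrite dvdn0.
  have := dyn_f' hd n; rewrite /ps_deriv -mulr_natr (vM hv).
  by rewrite (zf_nat hf nd) mulr1.
have [F [F0 hF F1 Fg]] := frobenius_twist_solution g0 gi g1.
have [G hm] := inverse_exists F0 hF F1.
have G0 := mi_G0 hm; have hG := mi_G hm.
exists F, G; split=> //.
set f1 := conj_by F G f; set u1 := conj_by F G u.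
have hd1 : dyn f1 u1 by apply: dyn_conj.
have f10 := dyn_f0 hd1; have u10 := dyn_u0 hd1.
have hf1 := dyn_f hd1; have hu1 := dyn_u hd1.
have Ff : ps_cong v (v pi) (ps_comp F f) (F ^+ p).
  apply: (cong_trans hv (t := ps_comp F (ps_comp g XP))).
    apply: (cong_comp_r hv) => //; first exact: vpi1.
    by rewrite ps_comp_00.
  rewrite -ps_compA // Fg; apply: (cong_sym hv); exact: (cong_frob hv hf).
have f1X : ps_cong v (v pi) f1 XP.
  rewrite /f1 /conj_by -ps_compA // /ps_XP -(mi_FG hm) -ps_compX //.
  exact: (cong_comp_l hv).
split=> // n.
  apply: (zpmod_congr hv (c := XP n)); last by rewrite (vB_sym hv) expr1.
  rewrite /ps_XP ps_XX; exact/(zpmodZ hv hf)/(sp_nat (zf_sub hf)).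
apply: (zpmod1_fermat hv hf) => //.
suff : ps_cong v (v pi) (frob p u1) u1 by apply.
apply: (cong_XP_inj hf).
apply: (cong_trans hv (cong_sym hv (cong_frob hv hf hu1))).
apply: (cong_trans hv (t := ps_comp f1 u1)).
  have -> : u1 ^+ p = ps_comp XP u1 by rewrite /ps_XP ps_compX // ps_Xcomp.
  exact/(cong_sym hv)/(cong_comp_l hv).
rewrite (dyn_comm hd1); apply: (cong_comp_r hv) => //; exact: vpi1.
Qed.

Theorem descent J : reach J.+1 f u.
Proof.
elim: J => [|J [F [G [hm H]]]]; first exact: descent_base.
apply: reach_trans hm hd _; exact: descent_step H.
Qed.
End Base.
End Descent.

(** * Power series in several variables and the group law of a logarithm *)

Section MultiOrder.
Variables (A : comNzRingType) (n : nat).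
Implicit Types (P Q : {mpoly A[n]}).

(** Order at the origin. Identities between series are proved on truncations, with [meq d]
    forgetting the total degrees from [d] on. *)
Definition mord d P := forall m, (mdeg m < d)%N -> P@_m = 0.
Definition meq d P Q := mord d (P - Q).

Lemma mord0 d : mord d 0. Proof. by move=> m _; rewrite mcoeff0. Qed.
Lemma mordW d d' P : (d' <= d)%N -> mord d P -> mord d' P.
Proof. by move=> h H m lt; apply: H; apply: leq_trans h. Qed.
Lemma mord_0 P : mord 0 P. Proof. by []. Qed.
Lemma mordD d P Q : mord d P -> mord d Q -> mord d (P + Q).
Proof. by move=> H1 H2 m lt; rewrite mcoeffD H1 ?H2 ?addr0. Qed.
Lemma mordN d P : mord d P -> mord d (- P).
Proof. by move=> H1 m lt; rewrite mcoeffN H1 ?oppr0. Qed.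
Lemma mordZ d c P : mord d P -> mord d (c *: P).
Proof. by move=> H1 m lt; rewrite mcoeffZ H1 ?mulr0. Qed.
Lemma mord_sum d I (l : seq I) (C : pred I) (F : I -> {mpoly A[n]}) :
  (forall i, C i -> mord d (F i)) -> mord d (\sum_(i <- l | C i) F i).
Proof.
by move=> H; apply: big_ind => //; [exact: mord0|exact: mordD].
Qed.
Lemma mordM a b P Q : mord a P -> mord b Q -> mord (a + b) (P * Q).
Proof.
move=> HP HQ m lt; rewrite mcoeffM big1 // => k /eqP e.
have [h|h] := ltnP (mdeg k.1) a; first by rewrite HP ?mul0r.
rewrite HQ ?mulr0 //; rewrite e mdegD in lt.
by rewrite -(ltn_add2l a); apply: leq_ltn_trans lt; rewrite leq_add2r.
Qed.
Lemma mordX a P k : mord a P -> mord (a * k) (P ^+ k).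
Proof.
by move=> HP; elim: k => [|k IH]; rewrite ?muln0 // exprS mulnS; apply: mordM.
Qed.
Lemma mord1 P : P@_0%MM = 0 -> mord 1 P.
Proof. by move=> H m; rewrite ltnS leqn0 mdeg_eq0 => /eqP ->. Qed.

Lemma meq_refl d P : meq d P P.
Proof. by rewrite /meq subrr; apply: mord0. Qed.
Lemma meqE d P Q m : meq d P Q -> (mdeg m < d)%N -> P@_m = Q@_m.
Proof. by move=> H lt; apply/eqP; rewrite -subr_eq0 -mcoeffB H. Qed.
Lemma meq_sym d P Q : meq d P Q -> meq d Q P.
Proof. by move=> H; rewrite /meq -opprB; apply: mordN. Qed.
Lemma meq_trans d P Q S : meq d P Q -> meq d Q S -> meq d P S.
Proof.
by move=> H1 H2; have := mordD H1 H2; congr mord; rewrite addrA subrK.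
Qed.
Lemma meqD d P P' Q Q' : meq d P P' -> meq d Q Q' -> meq d (P + Q) (P' + Q').
Proof.
by move=> H1 H2; have := mordD H1 H2; congr mord; ring.
Qed.
Lemma meq_sum d I (l : seq I) (C : pred I) (F G : I -> {mpoly A[n]}) :
  (forall i, C i -> meq d (F i) (G i)) ->
  meq d (\sum_(i <- l | C i) F i) (\sum_(i <- l | C i) G i).
Proof. by move=> H; rewrite /meq -sumrB; apply: mord_sum. Qed.
Lemma meqM d P P' Q Q' : meq d P P' -> meq d Q Q' -> meq d (P * Q) (P' * Q').
Proof.
move=> H1 H2; have h1 := mordM H1 (@mord_0 Q); have h2 := mordM (@mord_0 P') H2.
by rewrite addn0 in h1; have := mordD h1 h2; congr mord; ring.
Qed.
Lemma meqX d P Q k : meq d P Q -> meq d (P ^+ k) (Q ^+ k).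
Proof.
by move=> H; elim: k => [|k IH]; rewrite ?expr0 ?exprS; [apply: meq_refl|apply: meqM].
Qed.
Lemma meqZ d c P Q : meq d P Q -> meq d (c *: P) (c *: Q).
Proof. by move=> H; rewrite /meq -scalerBr; apply: mordZ. Qed.
End MultiOrder.

Section MultiComp.
Variables (A : comNzRingType) (k n : nat).
Implicit Types (P Q : {mpoly A[k]}) (lq lr : k.-tuple {mpoly A[n]}).

Lemma mord_monomial (m : 'X_{1..k}) lq : (forall i, mord 1 (tnth lq i)) ->
  mord (mdeg m) ('X_[m] \mPo lq).
Proof.
move=> H; rewrite comp_mpolyX mdegE.
elim/big_rec2: _ => [|i a b _ IH]; first exact: mord_0.
by apply: mordM => //; have := @mordX _ _ 1 _ (m i) (H i); rewrite mul1n.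
Qed.

Lemma mord_comp d P lq : (forall i, mord 1 (tnth lq i)) -> mord d P ->
  mord d (P \mPo lq).
Proof.
move=> H HP; rewrite comp_mpolyEX big_seq; apply: mord_sum => m.
rewrite mcoeff_msupp => ne; apply: mordZ; apply: (@mordW _ _ (mdeg m)); last exact: mord_monomial.
by rewrite leqNgt; apply/negP => lt; case/eqP: ne; apply: HP.
Qed.

Lemma meq_comp_l d P Q lq : (forall i, mord 1 (tnth lq i)) -> meq d P Q ->
  meq d (P \mPo lq) (Q \mPo lq).
Proof. by move=> H HP; rewrite /meq -raddfB; apply: mord_comp. Qed.

Lemma meq_comp_r d P lq lr : (forall i, meq d (tnth lq i) (tnth lr i)) ->
  meq d (P \mPo lq) (P \mPo lr).
Proof.
move=> H; rewrite !comp_mpolyEX; apply: meq_sum => m _; apply: meqZ.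
rewrite !comp_mpolyX; elim/big_rec2: _ => [|i a b _ IH]; first exact: meq_refl.
by apply: meqM => //; apply: meqX.
Qed.

Definition meq_lead a (P Q : {mpoly A[n]}) :=
  [/\ mord a P, mord a Q & meq a.+1 P Q].

(** In degree [d], a polynomial of order [d] only sees the linear parts of what is substituted into
    it. This isolates the unknown coefficient in the Lubin-Tate recursion. *)
Lemma meq_lead_comp d P lq lr : (forall i, meq_lead 1 (tnth lq i) (tnth lr i)) ->
  mord d P -> meq d.+1 (P \mPo lq) (P \mPo lr).
Proof.
have leadM a b (S T S' T' : {mpoly A[n]}) : meq_lead a S T -> meq_lead b S' T' ->
    meq_lead (a + b) (S * S') (T * T').
  move=> [h1 h2 h3] [h4 h5 h6]; split; try exact: mordM.
  have h7 := mordM h1 h6; have h8 := mordM h3 h5; rewrite addnS in h7.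
  by have := mordD h7 h8; congr mord; ring.
have lead0 : meq_lead 0 1 1 by split; rewrite ?/meq ?subrr; do ?exact: mord0.
move=> H HP; rewrite !comp_mpolyEX !big_seq; apply: meq_sum => m.
rewrite mcoeff_msupp => ne; apply: meqZ.
have dm : (d <= mdeg m)%N.
  by rewrite leqNgt; apply/negP => lt; case/eqP: ne; apply: HP.
suff [_ _ h] : meq_lead (mdeg m) ('X_[m] \mPo lq) ('X_[m] \mPo lr).
  by apply: mordW h; rewrite ltnS.
rewrite !comp_mpolyX mdegE.
elim: (index_enum _) => [|i l IH]; first by rewrite !big_nil.
rewrite !big_cons; apply: (leadM) => //.
elim: (m i) => [|j IHj]; first by rewrite !expr0.
by rewrite !exprS -add1n; apply: (leadM).
Qed.

Lemma comp_mpolyA l P lq (lr : n.-tuple {mpoly A[l]}) :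
  (P \mPo lq) \mPo lr = P \mPo [tuple tnth lq i \mPo lr | i < k].
Proof.
rewrite [X in X \mPo lr]comp_mpolyEX [RHS]comp_mpolyEX raddf_sum /=; apply: eq_bigr => m _.
rewrite comp_mpolyZ !comp_mpolyX rmorph_prod; congr (_ *: _).
by apply: eq_bigr => i _; rewrite rmorphXn tnth_mktuple.
Qed.
End MultiComp.

Section MultiSeries.
Variable A : comNzRingType.

Lemma coef_ms_trunc n d (F : mseries A n) m :
  (ms_trunc d F)@_m = if (mdeg m < d)%N then F m else 0.
Proof.
case: ltnP => h; first by rewrite /ms_trunc mcoeff_mpoly.
rewrite /ms_trunc raddf_sum big1 //= => k _; rewrite mcoeffZ mcoeffX.
by case: eqP => [e|]; rewrite ?mulr0 //; have := bmdeg k; rewrite e ltnNge h.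
Qed.

Lemma ms_trunc_meq n d N (F : mseries A n) : (d <= N)%N ->
  meq d (ms_trunc N F) (ms_trunc d F).
Proof.
move=> le m lt; rewrite mcoeffB !coef_ms_trunc lt (leq_trans lt le).
by rewrite subrr.
Qed.

Lemma ms_trunc_ord n d (F : mseries A n) : F 0%MM = 0 -> mord 1 (ms_trunc d F).
Proof. by move=> H; apply: mord1; rewrite coef_ms_trunc H if_same. Qed.

(** The definition truncates at an order depending on [m]; a common [N] is what allows the laws of
    polynomial composition to be transported. *)
Lemma ms_substE N k n (F : mseries A k) (G : 'I_k -> mseries A n) m :
  (forall i, G i 0%MM = 0) -> (mdeg m < N)%N ->
  ms_subst F G m = (ms_trunc N F \mPo [tuple ms_trunc N (G i) | i < k])@_m.
Proof.
move=> G0 lt; rewrite /ms_subst; apply: (meqE (d := (mdeg m).+1)) => //.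
apply: meq_sym; apply: (@meq_trans _ _ _ _ (ms_trunc (mdeg m).+1 F
    \mPo [tuple ms_trunc N (G i) | i < k])).
  apply: meq_comp_l; last exact: ms_trunc_meq.
  by move=> i; rewrite tnth_mktuple; apply: ms_trunc_ord.
by apply: meq_comp_r => i; rewrite !tnth_mktuple; apply: ms_trunc_meq.
Qed.

Lemma ms_subst_trunc N k n (F : mseries A k) (G : 'I_k -> mseries A n) :
  (forall i, G i 0%MM = 0) ->
  meq N (ms_trunc N (ms_subst F G))
        (ms_trunc N F \mPo [tuple ms_trunc N (G i) | i < k]).
Proof.
move=> G0 m lt; rewrite mcoeffB coef_ms_trunc lt (ms_substE _ _ lt) //.
by rewrite subrr.
Qed.

Lemma ms_subst0 k n (F : mseries A k) (G : 'I_k -> mseries A n) :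
  (forall i, G i 0%MM = 0) -> ms_subst F G 0%MM = F 0%MM.
Proof.
move=> G0; rewrite (@ms_substE 1) ?mdeg0 //.
have H : meq 1 (ms_trunc 1 F) (F 0%MM)%:MP.
  apply: mord1; rewrite mcoeffB coef_ms_trunc mdeg0 /= mcoeffC eqxx mulr1.
  by rewrite subrr.
have := meq_comp_l (lq := [tuple ms_trunc 1 (G i) | i < k]) _ H.
move=> /(_ _)/meqE -> //; last by rewrite mdeg0.
  by rewrite comp_mpolyC mcoeffC eqxx mulr1.
by move=> i; rewrite tnth_mktuple; apply: ms_trunc_ord.
Qed.

Lemma ms_substA k l n (F : mseries A k) (G : 'I_k -> mseries A l)
    (H : 'I_l -> mseries A n) :
  (forall i, G i 0%MM = 0) -> (forall i, H i 0%MM = 0) ->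
  ms_subst (ms_subst F G) H = ms_subst F (fun i => ms_subst (G i) H).
Proof.
move=> G0 H0; apply: funext => m; pose N := (mdeg m).+1.
have lt : (mdeg m < N)%N by [].
have GH0 i : ms_subst (G i) H 0%MM = 0 by rewrite ms_subst0.
rewrite (ms_substE _ _ lt) // [RHS](ms_substE _ _ lt) //.
apply: (meqE (d := N)) => //.
have oH i : mord 1 (tnth [tuple ms_trunc N (H i) | i < l] i).
  by rewrite tnth_mktuple; apply: ms_trunc_ord.
have h1 := meq_comp_l oH (@ms_subst_trunc N _ _ F G G0).
rewrite comp_mpolyA in h1; apply: (meq_trans h1).
by apply: meq_comp_r => i; rewrite !tnth_mktuple; exact/meq_sym/ms_subst_trunc.
Qed.

Definition ms_add n (F G : mseries A n) : mseries A n := fun m => F m + G m.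
Definition ms_scale n (c : A) (F : mseries A n) : mseries A n := fun m => c * F m.

Lemma ms_substD k n (F F' : mseries A k) (G : 'I_k -> mseries A n) :
  ms_subst (ms_add F F') G = ms_add (ms_subst F G) (ms_subst F' G).
Proof.
apply: funext => m; rewrite /ms_add /ms_subst -mcoeffD -raddfD /=.
congr (_ \mPo _)@_m; apply/mpolyP => m'.
by rewrite mcoeffD !coef_ms_trunc /ms_add; case: ifP; rewrite ?addr0.
Qed.

Lemma ms_substZ k n c (F : mseries A k) (G : 'I_k -> mseries A n) :
  ms_subst (ms_scale c F) G = ms_scale c (ms_subst F G).
Proof.
apply: funext => m; rewrite /ms_scale /ms_subst -mcoeffZ -comp_mpolyZ.
congr (_ \mPo _)@_m; apply/mpolyP => m'.
by rewrite mcoeffZ !coef_ms_trunc /ms_scale; case: ifP; rewrite ?mulr0.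
Qed.

Lemma ms_subst_var k n i (G : 'I_k -> mseries A n) : (forall i, G i 0%MM = 0) ->
  ms_subst (ms_var A i) G = G i.
Proof.
move=> G0; apply: funext => m; rewrite (@ms_substE (mdeg m).+2) //.
have -> : ms_trunc (mdeg m).+2 (ms_var A i) = 'X_i.
  apply/mpolyP => m'; rewrite coef_ms_trunc mcoeffX /ms_var.
  case: ltnP => h; first by rewrite eq_sym.
  by case: eqP => // e; move: h; rewrite -e mdeg1.
by rewrite comp_mpolyX (bigD1 i) //= mnm1E eqxx expr1 big1 ?mulr1 => [|j ne];
  rewrite ?tnth_mktuple ?coef_ms_trunc ?ltnS ?leqnSn // mnm1E eq_sym (negbTE ne).
Qed.

Definition mp_eval n (q : {poly A}) (G : {mpoly A[n]}) :=
  \sum_(k < size q) q`_k *: G ^+ k.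

Lemma mp_evalE n (q : {poly A}) (G : {mpoly A[n]}) :
  mp_eval q G = (map_poly (@mpolyC n A) q).[G].
Proof.
rewrite /mp_eval (horner_coef_wide _ (size_poly _ _)).
by apply: eq_bigr => i _; rewrite coef_map /= mul_mpolyC.
Qed.

Lemma mp_evalEw N n (q : {poly A}) (G : {mpoly A[n]}) : (size q <= N)%N ->
  mp_eval q G = \sum_(k < N) q`_k *: G ^+ k.
Proof.
move=> h; rewrite mp_evalE (@horner_coef_wide _ N).
  by apply: eq_bigr => i _; rewrite coef_map /= mul_mpolyC.
exact: leq_trans (size_poly _ _) h.
Qed.

Lemma mp_eval_comp n (q r : {poly A}) (G : {mpoly A[n]}) :
  mp_eval (q \Po r) G = mp_eval q (mp_eval r G).
Proof. by rewrite !mp_evalE map_comp_poly horner_comp. Qed.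

(** Passage from series in one variable seen as [mseries 1] to evaluation of ordinary polynomials: a
    monomial in one variable is determined by its degree. *)
Lemma ms_app1_subst N n s (G : mseries A n) m : G 0%MM = 0 -> (mdeg m < N)%N ->
  ms_app1 s G m = (mp_eval (ps_trunc N s) (ms_trunc N G))@_m.
Proof.
move=> G0 lt; rewrite /ms_app1 (ms_substE _ _ lt) //; congr _@_m.
rewrite /ms_trunc {1}/ms_uni raddf_sum (@mp_evalEw N) ?size_poly //=.
have bnd (i : 'I_N) : (mdeg (U_(@ord0 0) *+ i)%MM < N)%N.
  by rewrite mdegMn mdeg1 mul1n.
rewrite (reindex_omap (fun i : 'I_N => BMultinom (bnd i))
   (fun m : 'X_{1..1 < N} => Some (Ordinal (bmdeg m)))) /=; last first.
  move=> [m' hm'] _ /=; congr Some; apply: val_inj => /=.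
  apply/mnmP => i; rewrite mulmnE mnm1E [i]ord1 eqxx mul1n mdegE.
  by rewrite big_ord1.
apply: eq_big => [i|i _].
  by apply/eqP; congr Some; apply: val_inj; rewrite /= mdegMn mdeg1 mul1n.
rewrite comp_mpolyZ comp_mpolyX big_ord1 tnth_mktuple mulmnE mnm1E eqxx mul1n.
by rewrite mdegMn mdeg1 mul1n coef_poly ltn_ord.
Qed.

Lemma meq_mp_eval d n q (G G' : {mpoly A[n]}) : meq d G G' ->
  meq d (mp_eval q G) (mp_eval q G').
Proof.
by move=> H; apply: meq_sum => i _; apply: meqZ; apply: meqX.
Qed.

Lemma ms_app10 n s (G : mseries A n) : s 0%N = 0 -> G 0%MM = 0 ->
  ms_app1 s G 0%MM = 0.
Proof. by move=> s0 G0; rewrite /ms_app1 ms_subst0 // /ms_uni mdeg0. Qed.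

Lemma ms_app1_comp n s t (G : mseries A n) : t 0%N = 0 -> G 0%MM = 0 ->
  ms_app1 (ps_comp s t) G = ms_app1 s (ms_app1 t G).
Proof.
move=> t0 G0; apply: funext => m; pose N := (mdeg m).+1.
have lt : (mdeg m < N)%N by [].
rewrite (ms_app1_subst _ _ lt) // [RHS](ms_app1_subst _ _ lt) ?ms_app10 //.
apply: (meqE (d := N)) => //.
apply: (@meq_trans _ _ _ _ (mp_eval (ps_trunc N s \Po ps_trunc N t) (ms_trunc N G))).
  rewrite (@mp_evalEw N) ?size_poly //.
  set M := size (ps_trunc N s \Po ps_trunc N t).
  rewrite (@mp_evalEw (N + M)) ?leq_addl // big_split_ord /=.
  rewrite -[X in meq _ X _]addr0; apply: meqD.
    apply: meq_sum => i _; rewrite coef_poly ltn_ord.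
    have -> : ps_comp s t i = (ps_trunc N s \Po ps_trunc N t)`_i.
      rewrite (@ps_compEw _ N) // coef_comp_poly.
      rewrite [RHS](big_ord_widen_cond N xpredT (fun j => (ps_trunc N s)`_j *
        ((ps_trunc N t) ^+ j)`_i)) ?size_poly //=.
      rewrite [RHS]big_mkcond /=; apply: eq_bigr => j _.
      rewrite (psX_trunc _ _ (ltn_ord i)).
      case: ltnP => h; first by rewrite coef_ps_trunc ltn_ord.
      by have := nth_default 0 h; rewrite coef_ps_trunc ltn_ord => ->; rewrite mul0r.
    exact: meq_refl.
  apply: meq_sym; rewrite /meq subr0; apply: mord_sum => i _; apply: mordZ.
  apply: (@mordW _ _ (1 * (N + i))); first by rewrite mul1n leq_addr.
  exact/mordX/ms_trunc_ord.
rewrite mp_eval_comp; apply: meq_mp_eval => m' lt'.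
by rewrite mcoeffB coef_ms_trunc lt' -(ms_app1_subst _ _ lt') // subrr.
Qed.

Lemma ms_app1_scale n c s (G : mseries A n) :
  ms_app1 (ps_const c * s) G = ms_scale c (ms_app1 s G).
Proof.
rewrite /ms_app1 -ms_substZ; congr ms_subst; apply: funext => m.
by rewrite /ms_uni ps_const_mul.
Qed.

Lemma ms_app1_X n (G : mseries A n) : G 0%MM = 0 -> ms_app1 (ps_X A) G = G.
Proof.
move=> G0; rewrite /ms_app1 -[RHS](@ms_subst_var 1 n ord0 (fun=> G)) //.
congr ms_subst; apply: funext => m; rewrite /ms_uni /ps_X /ms_var.
congr (nat_of_bool _)%:R; apply/eqP/eqP => [/eqP/mdeg1P[i /eqP ->]|->].
  by rewrite [i]ord1.
by rewrite mdeg1.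
Qed.

Lemma ms_app1_zero n s : s 0%N = 0 -> ms_app1 s (@ms_zero A n) = @ms_zero A n.
Proof.
move=> s0; apply: funext => m; rewrite (@ms_app1_subst (mdeg m).+1) //.
have -> : ms_trunc (mdeg m).+1 (@ms_zero A n) = 0.
  by apply/mpolyP => m'; rewrite coef_ms_trunc mcoeff0 if_same.
rewrite (@mp_evalEw (mdeg m).+1) ?size_poly // big_ord_recl.
rewrite coef_ps_trunc /= s0 scale0r add0r.
by rewrite big1 ?mcoeff0 // => i _; rewrite exprS mul0r scaler0.
Qed.

Lemma ms_subst_app1 k n s (F : mseries A k) (G : 'I_k -> mseries A n) :
  F 0%MM = 0 -> (forall i, G i 0%MM = 0) ->
  ms_subst (ms_app1 s F) G = ms_app1 s (ms_subst F G).
Proof. by move=> F0 G0; rewrite /ms_app1 ms_substA. Qed.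

Lemma ms_app1E n s (G : mseries A n) : ms_app1 s G = ms_subst (ms_uni s) (fun=> G).
Proof. by []. Qed.

Lemma ms_app2E n (F : mseries A 2) (G H : mseries A n) :
  ms_app2 F G H = ms_subst F (fun i => if i == 0 then G else H).
Proof. by []. Qed.

(* Otherwise unification unfolds the truncated compositions and diverges. *)
#[local] Opaque ms_app1 ms_subst.

Section LogGroup.
Variables L Li : pseries A.
Hypotheses (L0 : L 0%N = 0) (Li0 : Li 0%N = 0).

Definition log_group : mseries A 2 :=
  ms_app1 Li (ms_add (ms_app1 L (ms_var A (0 : 'I_2)))
                     (ms_app1 L (ms_var A (1 : 'I_2)))).

Lemma log_groupE :
  log_group = ms_app1 Li (ms_add (ms_app1 L (ms_var A (0 : 'I_2)))
                                 (ms_app1 L (ms_var A (1 : 'I_2)))).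
Proof. by []. Qed.

Lemma ms_var0 n (i : 'I_n) : ms_var A i 0%MM = 0.
Proof.
rewrite /ms_var; case: eqP => // /(congr1 (@mdeg n)).
by rewrite mdeg0 mdeg1.
Qed.

Lemma app2_log_group n (G H : mseries A n) : G 0%MM = 0 -> H 0%MM = 0 ->
  ms_app2 log_group G H = ms_app1 Li (ms_add (ms_app1 L G) (ms_app1 L H)).
Proof.
move=> G0 H0; rewrite /ms_app2 /log_group.
have GH0 (i : 'I_2) : (if i == 0 then G else H) 0%MM = 0 by case: ifP.
have e0 (i : 'I_2) : ms_app1 L (ms_var A i) 0%MM = 0.
  by rewrite ms_app10 ?ms_var0.
set V := fun i : 'I_2 => _ in GH0 *.
have W0 : ms_add (ms_app1 L (ms_var A (0 : 'I_2)))
    (ms_app1 L (ms_var A (1 : 'I_2))) 0%MM = 0 by rewrite /ms_add !e0 addr0.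
rewrite (ms_subst_app1 Li W0 GH0).
have hv (i : 'I_2) : ms_subst (ms_app1 L (ms_var A i)) V = ms_app1 L (V i).
  by rewrite (ms_subst_app1 L (ms_var0 i) GH0) (ms_subst_var i GH0).
have gen (i j : 'I_2) : ms_subst (ms_add (ms_app1 L (ms_var A i))
    (ms_app1 L (ms_var A j))) V = ms_add (ms_app1 L (V i)) (ms_app1 L (V j)).
  exact: (etrans (ms_substD _ _ V) (congr2 (@ms_add n) (hv i) (hv j))).
have V0 : V 0 = G by rewrite /V eqxx.
have V1 : V 1 = H by [].
by move: (gen 0 1); rewrite V0 V1 => <-.
Qed.

#[local] Opaque ms_app2 log_group.

Lemma app2_log_group0 n (G H : mseries A n) : G 0%MM = 0 -> H 0%MM = 0 ->
  ms_app2 log_group G H 0%MM = 0.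
Proof.
by move=> G0 H0; rewrite app2_log_group // ms_app10 // /ms_add !ms_app10 ?addr0.
Qed.

Hypotheses (LLi : ps_comp L Li = ps_X A) (LiL : ps_comp Li L = ps_X A).

Lemma ms_app1_LLi n (G : mseries A n) : G 0%MM = 0 ->
  ms_app1 L (ms_app1 Li G) = G.
Proof. by move=> G0; rewrite -ms_app1_comp // LLi ms_app1_X. Qed.

Lemma log_group_axioms (O : A -> Prop) : (forall m, O (log_group m)) ->
  formal_group O log_group.
Proof.
move=> hO.
have z0 n : @ms_zero A n 0%MM = 0 by [].
have addz n (G : mseries A n) : ms_add G (@ms_zero A n) = G.
  by apply: funext => m; rewrite /ms_add addr0.
have zadd n (G : mseries A n) : ms_add (@ms_zero A n) G = G.
  by apply: funext => m; rewrite /ms_add add0r.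
have LiLe n (G : mseries A n) : G 0%MM = 0 -> ms_app1 Li (ms_app1 L G) = G.
  by move=> G0; rewrite -ms_app1_comp // LiL ms_app1_X.
have s0 n (G H : mseries A n) : G 0%MM = 0 -> H 0%MM = 0 ->
    ms_add (ms_app1 L G) (ms_app1 L H) 0%MM = 0.
  by move=> G0 H0; rewrite /ms_add !ms_app10 ?addr0.
have addA n (G H S : mseries A n) : ms_add (ms_add G H) S = ms_add G (ms_add H S).
  by apply: funext => m; rewrite /ms_add addrA.
have addC n (G H : mseries A n) : ms_add G H = ms_add H G.
  by apply: funext => m; rewrite /ms_add addrC.
have x1 := @ms_var0 1 0; have x2 := @ms_var0 2; have x3 := @ms_var0 3.
have commG n (G H : mseries A n) : G 0%MM = 0 -> H 0%MM = 0 ->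
    ms_app2 log_group G H = ms_app2 log_group H G.
  move=> G0 H0.
  exact: (etrans (app2_log_group G0 H0) (etrans (congr1 (ms_app1 Li)
    (addC _ (ms_app1 L G) (ms_app1 L H))) (esym (app2_log_group H0 G0)))).
have assocG n (X Y T : mseries A n) : X 0%MM = 0 -> Y 0%MM = 0 -> T 0%MM = 0 ->
    ms_app2 log_group (ms_app2 log_group X Y) T
    = ms_app2 log_group X (ms_app2 log_group Y T).
  move=> X0 Y0 T0.
  have e1 := app2_log_group (app2_log_group0 X0 Y0) T0.
  have e2 := app2_log_group X0 (app2_log_group0 Y0 T0).
  have e3 := congr1 (ms_app1 L) (app2_log_group X0 Y0).
  have e4 := congr1 (ms_app1 L) (app2_log_group Y0 T0).
  have e5 := etrans e3 (ms_app1_LLi (s0 _ _ _ X0 Y0)).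
  have e6 := etrans e4 (ms_app1_LLi (s0 _ _ _ Y0 T0)).
  rewrite e1 e2 e5 e6.
  exact: (congr1 (ms_app1 Li) (addA _ (ms_app1 L X) (ms_app1 L Y) (ms_app1 L T))).
apply: FormalGroup; first exact: hO.
- move=> X m; rewrite /X (app2_log_group x1 (z0 1%N)) ms_app1_zero //.
  rewrite addz (LiLe _ _ x1); reflexivity.
- move=> X m; rewrite /X (app2_log_group (z0 1%N) x1) ms_app1_zero //.
  rewrite zadd (LiLe _ _ x1); reflexivity.
- move=> X Y T m; exact: (congr1 (@^~ m) (assocG _ X Y T (x3 _) (x3 _) (x3 _))).
- move=> X Y m; exact: (congr1 (@^~ m) (commG _ X Y (x2 _) (x2 _))).
Qed.

(** Through [L], [f] becomes multiplication by [c], which is additive; this one argument serves both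
    [f] and [u]. *)
Lemma log_group_hom f c n (G H : mseries A n) :
  f 0%N = 0 -> ps_comp L f = ps_const c * L -> G 0%MM = 0 -> H 0%MM = 0 ->
  ms_app1 f (ms_app2 log_group G H) =
  ms_app2 log_group (ms_app1 f G) (ms_app1 f H).
Proof.
move=> f0 Lf G0 H0.
rewrite !app2_log_group ?ms_app10 //.
rewrite -!(ms_app1_comp L) // Lf !ms_app1_scale.
set W := ms_add _ _; have W0 : W 0%MM = 0 by rewrite /W /ms_add !ms_app10 ?addr0.
have -> : ms_add (ms_scale c (ms_app1 L G)) (ms_scale c (ms_app1 L H)) = ms_scale c W.
  by apply: funext => m; rewrite /W /ms_add /ms_scale mulrDr.
have X0 : ps_X A 0%N = 0 by [].
have fLi : ps_comp f Li = ps_comp Li (ps_const c * ps_X A).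
  have -> : ps_comp f Li = ps_comp Li (ps_comp L (ps_comp f Li)).
    by rewrite -[RHS]ps_compA ?ps_comp_00 // LiL ps_Xcomp ?ps_comp_00.
  by rewrite -[ps_comp L _]ps_compA // Lf ps_comp_scale // LLi.
rewrite -ms_app1_comp // fLi ms_app1_comp ?ps_const_mul ?mulr0 //.
by rewrite ms_app1_scale ms_app1_X.
Qed.

Lemma log_group_End (O : A -> Prop) f c : ps_int0 O f ->
  ps_comp L f = ps_const c * L -> fg_End O log_group f.
Proof.
move=> hf Lf; split=> //= m; have [f0 _] := hf.
by rewrite (log_group_hom f0 Lf) ?ms_var0.
Qed.

End LogGroup.
End MultiSeries.

(** * Integrality by the Lubin-Tate induction *)

#[local] Opaque ms_app1 ms_app2 ms_subst log_group.

Section CoefficientPredicates.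
Variables (A : comNzRingType) (n : nat).

Definition mcoeffs_in (P : A -> Prop) (Q : {mpoly A[n]}) := forall m, P Q@_m.

Section Sub.
Variable P : A -> Prop.
Hypothesis hP : subring_pred P.

Lemma subring_mcoeffs : subring_pred (mcoeffs_in P).
Proof.
split=> [m|x y hx hy m|x y hx hy m].
- by rewrite mcoeff1; apply: (sp_nat hP).
- by rewrite mcoeffB; apply: (spB hP).
- rewrite mcoeffM; apply: (sp_sum hP) => k _.
  by apply: (spM hP); [exact: hx|exact: hy].
Qed.

Lemma mcoeffs_inZ c Q : P c -> mcoeffs_in P Q -> mcoeffs_in P (c *: Q).
Proof. by move=> hc hQ m; rewrite mcoeffZ; apply: (spM hP). Qed.

Lemma mcoeffs_inX m : mcoeffs_in P 'X_[m].
Proof. by move=> m'; rewrite mcoeffX; apply: (sp_nat hP). Qed.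
End Sub.

Lemma mcoeffs_in_comp k (P : A -> Prop) (hP : subring_pred P)
    (Q : {mpoly A[k]}) (lq : k.-tuple {mpoly A[n]}) :
  (forall m, P Q@_m) -> (forall i, mcoeffs_in P (tnth lq i)) ->
  mcoeffs_in P (Q \mPo lq).
Proof.
move=> hQ hl; rewrite comp_mpolyEX.
apply: (sp_sum (subring_mcoeffs hP)) => m _; apply: mcoeffs_inZ => //.
rewrite comp_mpolyX.
apply: (big_ind (mcoeffs_in P)) => [|x y|i _].
- exact: (sp1 (subring_mcoeffs hP)).
- exact: (spM (subring_mcoeffs hP)).
- exact: (spX (subring_mcoeffs hP)).
Qed.

Lemma scale_vars_comp (c : A) (Q : {mpoly A[n]}) m :
  (Q \mPo [tuple c *: 'X_i | i < n])@_m = c ^+ mdeg m * Q@_m.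
Proof.
have e m' : 'X_[m'] \mPo [tuple c *: ('X_i : {mpoly A[n]}) | i < n]
    = c ^+ mdeg m' *: 'X_[m'].
  rewrite comp_mpolyX mpolyXE_id mdegE expr_sum -scaler_prod.
  apply: eq_bigr => i _.
  by rewrite tnth_mktuple exprZn.
rewrite comp_mpolyEX raddf_sum /= [in RHS](mpolyE Q) raddf_sum mulr_sumr /=.
apply: eq_bigr => m' _; rewrite e !mcoeffZ mcoeffX.
by case: eqP => [->|_]; rewrite ?mulr0 // !mulr1 mulrC.
Qed.
End CoefficientPredicates.

Lemma ms_subst_in (A : comNzRingType) (P : A -> Prop) D k n (F : mseries A k)
    (G : 'I_k -> mseries A n) m : subring_pred P -> (forall i, G i 0%MM = 0) ->
  (forall m', (mdeg m' <= D)%N -> P (F m')) ->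
  (forall i m', (mdeg m' <= D)%N -> P (G i m')) -> (mdeg m <= D)%N ->
  P (ms_subst F G m).
Proof.
move=> hP G0 hF hG mD; rewrite (@ms_substE _ D.+1) //.
have tr l (H : mseries A l) : (forall m', (mdeg m' <= D)%N -> P (H m')) ->
    mcoeffs_in P (ms_trunc D.+1 H).
  move=> hH m'; rewrite coef_ms_trunc; case: ltnP => h; first exact: hH.
  exact: (sp0 hP).
apply: (mcoeffs_in_comp hP); first exact: tr.
by move=> i; rewrite tnth_mktuple; apply: tr => m'; apply: hG.
Qed.

Section LubinTate.
Variables (R : realType) (E : fieldType) (v : E -> R).
Hypothesis hv : nonarch_abs v.
Variables (p : nat) (Z : E -> Prop) (pi : E).
Hypothesis hf : zp_frame v p Z pi.
Let hp := zf_prime hf.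
Notation XP := (ps_XP E p).
Notation vpi0 := (vpi_ge0 hv hf).
Notation vpi1 := (vpi_le1 hf).

Section Integral.
Variables (J : nat) (f L Li : pseries E).
Hypotheses (f0 : f 0%N = 0) (f1 : f 1%N = pi).
Hypotheses (hfJ : forall n, zpmod v Z pi J (f n)) (hX : ps_cong v (v pi) f XP).
Hypotheses (L0 : L 0%N = 0) (Li0 : Li 0%N = 0).
Hypotheses (LLi : ps_comp L Li = ps_X E) (LiL : ps_comp Li L = ps_X E).
Hypothesis Lf : ps_comp L f = ps_const pi * L.
Let F := log_group L Li.

Lemma ms_var_add2 (m : 'X_{1..2}) : mdeg m = 1%N ->
  ms_var E (0 : 'I_2) m + ms_var E (1 : 'I_2) m = 1.
Proof.
move/eqP/mdeg1P=> [i /eqP ->]; rewrite /ms_var !eq_mnm1.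
case: i => -[|[|//]] hi; first by rewrite addr0.
by rewrite add0r.
Qed.

Lemma ms_app1_deg1 n s (G : mseries E n) m : s 0%N = 0 -> G 0%MM = 0 ->
  mdeg m = 1%N -> ms_app1 s G m = s 1%N * G m.
Proof.
move=> s0 G0 dm; rewrite (@ms_app1_subst _ 2) ?dm //.
rewrite (@mp_evalEw _ 2) ?size_poly // !big_ord_recl big_ord0 !coef_ps_trunc /=.
by rewrite s0 scale0r add0r addr0 expr1 mcoeffZ coef_ms_trunc dm.
Qed.

Lemma log_group_sum0 : ms_add (ms_app1 L (ms_var E (0 : 'I_2)))
                     (ms_app1 L (ms_var E (1 : 'I_2))) 0%MM = 0.
Proof. by rewrite /ms_add !ms_app10 ?ms_var0 // addr0. Qed.

Lemma log_group_const0 : F 0%MM = 0.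
Proof. by rewrite /F log_groupE ms_app10 // log_group_sum0. Qed.

Lemma log_group_deg1 m : mdeg m = 1%N -> F m = 1.
Proof.
move=> dm; rewrite /F log_groupE ms_app1_deg1 ?log_group_sum0 //.
rewrite /ms_add !ms_app1_deg1 ?ms_var0 // -mulrDr ms_var_add2 // mulr1.
by rewrite -ps_comp_1 // LiL.
Qed.

Lemma log_group_functional :
  ms_app1 f F = ms_subst F (fun i => ms_app1 f (ms_var E i)).
Proof.
have h := log_group_hom L0 Li0 LLi LiL f0 Lf (ms_var0 E (0 : 'I_2)) (ms_var0 E (1 : 'I_2)).
rewrite app2_log_group ?ms_var0 // in h; rewrite /F log_groupE h.
rewrite ms_app2E; congr ms_subst; apply: funext => i.
have [->|ne] := eqVneq i 0; first reflexivity.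
have -> : i = 1; last reflexivity.
by apply: val_inj; case: i ne => -[|[|//]].
Qed.

Let small (Q : {mpoly E[2]}) := mcoeffs_in (fun x => v x <= v pi) Q.
Let int (Q : {mpoly E[2]}) := mcoeffs_in (vint v) Q.
Let hint : subring_pred int := subring_mcoeffs 2 (subring_vint hv).

Lemma small0 : small 0.
Proof. by move=> m; rewrite mcoeff0 (v0 hv) vpi0. Qed.
Lemma smallD x y : small x -> small y -> small (x + y).
Proof. by move=> hx hy m; rewrite mcoeffD; apply: (vD_le hv). Qed.
Lemma smallM x y : int x -> small y -> small (x * y).
Proof.
move=> hx hy m; rewrite mcoeffM; apply: (v_sum hv) => [|k _]; first exact: vpi0.
rewrite (vM hv) -[v pi]mul1r.
by apply: ler_pM; rewrite ?(v_ge0 hv) //; apply: hx.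
Qed.
Lemma smallZl c x : v c <= v pi -> int x -> small (c *: x).
Proof.
move=> hc hx m; rewrite mcoeffZ (vM hv) -[v pi]mulr1.
by apply: ler_pM; rewrite ?(v_ge0 hv) //; apply: hx.
Qed.
Lemma smallZr c x : v c <= 1 -> small x -> small (c *: x).
Proof.
move=> hc hx m; rewrite mcoeffZ (vM hv) -[v pi]mul1r.
by apply: ler_pM; rewrite ?(v_ge0 hv) //; apply: hx.
Qed.
Lemma small_sum I (l : seq I) (C : pred I) (G : I -> {mpoly E[2]}) :
  (forall i, C i -> small (G i)) -> small (\sum_(i <- l | C i) G i).
Proof.
by move=> H; apply: (big_ind small) => //; [exact: small0|exact: smallD].
Qed.
Lemma small_congM x x' y y' : int x -> int y' ->
  small (x - x') -> small (y - y') -> small (x * y - x' * y').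
Proof.
move=> hx hy' h1 h2; have -> : x * y - x' * y' = x * (y - y') + y' * (x - x') by ring.
by apply: smallD; apply: smallM.
Qed.
Lemma small_congX x y k : int x -> int y -> small (x - y) ->
  small (x ^+ k - y ^+ k).
Proof.
move=> hx hy h; elim: k => [|k IH]; first by rewrite !expr0 subrr; apply: small0.
by rewrite !exprS; apply: small_congM => //; apply: (spX hint).
Qed.
Lemma small_trans x y z : small (x - y) -> small (y - z) -> small (x - z).
Proof. by move=> h1 h2; have := smallD h1 h2; congr small; ring. Qed.

(** Freshman's dream on the monomials, then Fermat on the coefficients. *)
Lemma small_frob (Q : {mpoly E[2]}) : (forall m, zpmod v Z pi 1 Q@_m) ->
  small (Q ^+ p - (Q \mPo [tuple 'X_i ^+ p | i < 2])).
Proof.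
move=> hQ.
have hQi m : v Q@_m <= 1 by apply: (zpmod_int hv hf (hQ m)).
have Ip : small p%:R.
  move=> m; rewrite -[p%:R]mulr_natr mul1r mcoeffMn mcoeff1 -mulrnA.
  by case: (m == 0%MM); rewrite ?mul0n ?(v0 hv) ?vpi0 // mul1n (zf_p hf).
have hmono m : int (Q@_m *: 'X_[m]).
  apply: (mcoeffs_inZ (subring_vint hv)); first exact: hQi.
  exact: (mcoeffs_inX (subring_vint hv)).
have := freshman_sum hint hp small0 smallD smallM Ip (msupp Q) hmono.
rewrite -mpolyE => h1; apply: (small_trans h1).
rewrite comp_mpolyEX -sumrB; apply: small_sum => m _.
rewrite comp_mpolyX exprZn.
have -> : \prod_(i < 2) tnth [tuple ('X_i : {mpoly E[2]}) ^+ p | i < 2] i ^+ m i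
    = 'X_[m] ^+ p.
  rewrite mpolyXE_id -prodrXl; apply: eq_bigr => i _.
  by rewrite tnth_mktuple -!exprM mulnC.
rewrite -scalerBl; apply: smallZl; first exact: (v_fermat hv hf).
apply: (spX hint); exact: (mcoeffs_inX (subring_vint hv)).
Qed.

Lemma small_eval N (Q : {mpoly E[2]}) : (p < N)%N -> int Q ->
  small (mp_eval (ps_trunc N f) Q - Q ^+ p).
Proof.
move=> pN hQ; rewrite (@mp_evalEw _ N) ?size_poly //.
have -> : Q ^+ p = \sum_(k < N) (k == p :> nat)%:R *: Q ^+ k.
  rewrite (bigD1 (Ordinal pN)) //= eqxx scale1r big1 ?addr0 // => k ne.
  case: eqP => [e|]; last by rewrite scale0r.
  by case/eqP: ne; apply: val_inj.
rewrite -sumrB; apply: small_sum => k _; rewrite -scalerBl.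
apply: smallZl; last exact: (spX hint).
by rewrite coef_ps_trunc ltn_ord; have := hX k; rewrite /ps_XP ps_XX.
Qed.

Lemma trunc_app1_var N (i : 'I_2) : (1 < N)%N ->
  ms_trunc N (ms_app1 f (ms_var E i)) = mp_eval (ps_trunc N f) 'X_i.
Proof.
move=> N1.
have tX : ms_trunc N (ms_var E i) = 'X_i.
  apply/mpolyP => m'; rewrite coef_ms_trunc mcoeffX /ms_var.
  case: ltnP => h; first by rewrite eq_sym.
  by case: eqP => // e; move: h; rewrite -e mdeg1 leqNgt N1.
apply/mpolyP => m; rewrite coef_ms_trunc; case: ltnP => h.
  have e := ms_app1_subst f (ms_var0 E i) h.
  rewrite tX in e; exact: e.
rewrite (@mp_evalEw _ N) ?size_poly // raddf_sum big1 //= => k _.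
rewrite mcoeffZ mcoeffXn; case: eqP => [e|]; last by rewrite mulr0.
by move: h; rewrite -e mdegMn mdeg1 mul1n leqNgt ltn_ord.
Qed.

(** The coefficient of [m] in [f(F(X,Y)) = F(f(X),f(Y))]: on the left [F m] occurs through the
    linear term of [f], with factor [pi]; on the right through the linear terms of [f(X)] and
    [f(Y)], with factor [pi^d]. The rest depends on the truncation of [F] below degree [d]. *)
Lemma coef_recursion d N m : mdeg m = d -> (1 < d)%N -> (d < N)%N ->
  (pi - pi ^+ d) * F m =
  (ms_trunc d F \mPo [tuple ms_trunc N (ms_app1 f (ms_var E i)) | i < 2])@_m
  - (mp_eval (ps_trunc N f) (ms_trunc d F))@_m.
Proof.
move=> dm d1 dN; have mN : (mdeg m < N)%N by rewrite dm.
have N1 : (1 < N)%N by apply: ltn_trans dN.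
set lq := [tuple _ | i < 2]; set T := ms_trunc d F.
pose H := ms_trunc N F - T.
have oH : mord d H by apply: ms_trunc_meq; apply: ltnW.
have Hm : H@_m = F m.
  by rewrite mcoeffB !coef_ms_trunc mN dm ltnn subr0.
have FE : ms_trunc N F = T + H by rewrite /H; ring.
have oF k : mord 1 (ms_trunc k F) by apply: ms_trunc_ord; exact: log_group_const0.
have dm1 : (mdeg m < d.+1)%N by rewrite dm.
have lead i : meq_lead 1 (tnth lq i) (tnth [tuple pi *: 'X_j | j < 2] i).
  rewrite !tnth_mktuple trunc_app1_var //.
  have oX : mord 1 ('X_i : {mpoly E[2]}).
    by apply: mord1; rewrite mcoeffX; case: eqP => // /(congr1 (@mdeg _));
      rewrite mdeg1 mdeg0.
  have e : mp_eval (ps_trunc N f) 'X_i = pi *: 'X_i +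
      \sum_(k < N.-2) f k.+2 *: ('X_i : {mpoly E[2]}) ^+ k.+2.
    rewrite (@mp_evalEw _ N) ?size_poly //.
    case: (N) N1 => [|[|n]] // _; rewrite !big_ord_recl !coef_ps_trunc /= f0 f1.
    rewrite scale0r add0r expr1; congr (_ + _); apply: eq_bigr => k _.
    by rewrite coef_ps_trunc !ltnS ltn_ord.
  have o2 : mord 2 (\sum_(k < N.-2) f k.+2 *: ('X_i : {mpoly E[2]}) ^+ k.+2).
    apply: mord_sum => k _; apply: mordZ.
    by apply: (@mordW _ _ (1 * k.+2)); [rewrite mul1n|apply: mordX].
  split; first by rewrite e; apply: mordD; [apply: mordZ|apply: mordW o2].
    exact: mordZ.
  by rewrite /meq e addrC addKr.
have eqR : ms_subst F (fun i => ms_app1 f (ms_var E i)) m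
    = (T \mPo lq)@_m + pi ^+ d * F m.
  rewrite (ms_substE _ _ mN) => [|i]; last by rewrite ms_app10 ?ms_var0.
  rewrite -/lq FE raddfD mcoeffD; congr (_ + _).
  rewrite (meqE (meq_lead_comp lead oH)) // scale_vars_comp dm Hm //.
have eqL : ms_app1 f F m = (mp_eval (ps_trunc N f) T)@_m + pi * F m.
  rewrite (ms_app1_subst _ log_group_const0 mN).
  have -> : (mp_eval (ps_trunc N f) T)@_m + pi * F m =
      (mp_eval (ps_trunc N f) T + pi *: H)@_m by rewrite mcoeffD mcoeffZ Hm.
  apply: (meqE (d := d.+1)) => //.
  have -> : pi *: H = \sum_(k < N) (if k == 1%N :> nat then pi *: H else 0).
    rewrite (bigD1 (Ordinal N1)) //= big1 ?addr0 // => k ne.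
    case: eqP => // e; case/eqP: ne; exact: val_inj.
  rewrite !(@mp_evalEw _ N) ?size_poly // -big_split /=; apply: meq_sum => k _.
  rewrite coef_ps_trunc ltn_ord; case: k => -[|[|k]] hk /=.
  - rewrite f0 !scale0r addr0; exact: meq_refl.
  - rewrite f1 !expr1 FE scalerDr; exact: meq_refl.
  - rewrite addr0; apply: meqZ; rewrite /meq subrXX FE addrC addKr.
    apply: (@mordW _ _ (d + 1)); first by rewrite addn1.
    apply: mordM => //; apply: mord_sum => i _; rewrite -FE.
    have [i0|i0] := posnP i.
      rewrite i0 expr0 mulr1 subn0.
      by apply: (@mordW _ _ (1 * k.+1)); [rewrite mul1n|apply: mordX].
    rewrite mulrC.
    apply: (@mordW _ _ (1 * i + 0)); first by rewrite mul1n addn0.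
    exact: mordM (@mordX _ _ 1 T i (oF d)) (@mord_0 _ _ _).
have := congr1 (@^~ m) log_group_functional; rewrite eqL eqR => e.
have -> : (T \mPo lq)@_m = (mp_eval (ps_trunc N f) T)@_m + pi * F m - pi ^+ d * F m.
  by rewrite e addrK.
ring.
Qed.

(** Solving the recursion means dividing by [pi - pi^d], that is by [pi] times a unit of [Z_p]. This
    costs one level per degree, hence the level [J - mdeg m]. *)
Lemma log_group_zpmod m : (mdeg m <= J)%N -> zpmod v Z pi (J - mdeg m) (F m).
Proof.
have [d] := ubnP (mdeg m); elim: d m => // d IH m; rewrite ltnS => md mJ.
case dm: (mdeg m) md mJ => [|[|e]] md mJ.
- have -> : m = 0%MM by apply/eqP; rewrite -mdeg_eq0 dm.
  rewrite log_group_const0; exact: (sp0 (zpmod_sub hv hf _)).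
- rewrite log_group_deg1 //; exact: (sp1 (zpmod_sub hv hf _)).
(* The level known for all degrees below [D]. It is at least 1, so Fermat applies to the
   coefficients of [T]. *)
set D := e.+2 in dm md mJ *; pose i := (J - D).+1.
have iJ : (i <= J)%N by rewrite /i /D in mJ *; lia.
have sub := zpmod_sub hv hf i.
have msub := subring_mcoeffs 2 sub.
pose N := (D + p).+1.
have DN : (D < N)%N by rewrite /N; lia.
have pN : (p < N)%N by rewrite /N; lia.
have N1 : (1 < N)%N by rewrite /N /D; lia.
have := coef_recursion dm (isT : (1 < D)%N) DN.
set T := ms_trunc D F; set lq := [tuple _ | _ < _].
have hT : mcoeffs_in (zpmod v Z pi i) T.
  move=> m'; rewrite coef_ms_trunc; case: ltnP => h; last exact: (sp0 sub).
  apply: (zpmodW hv hf (J := J - mdeg m')); first by rewrite /i; lia.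
  by apply: IH; lia.
have hfi k : zpmod v Z pi i (f k) by apply: (zpmodW hv hf) (hfJ k).
have hev Q : mcoeffs_in (zpmod v Z pi i) Q ->
    mcoeffs_in (zpmod v Z pi i) (mp_eval (ps_trunc N f) Q : {mpoly E[2]}).
  move=> hQ; apply: (sp_sum msub) => k _; apply: (mcoeffs_inZ sub).
    by rewrite coef_ps_trunc; case: ifP => _ //; exact: (sp0 sub).
  exact: (spX msub).
have hlq j : mcoeffs_in (zpmod v Z pi i) (tnth lq j).
  rewrite tnth_mktuple trunc_app1_var //; apply: hev.
  exact: (mcoeffs_inX sub).
have hZ1 c : zpmod v Z pi i c -> zpmod v Z pi 1 c by apply: (zpmodW hv hf).
have toint Q : mcoeffs_in (zpmod v Z pi i) Q -> int Q.
  by move=> hQ m'; apply: (zpmod_int hv hf (hQ m')).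
set c := (X in _ = X) => ec.
have cZ : zpmod v Z pi i c.
  apply: (spB sub); first exact: (mcoeffs_in_comp sub hT hlq).
  exact: (hev _ hT).
(* Lubin-Tate congruence: as [f = X^p] modulo [pi], both [T(f(X),f(Y))] and [f(T)] are [T(X^p,Y^p)]
   modulo [pi]. *)
have csmall : v c <= v pi.
  have s1 : small ((T \mPo lq) - (T \mPo [tuple 'X_j ^+ p | j < 2])).
    rewrite !comp_mpolyEX -sumrB; apply: small_sum => m' _.
    rewrite -scalerBr; apply: smallZr; first exact: (toint _ hT m').
    have iX (j : 'I_2) : int 'X_j by apply: (mcoeffs_inX (subring_vint hv)).
    suff [_ _ //] : [/\ int ('X_[m'] \mPo lq),
       int ('X_[m'] \mPo [tuple 'X_j ^+ p | j < 2]) &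
       small ('X_[m'] \mPo lq - ('X_[m'] \mPo [tuple 'X_j ^+ p | j < 2]))].
    rewrite !comp_mpolyX.
    elim: (index_enum _) => [|j l [h1 h2 h3]].
      rewrite !big_nil subrr; split; try exact: small0; exact: (sp1 hint).
    have hl := toint _ (hlq j).
    have hXp : int (tnth [tuple ('X_j : {mpoly E[2]}) ^+ p | j < 2] j).
      by rewrite tnth_mktuple; apply: (spX hint).
    rewrite !big_cons; split; try by apply: (spM hint) => //; apply: (spX hint).
    apply: small_congM => //; first exact: (spX hint).
    apply: small_congX => //; rewrite !tnth_mktuple trunc_app1_var //.
    exact: small_eval.
  have s2 : small (T ^+ p - (T \mPo [tuple 'X_j ^+ p | j < 2])).
    by apply: small_frob => m'; apply: hZ1; apply: hT.
  have s3 := small_eval pN (toint _ hT).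
  have := small_trans s3 s2 m; have := s1 m; rewrite !mcoeffB => h1 h2.
  have sub_sub (x y z : E) : v (x - z) <= v pi -> v (y - z) <= v pi ->
      v (x - y) <= v pi.
    move=> hx hy; have -> : x - y = (x - z) - (y - z) by ring.
    exact: (vB_le hv).
  exact: sub_sub h1 h2.
pose w := 1 - pi ^+ e.+1.
have vw : v w = 1 by apply: (v_1subpi hv hf).
have wn : w != 0 by rewrite -(v_eq0 hv) vw oner_eq0.
have Zw : Z w^-1.
  apply: (zf_inv hf) => //; apply: (spB (zf_sub hf)); first exact: (sp1 (zf_sub hf)).
  apply: (spX (zf_sub hf)); exact: (zf_pi hf).
have -> : F m = (c / pi) * w^-1.
  have ew : pi - pi ^+ D = pi * w by rewrite /D /w exprS; ring.
  by rewrite -ec ew; field; rewrite wn (zf_pi0 hf).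
apply: (spM (zpmod_sub hv hf _)); last exact: (zpmodZ hv hf).
exact: (zpmod_div hv hf).
Qed.

End Integral.

(** The conjugate of [f] has logarithm [L(G)], so its group law is that of [f] transported by the
    integral series [F] and [G]; integrality passes from one to the other. *)
Lemma log_group_conj (L Li F G : pseries E) : mutually_inverse v F G ->
  L 0%N = 0 -> Li 0%N = 0 ->
  log_group L Li = ms_app1 G (ms_app2 (log_group (ps_comp L G) (ps_comp F Li))
    (ms_app1 F (ms_var E 0)) (ms_app1 F (ms_var E 1))).
Proof.
move=> hm L0 Li0; have F0 := mi_F0 hm; have G0 := mi_G0 hm.
rewrite app2_log_group ?ps_comp_00 ?ms_app10 ?ms_var0 //.
have e (i : 'I_2) : ms_app1 (ps_comp L G) (ms_app1 F (ms_var E i)) = ms_app1 L (ms_var E i).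
  by rewrite -ms_app1_comp ?ms_var0 // ps_compA // (mi_GF hm) ps_comp_X.
rewrite (e 0) (e 1) -ms_app1_comp ?ps_comp_00 ?log_group_sum0 //.
by rewrite -ps_compA // (mi_GF hm) ps_Xcomp.
Qed.

Lemma ms_app1_int D n (s : pseries E) (G : mseries E n) m : G 0%MM = 0 ->
  ps_le v 1 s -> (forall m', (mdeg m' <= D)%N -> v (G m') <= 1) ->
  (mdeg m <= D)%N -> v (ms_app1 s G m) <= 1.
Proof.
move=> G0 hs hG mD; rewrite ms_app1E.
apply: (@ms_subst_in _ (vint v) D) => //; first exact: (subring_vint hv).
by move=> m' _; apply: hs.
Qed.

(** For a coefficient of degree [D], stage [D + 1] of the descent suffices: substituting integral
    series without constant term only uses coefficients of degree at most [D]. *)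
Theorem log_group_int (f u L Li : pseries E) : GRing.closed_field_axiom E ->
  dyn v Z pi f u -> v (f p) = 1 -> L 0%N = 0 -> Li 0%N = 0 ->
  ps_comp L Li = ps_X E -> ps_comp Li L = ps_X E ->
  ps_comp L f = ps_const pi * L -> forall m, v (log_group L Li m) <= 1.
Proof.
move=> cl hd fp L0 Li0 LLi LiL Lf m; set D := mdeg m.
have [F [G [hm [hd1 hX1 hf1 _]]]] := descent hv hf cl hd fp D.
have F0 := mi_F0 hm; have G0 := mi_G0 hm; have f0 := dyn_f0 hd.
set f1 := conj_by F G f in hd1 hX1 hf1.
rewrite (log_group_conj hm L0 Li0).
set L1 := ps_comp L G; set Li1 := ps_comp F Li.
have L10 : L1 0%N = 0 by rewrite /L1 ps_comp_00.
have Li10 : Li1 0%N = 0 by rewrite /Li1 ps_comp_00.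
have LLi1 : ps_comp L1 Li1 = ps_X E.
  by rewrite /L1 /Li1 ps_compA ?ps_comp_00 // -(ps_compA G) // (mi_GF hm) ps_Xcomp.
have LiL1 : ps_comp Li1 L1 = ps_X E.
  by rewrite /L1 /Li1 ps_compA ?ps_comp_00 // -(ps_compA Li) // LiL ps_Xcomp //
    (mi_FG hm).
have Lf1 : ps_comp L1 f1 = ps_const pi * L1.
  rewrite /L1 /f1 /conj_by ps_compA ?ps_comp_00 // -(ps_compA G) ?ps_comp_00 //.
  rewrite (mi_GF hm) ps_Xcomp ?ps_comp_00 // -ps_compA // Lf ps_comp_scale //.
have F1int m' : (mdeg m' <= D)%N -> v (log_group L1 Li1 m') <= 1.
  move=> h; apply: (zpmod_int hv hf (J := D.+1 - mdeg m')).
  apply: (log_group_zpmod (dyn_f0 hd1) (dyn_f1 hd1) hf1 hX1) => //.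
  exact: leqW.
have x0 (i : 'I_2) : ms_app1 F (ms_var E i) 0%MM = 0 by rewrite ms_app10 ?ms_var0.
have xint (i : 'I_2) m' : v (ms_app1 F (ms_var E i) m') <= 1.
  apply: (ms_app1_int (D := mdeg m')) => //; first exact: ms_var0.
    exact: (mi_F hm).
  by move=> m'' _; rewrite /ms_var (v_nat hv).
apply: (ms_app1_int (D := D)) => //.
- by rewrite app2_log_group0.
- exact: (mi_G hm).
move=> m' h; rewrite ms_app2E.
apply: (@ms_subst_in _ (vint v) D) => //; first exact: (subring_vint hv).
  by move=> i; case: ifP.
by move=> i m'' _; case: ifP => _; apply: xint.
Qed.

End LubinTate.

(** * Evaluation on the open disk and zeros of [f'] *)

Section Evaluation.
Variables (R : realType) (C : fieldType) (v : C -> R).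
Hypothesis hv : nonarch_abs v.
Implicit Types (s t : pseries C) (x y z : C).

Lemma cvg_unique w (l l' : C) : cvg_abs v w l -> cvg_abs v w l' -> l = l'.
Proof.
move=> h h'; apply/eqP; rewrite -subr_eq0 -(v_eq0 hv); apply/eqP.
apply/eqP; rewrite eq_le (v_ge0 hv) andbT leNgt; apply/negP => lt.
have [N HN] := h _ lt; have [N' HN'] := h' _ lt.
have := vB_lt hv (HN' (maxn N N') (leq_maxr _ _)) (HN (maxn N N') (leq_maxl _ _)).
have -> : w (maxn N N') - l' - (w (maxn N N') - l) = l - l' by ring.
by rewrite ltxx.
Qed.

Lemma cvg_near w w' l : cvg_abs v w l ->
  (forall e : R, 0 < e -> exists N, forall n, (N <= n)%N -> v (w' n - w n) < e) ->
  cvg_abs v w' l.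
Proof.
move=> h h' e e0; have [N HN] := h e e0; have [N' HN'] := h' e e0.
exists (maxn N N') => n; rewrite geq_max => /andP[l1 l2].
have -> : w' n - l = (w' n - w n) + (w n - l) by ring.
by apply: (vD_lt hv); [apply: HN'|apply: HN].
Qed.

Lemma v_horner_ord (P : {poly C}) x N : (forall k, v P`_k <= 1) ->
  (forall k, (k < N)%N -> P`_k = 0) -> v x <= 1 -> v P.[x] <= v x ^+ N.
Proof.
move=> hP hN hx; have x0 := v_ge0 hv x; rewrite horner_coef.
apply: (v_sum hv) => [|k _]; first exact: exprn_ge0.
have [lt|le] := ltnP k N; first by rewrite hN // mul0r (v0 hv) exprn_ge0.
rewrite (vM hv) (vX hv) -[v x ^+ N]mul1r ler_pM ?(v_ge0 hv) ?exprn_ge0 //.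
exact: ler_wiXn2l.
Qed.

Lemma v_horner_int (P : {poly C}) x : (forall k, v P`_k <= 1) -> v x <= 1 ->
  v P.[x] <= 1.
Proof. by move=> hP hx; have := @v_horner_ord P x 0 hP; rewrite expr0; apply. Qed.

Lemma v_horner_lip (P : {poly C}) x y : (forall k, v P`_k <= 1) -> v x <= 1 ->
  v y <= 1 -> v (P.[x] - P.[y]) <= v (x - y).
Proof.
move=> hP hx hy; rewrite !horner_coef -sumrB.
apply: (v_sum hv) => [|k _]; first exact: (v_ge0 hv).
rewrite -mulrBr subrXX mulrCA (vM hv) -[X in _ <= X]mulr1 ler_pM ?(v_ge0 hv) //.
rewrite (vM hv) mulr_ile1 ?(v_ge0 hv) //.
apply: (sp_sum (subring_vint hv)) => i _.
by apply: (spM (subring_vint hv)); apply: (spX (subring_vint hv)).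
Qed.

Lemma eval_toE s x y :
  ps_eval_to v s x y <-> cvg_abs v (fun N => (ps_trunc N s).[x]) y.
Proof.
have e N : (ps_trunc N s).[x] = \sum_(k < N) s k * x ^+ k by rewrite horner_poly.
by split=> h e' e0; have [N HN] := h e' e0; exists N => n /HN; rewrite e.
Qed.

Lemma trunc_int N s : ps_le v 1 s -> forall k, v (ps_trunc N s)`_k <= 1.
Proof.
by move=> hs k; rewrite coef_ps_trunc; case: ifP => // _; rewrite (v0 hv) ler01.
Qed.

Lemma pow_small x (e : R) : v x < 1 -> 0 < e ->
  exists N, forall n, (N <= n)%N -> v x ^+ n < e.
Proof.
move=> hx e0; have [N HN] := exp_small (v_ge0 hv x) hx e0.
exists N => n le; apply: le_lt_trans HN.
by rewrite ler_wiXn2l ?(v_ge0 hv) // ltW.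
Qed.

Lemma eval_scale s x y c : ps_eval_to v s x y ->
  ps_eval_to v (ps_const c * s) x (c * y).
Proof.
have [->|c0] := eqVneq c 0.
  move=> _ e e0; exists 0%N => n _; rewrite mul0r subr0 big1 ?(v0 hv) // => k _.
  by rewrite ps_const_mul !mul0r.
move=> h e e0; have vc : 0 < v c by rewrite (v_gt0 hv).
have [N HN] := h (e / v c) (divr_gt0 e0 vc); exists N => n /HN.
rewrite ltr_pdivlMr // mulrC -(vM hv) mulrBr mulr_sumr.
by under [in X in _ -> X]eq_bigr => k _ do rewrite ps_const_mul -mulrA.
Qed.

Lemma eval_mul s t x y z : ps_le v 1 s -> ps_le v 1 t -> v x < 1 ->
  ps_eval_to v s x y -> ps_eval_to v t x z -> ps_eval_to v (s * t) x (y * z).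
Proof.
move=> hs ht hx /eval_toE h1 /eval_toE h2; apply/eval_toE.
have hx1 := ltW hx.
apply: (@cvg_near (fun N => (ps_trunc N s).[x] * (ps_trunc N t).[x])).
  move=> e e0.
  have [N1 H1] := h1 1 ltr01.
  have vy : v y <= 1.
    have -> : y = (ps_trunc N1 s).[x] - ((ps_trunc N1 s).[x] - y) by ring.
    apply: (vB_le hv); last exact/ltW/H1.
    by apply: v_horner_int => //; apply: trunc_int.
  have [Na Ha] := h1 e e0; have [Nb Hb] := h2 e e0.
  exists (maxn Na Nb) => n; rewrite geq_max => /andP[l1 l2].
  set a := (ps_trunc n s).[x]; set b := (ps_trunc n t).[x].
  have -> : a * b - y * z = (a - y) * b + y * (b - z) by ring.
  have vb : v b <= 1 by apply: v_horner_int => //; apply: trunc_int.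
  apply: (vD_lt hv); rewrite (vM hv).
    by apply: le_lt_trans (Ha n l1); rewrite ler_piMr ?(v_ge0 hv).
  by apply: le_lt_trans (Hb n l2); rewrite ler_piMl ?(v_ge0 hv).
move=> e e0; have [N HN] := pow_small hx e0; exists N => n /HN lt.
apply: le_lt_trans lt; rewrite -hornerM -hornerN -hornerD.
apply: v_horner_ord => // k.
  rewrite coefB; apply: (vB_le hv).
    exact/trunc_int/(sp_psM (subring_vint hv)).
  rewrite coefM; apply: (sp_sum (subring_vint hv)) => i _.
  by apply: (spM (subring_vint hv)); apply: trunc_int.
by move=> lt; rewrite coefB coef_ps_trunc lt -(psM_trunc _ _ lt) subrr.
Qed.

Lemma eval_comp s t x y z : ps_le v 1 s -> ps_le v 1 t -> t 0%N = 0 -> v x < 1 ->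
  v y < 1 ->
  ps_eval_to v t x y -> ps_eval_to v s y z -> ps_eval_to v (ps_comp s t) x z.
Proof.
move=> hs ht t0 hx hy /eval_toE h1 /eval_toE h2; apply/eval_toE.
have hx1 := ltW hx; have hy1 := ltW hy.
apply: (@cvg_near (fun N => (ps_trunc N s \Po ps_trunc N t).[x])).
  apply: (cvg_near h2) => e e0; have [N HN] := h1 e e0; exists N => n /HN.
  apply: le_lt_trans; rewrite horner_comp; apply: v_horner_lip => //.
    exact: trunc_int.
  by apply: v_horner_int => //; apply: trunc_int.
move=> e e0; have [N HN] := pow_small hx e0; exists N => n /HN lt.
apply: le_lt_trans lt; rewrite -hornerN -hornerD.
apply: v_horner_ord => // k.
  rewrite coefB; apply: (vB_le hv).
    exact/trunc_int/(sp_comp (subring_vint hv)).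
  rewrite coef_comp_poly; apply: (sp_sum (subring_vint hv)) => i _.
  apply: (spM (subring_vint hv)); first exact: trunc_int.
  elim: (nat_of_ord i) k => [|j IH] k; first by rewrite expr0 coef1 /vint (v_nat hv).
  rewrite exprS coefM; apply: (sp_sum (subring_vint hv)) => l _.
  by apply: (spM (subring_vint hv)); [apply: trunc_int|apply: IH].
move=> lt; rewrite coefB coef_ps_trunc lt; apply/eqP; rewrite subr_eq0; apply/eqP.
rewrite (@ps_compEw _ n) // coef_comp_poly.
rewrite [RHS](big_ord_widen_cond n xpredT (fun j => (ps_trunc n s)`_j *
  ((ps_trunc n t) ^+ j)`_k)) ?size_poly //=.
rewrite [RHS]big_mkcond /=; apply: eq_bigr => j _; rewrite (psX_trunc _ _ lt).
case: ltnP => h; first by rewrite coef_ps_trunc ltn_ord.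
by have := nth_default 0 h; rewrite coef_ps_trunc ltn_ord => ->; rewrite mul0r.
Qed.

(** The bound [2 <= N] ensures that the truncation contains the constant and linear coefficients,
    which [eval_const] and [eval_linear] compare with the value. *)
Lemma eval_near s x y : ps_eval_to v s x y -> forall e : R, 0 < e ->
  exists2 N, (2 <= N)%N & v ((ps_trunc N s).[x] - y) < e.
Proof.
move=> /eval_toE h e e0; have [N HN] := h e e0; exists (maxn 2 N); first exact: leq_maxl.
exact/HN/leq_maxr.
Qed.

Lemma eval_le s x y (P : {poly C}) (r : R) : ps_eval_to v s x y -> 0 <= r ->
  (forall N, (2 <= N)%N -> v ((ps_trunc N s).[x] - P.[x]) <= r) ->
  v (y - P.[x]) <= r.
Proof.
move=> h r0 H; rewrite leNgt; apply/negP => lt.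
have [N N2 HN] := eval_near h (le_lt_trans r0 lt).
have : v (y - P.[x]) < v (y - P.[x]).
  rewrite {1}(_ : y - P.[x] = ((ps_trunc N s).[x] - P.[x]) - ((ps_trunc N s).[x] - y)).
    by apply: (vB_lt hv) => //; apply: le_lt_trans (H N N2) lt.
  ring.
by rewrite ltxx.
Qed.

Lemma eval_const s x y : ps_le v 1 s -> v x <= 1 -> ps_eval_to v s x y ->
  v (y - s 0%N) <= v x.
Proof.
move=> hs hx h; have := @eval_le s x y (s 0%N)%:P (v x) h (v_ge0 hv x).
rewrite hornerC; apply => N N2; rewrite -[s 0%N](hornerC _ x) -hornerN -hornerD.
have := @v_horner_ord (ps_trunc N s - (s 0%N)%:P) x 1; rewrite expr1; apply => // k.
  rewrite coefB coefC; apply: (vB_le hv); first exact: trunc_int.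
  by case: eqP => _ //; rewrite (v0 hv) ler01.
rewrite ltnS leqn0 => /eqP ->; rewrite coefB coefC coef_ps_trunc eqxx.
by rewrite (ltnW N2) subrr.
Qed.

Lemma eval_linear s x y : ps_le v 1 s -> s 0%N = 0 -> v x <= 1 ->
  ps_eval_to v s x y -> v (y - s 1%N * x) <= v x ^+ 2.
Proof.
move=> hs s0 hx h; have x20 : 0 <= v x ^+ 2 by rewrite exprn_ge0 ?(v_ge0 hv).
have := @eval_le s x y (s 1%N *: 'X) (v x ^+ 2) h x20.
rewrite hornerZ hornerX; apply => N N2.
have -> : s 1%N * x = (s 1%N *: 'X).[x] by rewrite hornerZ hornerX.
rewrite -hornerN -hornerD; apply: v_horner_ord => // k.
  rewrite coefB coefZ coefX; apply: (vB_le hv); first exact: trunc_int.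
  by rewrite (vM hv) mulr_ile1 ?(v_ge0 hv) ?(v_nat hv).
by case: k => [|[|//]] _; rewrite coefB coefZ coefX coef_ps_trunc ?N2 ?(ltnW N2) /=
  ?s0 ?mulr0 ?mulr1 subrr.
Qed.

Lemma eval_0 s : s 0%N = 0 -> ps_eval_to v s 0 0.
Proof.
move=> s0 e e0; exists 0%N => n _; rewrite big1 ?subrr ?(v0 hv) // => -[[|k] hk] _ /=.
  by rewrite s0 mul0r.
by rewrite exprS mul0r mulr0.
Qed.

Lemma eval_lt1 s x y : ps_le v 1 s -> s 0%N = 0 -> v x < 1 ->
  ps_eval_to v s x y -> v y < 1.
Proof.
move=> hs s0 hx h; have := eval_const hs (ltW hx) h; rewrite s0 subr0 => le.
exact: le_lt_trans hx.
Qed.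

Lemma ultrametric_cauchy (w : nat -> C) :
  (forall e : R, 0 < e -> exists N, forall n, (N <= n)%N -> v (w n.+1 - w n) < e) ->
  cauchy_abs v w.
Proof.
move=> h e e0; have [N HN] := h e e0; exists N => m n.
have up k l : (N <= k)%N -> v (w (k + l)%N - w k) < e.
  move=> Nk; elim: l => [|l IH]; first by rewrite addn0 subrr (v0 hv).
  rewrite addnS.
  have -> : w (k + l).+1 - w k = (w (k + l).+1 - w (k + l)%N) + (w (k + l)%N - w k) by ring.
  by apply: (vD_lt hv) => //; apply: HN; lia.
move=> Nm Nn; have [le|lt] := leqP n m.
  by have := up n (m - n)%N Nn; rewrite subnKC.
by rewrite (vB_sym hv); have := up m (n - m)%N Nm; rewrite subnKC // ltnW.
Qed.

Section Complete.
Hypothesis complete : forall w : nat -> C, cauchy_abs v w -> exists l, cvg_abs v w l.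

Lemma eval_exists s x : ps_le v 1 s -> v x < 1 -> exists y, ps_eval_to v s x y.
Proof.
move=> hs hx.
have [|l Hl] := complete (w := fun N => (ps_trunc N s).[x]); last first.
  by exists l; apply/eval_toE.
apply: ultrametric_cauchy => e e0; have [N HN] := pow_small hx e0.
exists N => n /HN; apply: le_lt_trans.
rewrite -hornerN -hornerD; apply: v_horner_ord => [k|k lt|]; last exact: ltW.
  by rewrite coefB; apply: (vB_le hv); apply: trunc_int.
by rewrite coefB !coef_ps_trunc lt ltnS (ltnW lt) subrr.
Qed.
End Complete.

(** The coefficients of the quotient satisfy a recurrence downwards from the top degree, which keeps
    them integral. *)
Lemma synthetic_division (q : {poly C}) a : v a <= 1 -> (forall k, v q`_k <= 1) ->
  exists q1 : {poly C}, [/\ q - q.[a]%:P = q1 * ('X - a%:P),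
    forall k, v q1`_k <= 1 & forall k, q1`_k = q`_k.+1 + a * q1`_k.+1].
Proof.
move=> ha hq.
have /factor_theorem[q1 e] : root (q - q.[a]%:P) a.
  by rewrite rootE !hornerE subrr.
have rec k : q1`_k = q`_k.+1 + a * q1`_k.+1.
  have := congr1 (fun r : {poly C} => r`_k.+1) e.
  rewrite coefB coefC /= subr0 mulrBr coefB coefMX /= coefMC => ->.
  by ring.
exists q1; split=> //.
have hi m k : (size q1 <= k + m)%N -> v q1`_k <= 1.
  elim: m k => [|m IH] k.
    by rewrite addn0 => h; rewrite nth_default // (v0 hv) ler01.
  rewrite addnS -addSn => /IH h; rewrite rec; apply: (vD_le hv) => //.
  by rewrite (vM hv) mulr_ile1 ?(v_ge0 hv).
by move=> k; apply: (hi (size q1)); rewrite leq_addl.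
Qed.

Lemma min_distance a (ys : seq C) : a \notin ys ->
  exists2 m : R, 0 < m & forall y, y \in ys -> m <= v (y - a).
Proof.
elim: ys => [|b ys IH]; first by exists 1; rewrite ?ltr01.
rewrite inE negb_or => /andP[ab /IH[m m0 Hm]].
have vb : 0 < v (b - a) by rewrite (v_gt0 hv) subr_eq0 eq_sym.
exists (Num.min m (v (b - a))); first by rewrite lt_min m0.
move=> y; rewrite inE => /orP[/eqP ->|/Hm h]; first by rewrite ge_min lexx orbT.
by rewrite ge_min h.
Qed.

(* Divided differences: the separation of the points bounds from below the
   values that an integral polynomial with a unit coefficient of index [d] can
   take at [d + 1] of them. *)
Lemma separated_values d (ys : seq C) : size ys = d.+1 -> uniq ys ->
  (forall y, y \in ys -> v y < 1) ->
  exists2 c : R, 0 < c & forall (q : {poly C}) (tau : R),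
    (forall k, v q`_k <= 1) -> v q`_d = 1 ->
    (forall y, y \in ys -> v q.[y] <= tau) -> c <= tau.
Proof.
elim: d ys => [|d IH] [|a ys] //=.
  move=> [] /size0nil -> _ hy; exists 1 => // q tau hq q0 Hq.
  have ha : v a < 1 by apply: hy; rewrite inE.
  have [q1 [e hq1 _]] := synthetic_division (ltW ha) hq.
  have : v q.[a] = 1.
    have := congr1 (horner^~ 0) e; rewrite !hornerE horner_coef0 => e0.
    have -> : q.[a] = q`_0 + q1.[0] * a.
      by rewrite -[LHS](subKr q`_0) e0; ring.
    rewrite (vD_eq hv) q0 // (vM hv); apply: le_lt_trans ha.
    rewrite ler_piMl ?(v_ge0 hv) //; apply: v_horner_int => //.
    by rewrite (v0 hv) ler01.
  by move=> <-; apply: Hq; rewrite inE.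
move=> [] hsz /andP[na un] hy.
have [c c0 Hc] := IH ys hsz un (fun y hy' => hy y (@mem_behead _ (a :: ys) y hy')).
have [m m0 Hm] := min_distance na.
exists (c * m); first exact: mulr_gt0.
move=> q tau hq qd Hq.
have ha : v a < 1 by apply: hy; rewrite inE eqxx.
have [q1 [e hq1 rec]] := synthetic_division (ltW ha) hq.
rewrite -ler_pdivlMr //; apply: (Hc q1) => //.
  rewrite rec (vD_eq hv) qd // (vM hv); apply: le_lt_trans ha.
  by rewrite ler_piMr ?(v_ge0 hv).
move=> y yin; rewrite ler_pdivlMr //.
have := congr1 (horner^~ y) e; rewrite !hornerE => ey.
apply: le_trans (_ : v (q1.[y] * (y - a)) <= _).
  by rewrite (vM hv) ler_wpM2l ?(v_ge0 hv) // Hm.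
rewrite -ey; apply: (vB_le hv); apply: Hq; rewrite inE ?eqxx //.
by rewrite yin orbT.
Qed.

(** At most [d] zeros in the open disk, without Weierstrass preparation: at [d + 1] distinct zeros
    the values of the truncations would tend to 0, against [separated_values]. *)
Lemma zeros_not_uniq d s (ys : seq C) : ps_le v 1 s -> v (s d) = 1 ->
  size ys = d.+1 -> (forall y, y \in ys -> v y < 1 /\ ps_eval_to v s y 0) ->
  ~~ uniq ys.
Proof.
move=> hs sd hsz hy; apply/negP => un.
have [c c0 Hc] := separated_values hsz un (fun y h => proj1 (hy y h)).
have [N HN] : exists N, forall n, (N <= n)%N ->
    forall y, y \in ys -> v (ps_trunc n s).[y] < c.
  elim: ys hy {hsz un Hc} => [|a ys IH] hy; first by exists 0%N.
  have [|N HN] := IH; first by move=> y h; apply: hy; rewrite inE h orbT.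
  have [_ /eval_toE h] := hy a (mem_head _ _).
  have [N' HN'] := h c c0; exists (maxn N N') => n; rewrite geq_max => /andP[l1 l2] y.
  rewrite inE => /orP[/eqP ->|/(HN n l1) //].
  by have := HN' n l2; rewrite subr0.
pose n := maxn N d.+1.
have nN : (N <= n)%N by apply: leq_maxl.
have dn : (d < n)%N by apply: leq_maxr.
pose tau := \big[Num.max/0]_(y <- ys) v (ps_trunc n s).[y].
have Ht y : y \in ys -> v (ps_trunc n s).[y] <= tau.
  rewrite /tau; elim: (ys) => // a l IH; rewrite inE big_cons le_max.
  by case/orP=> [/eqP ->|/IH ->]; rewrite ?lexx ?orbT.
have lt : tau < c.
  rewrite /tau; elim: (ys) (HN n nN) => [|a l IH] Hl; first by rewrite big_nil.
  rewrite big_cons gt_max Hl ?mem_head //=; apply: IH => y h.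
  by apply: Hl; rewrite inE h orbT.
have := Hc (ps_trunc n s) tau (trunc_int n hs) _ Ht.
by rewrite coef_ps_trunc dn sd leNgt lt => /(_ erefl).
Qed.

End Evaluation.

(** * Absence of zeros of [f'] in the open disk *)

Section NoCriticalPoint.
Variables (R : realType) (C : fieldType) (v : C -> R).
Hypothesis hv : nonarch_abs v.
Hypothesis complete : forall w : nat -> C, cauchy_abs v w -> exists l, cvg_abs v w l.
Variables f u : pseries C.
Hypotheses (f0 : f 0%N = 0) (u0 : u 0%N = 0) (hf : ps_le v 1 f) (hu : ps_le v 1 u).
Hypotheses (comm : ps_comp f u = ps_comp u f) (f1 : v (f 1%N) < 1).
Hypotheses (u1 : v (u 1%N) = 1) (nt : forall n, (0 < n)%N -> u 1%N ^+ n <> 1).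
Hypothesis simple : forall n, (0 < n)%N -> simple_roots_in_disk v (ps_iter n f).

Lemma iter_int n s : s 0%N = 0 -> ps_le v 1 s -> ps_le v 1 (ps_iter n s).
Proof.
move=> s0 hs; elim: n => [|n IH]; first by move=> k; exact: (v_nat hv).
by rewrite ps_iterS; apply: (ps_le_comp hv); rewrite ?ps_iter0.
Qed.

Lemma eval_iter s (x : nat -> C) n : s 0%N = 0 -> ps_le v 1 s ->
  (forall k, v (x k) < 1) -> (forall k, ps_eval_to v s (x k) (x k.+1)) ->
  forall k, ps_eval_to v (ps_iter n s) (x k) (x (k + n)%N).
Proof.
move=> s0 hs hx hk k; elim: n => [|n IH].
  rewrite addn0 => e e0; exists 2%N => -[|[|n]] // _.
  rewrite !big_ord_recl /ps_iter /= /ps_X /= mul0r add0r mul1r expr1 big1.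
    by rewrite addr0 subrr (v0 hv).
  by move=> i _; rewrite mul0r.
rewrite ps_iterS addnS.
apply: (eval_comp hv hs (iter_int n s0 hs) (ps_iter0 n s0) (hx k) _ IH) => //.
Qed.

Lemma no_critical_point (h : pseries C) c d x : ps_le v 1 h -> v (h d) = 1 ->
  c != 0 -> ps_deriv f = ps_const c * h -> v x < 1 -> ~ ps_eval_to v h x 0.
Proof.
move=> hh hd c0 f'E hx hx0.
have hf' : ps_le v 1 (ps_deriv f) by apply: (ps_le_deriv hv).
have hu' : ps_le v 1 (ps_deriv u) by apply: (ps_le_deriv hv).
have crit z : ps_eval_to v h z 0 -> ps_eval_to v (ps_deriv f) z 0.
  by rewrite f'E => /(eval_scale hv c); rewrite mulr0.
(* [U] and [Fv] are the functions defined by [u] and [f] on the open disk, with a default value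
   outside. *)
have /choice[U HU] : forall z, exists y, v z < 1 -> ps_eval_to v u z y.
  move=> z; have [lt|ge] := ltP (v z) 1; last by exists 0.
  by have [y Hy] := eval_exists hv complete hu lt; exists y.
have /choice[Fv HF] : forall z, exists y, v z < 1 -> ps_eval_to v f z y.
  move=> z; have [lt|ge] := ltP (v z) 1; last by exists 0.
  by have [y Hy] := eval_exists hv complete hf lt; exists y.
have crit_u z : v z < 1 -> ps_eval_to v h z 0 -> ps_eval_to v h (U z) 0.
  move=> hz h0; have hUz := HU z hz.
  have Uz1 := eval_lt1 hv hu u0 hz hUz.
  have [y Hy] := eval_exists hv complete hh Uz1.
  suff y0 : y = 0 by rewrite -y0.
  (* At a zero [z] of [f'], the chain rule gives [f'(u(z)) u'(z) = u'(f(z)) f'(z) = 0]; and [u'] has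
     no zero in the disk, its constant term being a unit. *)
  have e1 := congr1 (@ps_deriv C) comm; rewrite !ps_deriv_comp // in e1.
  have [w Hw] := eval_exists hv complete hu' hz.
  have e2 : ps_eval_to v (ps_comp (ps_deriv f) u * ps_deriv u) z (c * y * w).
    apply: (eval_mul hv) => //; first exact: (ps_le_comp hv).
    apply: (eval_comp hv) hUz _ => //.
    by rewrite f'E; apply: (eval_scale hv).
  have Fz1 := eval_lt1 hv hf f0 hz (HF z hz).
  have [w' Hw'] := eval_exists hv complete hu' Fz1.
  have e3 : ps_eval_to v (ps_comp (ps_deriv u) f * ps_deriv f) z (w' * 0).
    apply: (eval_mul hv) => //; first exact: (ps_le_comp hv).
      by apply: (eval_comp hv) (HF z hz) _.
    exact: crit.
  rewrite -e1 mulr0 in e3; have /eqP := cvg_unique hv e2 e3.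
  rewrite !mulf_eq0 (negbTE c0) /= => /orP[/eqP //|/eqP w0].
  have := eval_const hv hu' (ltW hz) Hw; rewrite w0 sub0r (vN hv) /ps_deriv mulr1n u1.
  by rewrite leNgt hz.
pose X k := iter k U x.
have hX k : v (X k) < 1 /\ ps_eval_to v h (X k) 0.
  elim: k => [//|k [h1 h2]]; split; last exact: crit_u.
  exact: (eval_lt1 hv hu u0 h1 (HU _ h1)).
have XU k : ps_eval_to v u (X k) (X k.+1) by apply: HU; case: (hX k).
have [i [j [lij eij]]] : exists i j, (i < j)%N /\ X i = X j.
  have := @zeros_not_uniq _ _ _ hv d h (map X (iota 0 d.+1)) hh hd.
  rewrite size_map size_iota => /(_ erefl) H.
  have {}H : ~~ uniq [seq X k | k <- iota 0 d.+1].
    by apply: H => y /mapP[k _ ->].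
  apply/not_existsP => Hn; case/negP: H.
  rewrite map_inj_in_uniq ?iota_uniq // => a b _ _ eab.
  apply/eqP; rewrite eqn_leq; apply/andP; split; rewrite leqNgt; apply/negP => lt.
    by apply: (Hn b); exists a.
  by apply: (Hn a); exists b.
pose n := (j - i)%N; pose y := X i.
have n0 : (0 < n)%N by rewrite subn_gt0.
pose w := ps_iter n u.
have w0 : w 0%N = 0 by rewrite /w ps_iter0.
have hw : ps_le v 1 w by apply: iter_int.
have wf : ps_comp f w = ps_comp w f by apply: ps_iter_comm.
have w1 : w 1%N = u 1%N ^+ n by rewrite /w ps_iter1.
have wy : ps_eval_to v w y y.
  have := eval_iter n u0 hu (fun k => proj1 (hX k)) XU i.
  by rewrite /n subnKC ?(ltnW lij) // -eij.
have [hy hy0] := hX i; rewrite -/y in hy hy0.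
(* The orbit of [y] under [f] consists of fixed points of [w], because [f] and [w] commute. *)
pose Y k := iter k Fv y.
have hY k : v (Y k) < 1 /\ ps_eval_to v w (Y k) (Y k).
  elim: k => [//|k [h1 h2]].
  have h3 := HF _ h1; have h4 := eval_lt1 hv hf f0 h1 h3; split=> //.
  have [z Hz] := eval_exists hv complete hw h4.
  have e1 : ps_eval_to v (ps_comp w f) (Y k) z by apply: (eval_comp hv) h3 Hz.
  have e2 : ps_eval_to v (ps_comp f w) (Y k) (Fv (Y k)) by apply: (eval_comp hv) h2 h3.
  by rewrite wf in e2; rewrite (cvg_unique hv e1 e2) in Hz.
have YF k : ps_eval_to v f (Y k) (Y k.+1) by apply: HF; case: (hY k).
(* On the disk of radius [|y|], [f] contracts by the factor [rho]: the linear term by [|f'(0)|], the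
   rest by [|y|]. *)
pose rho := Num.max (v (f 1%N)) (v y).
have rho1 : rho < 1 by rewrite gt_max f1 hy.
have rho0 : 0 <= rho by rewrite le_max (v_ge0 hv).
have Ysmall k : v (Y k) <= rho ^+ k /\ v (Y k) <= v y.
  elim: k => [|k [h1 h2]]; first by rewrite expr0 ltW.
  have [hk _] := hY k.
  have le : v (Y k.+1) <= rho * v (Y k).
    rewrite -(subrK (f 1%N * Y k) (Y k.+1)); apply: (vD_le hv).
      apply: le_trans (eval_linear hv hf f0 (ltW hk) (YF k)) _.
      by rewrite expr2 ler_wpM2r ?(v_ge0 hv) // le_max h2 orbT.
    by rewrite (vM hv) ler_wpM2r ?(v_ge0 hv) // le_max lexx.
  split; first by apply: le_trans le _; rewrite exprS ler_wpM2l.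
  by apply: le_trans le _; apply: le_trans h2; rewrite ler_piMl ?(v_ge0 hv) // ltW.
have wn1 : w 1%N - 1 != 0 by rewrite subr_eq0 w1; apply/eqP/nt.
have b0 : 0 < v (w 1%N - 1) by rewrite (v_gt0 hv).
have [k Hk] := exp_small rho0 rho1 b0.
(* A nonzero fixed point [z] of [w] satisfies [|w'(0) - 1| <= |z|], and the orbit eventually gets
   below this bound. *)
have Yk0 : Y k = 0.
  apply/eqP/negPn/negP => ne; have [h1 h2] := hY k.
  have := eval_linear hv hw w0 (ltW h1) h2.
  have -> : Y k - w 1%N * Y k = - ((w 1%N - 1) * Y k) by ring.
  rewrite (vN hv) (vM hv) expr2 ler_pM2r ?(v_gt0 hv) // leNgt.
  by rewrite (le_lt_trans (proj1 (Ysmall k)) Hk).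
have fk : ps_eval_to v (ps_iter k f) y 0.
  have := eval_iter k f0 hf (fun k => proj1 (hY k)) YF 0%N.
  by rewrite add0n Yk0.
(* One more iterate makes the order positive even if [k = 0], and puts [f'(y) = 0] as a factor of
   its derivative at [y]. *)
have fkS : ps_eval_to v (ps_iter k.+1 f) y 0.
  rewrite ps_iterS; apply: (eval_comp hv) fk _ => //.
  - exact: iter_int.
  - by rewrite ps_iter0.
  - by rewrite (v0 hv) ltr01.
  - exact: eval_0.
apply: (simple (ltn0Sn k) hy fkS).
have Fy1 := eval_lt1 hv hf f0 hy (HF y hy).
have hik : ps_le v 1 (ps_deriv (ps_iter k f)) by apply/(ps_le_deriv hv)/iter_int.
have [z Hz] := eval_exists hv complete hik Fy1.
rewrite ps_iterSr // ps_deriv_comp // -[X in ps_eval_to _ _ _ X](mulr0 z).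
apply: (eval_mul hv) => //; first exact: (ps_le_comp hv).
  by apply: (eval_comp hv) (HF y hy) Hz.
exact: crit.
Qed.
End NoCriticalPoint.

(** * Roots of polynomials near a point, and zeros of series as limits of roots of truncations *)

Section RootExistence.
Variables (R : realType) (A : fieldType) (v : A -> R).
Hypothesis hv : nonarch_abs v.
Hypothesis closed : GRing.closed_field_axiom A.

Lemma closed_root (q : {poly A}) : (1 < size q)%N -> exists x, root q x.
Proof.
move=> sq; pose n := (size q).-1; have n0 : (0 < n)%N by rewrite /n; lia.
have lc : lead_coef q != 0 by rewrite lead_coef_eq0 -size_poly_gt0; lia.
have [x Hx] := closed (fun i => - q`_i / lead_coef q) n0.
exists x; rewrite rootE horner_coef -(prednK (ltnW sq)) big_ord_recr /= -/n.
rewrite -/(lead_coef q) Hx mulr_sumr -big_split /= big1 // => i _.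
by rewrite mulrA [lead_coef q * _]mulrC divfK // mulNr subrr.
Qed.

(* A root of absolute value at least 1 is divided out in the form [1 - X / x],
   a unit on the open disk; the others lower [d]. *)
Lemma near_root d (q : {poly A}) y : (forall k, v q`_k <= 1) -> v q`_d.+1 = 1 ->
  (forall k, (k <= d)%N -> v q`_k < 1) -> v y < 1 ->
  exists2 x, root q x & v x < 1 /\ v (y - x) ^+ d.+1 <= v q.[y].
Proof.
have [n] := ubnP (size q); elim: n d q => // n IH d q sq hq qd ql hy.
have dsz : (d.+1 < size q)%N.
  by rewrite ltnNge; apply/negP => h; move: qd; rewrite nth_default // (v0 hv) => /eqP;
    rewrite eq_sym oner_eq0.
have [x rx] := closed_root (leq_ltn_trans (ltn0Sn d) dsz).
have qx0 : q.[x] = 0 by apply/eqP; move: rx; rewrite rootE.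
have [hx|hx] := ltP (v x) 1.
  have [q1 [e hq1 rec]] := synthetic_division hv (ltW hx) hq.
  rewrite qx0 polyC0 subr0 in e.
  have q1d : v q1`_d = 1.
    rewrite rec (vD_eq hv) qd // (vM hv); apply: le_lt_trans hx.
    by rewrite ler_piMr ?(v_ge0 hv).
  have qy : v q.[y] = v q1.[y] * v (y - x) by rewrite e !hornerE (vM hv).
  case: d ql qd dsz q1d => [|d] ql qd dsz q1d.
    exists x => //; split=> //; rewrite expr1 qy.
    have -> : v q1.[y] = 1; last by rewrite mul1r.
    have [q2 [e2 hq2 _]] := synthetic_division hv (ltW hy) hq1.
    have := congr1 (horner^~ 0) e2; rewrite !hornerE horner_coef0 => e0.
    have -> : q1.[y] = q1`_0 + q2.[0] * y.
      by rewrite -[LHS](subKr q1`_0) e0; ring.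
    rewrite (vD_eq hv) q1d // (vM hv); apply: le_lt_trans hy.
    rewrite ler_piMl ?(v_ge0 hv) //; apply: (v_horner_int hv) => //.
    by rewrite (v0 hv) ler01.
  have q1n : q1 != 0 by apply/eqP => q10; move: q1d; rewrite q10 coef0 (v0 hv) => /eqP;
    rewrite eq_sym oner_eq0.
  have sq1 : (size q1 < n)%N.
    by move: sq; rewrite e size_mul ?polyXsubC_eq0 // size_XsubC addn2 /= ltnS.
  have q1l k : (k <= d)%N -> v q1`_k < 1.
    move=> kd; rewrite rec; apply: (vD_lt hv); first by apply: ql.
    by rewrite (vM hv); apply: le_lt_trans hx; rewrite ler_piMr ?(v_ge0 hv).
  have [x' rx' [hx' Hx']] := IH d q1 sq1 hq1 q1d q1l hy.
  (* Of the two roots the one nearer to [y] is kept, since [|q(y)|] is at least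
     [|y - x'|^(d+1) * |y - x|]. *)
  have [le|lt] := leP (v (y - x)) (v (y - x')).
    exists x => //; split=> //; rewrite qy exprSr ler_wpM2r ?(v_ge0 hv) //.
    by apply: le_trans Hx'; rewrite lerXn2r // nnegrE (v_ge0 hv).
  exists x'; first by rewrite e rootM rx'.
  split=> //; rewrite qy exprSr; apply: ler_pM => //; rewrite ?exprn_ge0 ?(v_ge0 hv) //.
  exact: ltW.
have xn : x != 0 by rewrite -(v_gt0 hv); apply: lt_le_trans hx; rewrite ltr01.
have [q1 e] := factor_theorem _ _ rx; pose q2 := - x *: q1.
have q20 : q2`_0 = q`_0.
  by rewrite e mulrBr coefB coefMX /= coefMC sub0r coefZ mulNr mulrC.
have q2S k : q2`_k.+1 = q`_k.+1 + x^-1 * q2`_k.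
  by rewrite e mulrBr coefB coefMX /= coefMC !coefZ; field.
have xi : v x^-1 <= 1 by rewrite (vV hv) invf_le1 // (v_gt0 hv).
have hq2 : forall j, v q2`_j <= 1.
  elim=> [|j IHj]; first by rewrite q20.
  by rewrite q2S; apply: (vD_le hv) => //; rewrite (vM hv) mulr_ile1 ?(v_ge0 hv).
have q2l : forall j, (j <= d)%N -> v q2`_j < 1.
  elim=> [|j IHj] jd; first by rewrite q20; apply: ql.
  rewrite q2S; apply: (vD_lt hv); first exact: ql.
  rewrite (vM hv); apply: le_lt_trans (IHj (ltnW jd)).
  by rewrite ler_piMl ?(v_ge0 hv).
have q2d : v q2`_d.+1 = 1.
  rewrite q2S (vD_eq hv) qd // (vM hv); apply: le_lt_trans (q2l d (leqnn d)).
  by rewrite ler_piMl ?(v_ge0 hv).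
have q1n : q1 != 0.
  apply/eqP => q10; move: q2d; rewrite /q2 q10 scaler0 coef0 (v0 hv) => /eqP.
  by rewrite eq_sym oner_eq0.
have sq2 : (size q2 < n)%N.
  rewrite /q2 size_scale ?oppr_eq0 //.
  by move: sq; rewrite e size_mul ?polyXsubC_eq0 // size_XsubC addn2 /= ltnS.
have [x' rx' Hx'] := IH d q2 sq2 hq2 q2d q2l hy.
exists x'.
  by rewrite e rootM; move: rx'; rewrite /q2 rootZ ?oppr_eq0 // => ->.
suff -> : v q.[y] = v q2.[y] by [].
rewrite e /q2 !hornerE !(vM hv) (vN hv) mulrC; congr (_ * _).
by rewrite -(vN hv) opprB (vD_eq hv) // (vN hv); apply: lt_le_trans hx.
Qed.

(** Otherwise the term of index [d + 1] strictly dominates all others. The bound keeps the roots of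
    all truncations in one smaller disk. *)
Lemma root_bound d (q : {poly A}) (theta : R) x : (forall k, v q`_k <= 1) ->
  v q`_d.+1 = 1 -> (forall k, (k <= d)%N -> v q`_k <= theta) -> v x < 1 ->
  root q x -> v x ^+ d.+1 <= theta.
Proof.
move=> hq qd ql hx; rewrite rootE => /eqP q0.
rewrite leNgt; apply/negP => lt.
have x0 := v_ge0 hv x.
have th0 : 0 <= theta by apply: le_trans (ql 0%N _); rewrite ?(v_ge0 hv).
have xp : 0 < v x.
  rewrite lt_neqAle x0 andbT; apply/eqP => e; move: lt; rewrite -e expr0n /= ltNge.
  by rewrite th0.
have dsz : (d.+1 < size q)%N.
  by rewrite ltnNge; apply/negP => h; move: qd; rewrite nth_default // (v0 hv) => /eqP;
    rewrite eq_sym oner_eq0.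
move: q0; rewrite horner_coef (bigD1 (Ordinal dsz)) //=; set S := \sum_(_ < _ | _) _.
have hS : v S < v x ^+ d.+1.
  rewrite /S; apply: (big_ind (fun z => v z < v x ^+ d.+1)).
  - by rewrite (v0 hv) exprn_gt0.
  - by move=> a b; apply: (vD_lt hv).
  move=> k ne; rewrite (vM hv) (vX hv).
  have [le|gt] := leqP k d.
    apply: le_lt_trans lt; rewrite -[theta]mulr1.
    by rewrite ler_pM ?(v_ge0 hv) ?exprn_ge0 ?exprn_ile1 ?ql // ltW.
  have gt' : (d.+1 < k)%N.
    rewrite ltn_neqAle gt andbT; apply/eqP => ek; case/eqP: ne.
    exact: val_inj.
  apply: le_lt_trans (_ : v x ^+ k < _); last by rewrite ltr_iXn2l.
  by rewrite -[X in _ <= X]mul1r ler_pM ?(v_ge0 hv) ?exprn_ge0.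
have vt : v (q`_d.+1 * x ^+ d.+1) = v x ^+ d.+1 by rewrite (vM hv) qd mul1r (vX hv).
move=> /(congr1 v); rewrite (vD_eq hv) ?vt // (v0 hv) => /eqP.
by rewrite expf_eq0 /= (gt_eqF xp).
Qed.

End RootExistence.

Section RootInCompletion.
Variables (R : realType) (A C : fieldType) (v : A -> R) (v' : C -> R).
Variable i : {rmorphism A -> C}.
Hypotheses (hv : nonarch_abs v) (closed : GRing.closed_field_axiom A).
Hypothesis hC : completion v v' i.
Let hv' := completion_abs hC.

(** A root of each truncation is chosen close to the previous one: consecutive truncations differ
    little at [x n], so [near_root] gives a Cauchy sequence. The roots lie in the algebraically
    closed [A], their limit in the completion [C]. *)
Lemma zero_exists (h : pseries A) d (theta : R) : ps_le v 1 h -> v (h d.+1) = 1 ->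
  theta < 1 -> (forall k, (k <= d)%N -> v (h k) <= theta) ->
  exists x, v' x < 1 /\ ps_eval_to v' (fun k => i (h k)) x 0.
Proof.
move=> hh hd th1 hl.
have th0 : 0 <= theta by apply: le_trans (hl 0%N _); rewrite ?(v_ge0 hv).
pose q n := ps_trunc (n + d.+2) h.
have hq n k : v (q n)`_k <= 1 by apply: trunc_int.
have qE n k : (k < d.+2)%N -> (q n)`_k = h k.
  by move=> lt; rewrite coef_ps_trunc (leq_trans lt) ?leq_addl.
have qd n : v (q n)`_d.+1 = 1 by rewrite qE.
have ql n k : (k <= d)%N -> v (q n)`_k <= theta by move=> kd; rewrite qE ?hl // ltnS ltnW.
have qlt n k : (k <= d)%N -> v (q n)`_k < 1 by move=> kd; apply: le_lt_trans th1; apply: ql.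
have /choice[nxt Hnxt] : forall ny : nat * A, exists x, v ny.2 < 1 ->
    root (q ny.1) x /\ v x < 1 /\ v (ny.2 - x) ^+ d.+1 <= v (q ny.1).[ny.2].
  move=> [n y]; have [lt|ge] := ltP (v y) 1; last by exists 0.
  have [x h1 h2] := near_root hv closed (hq n) (qd n) (@qlt n) lt.
  by exists x.
pose fix x n := if n is m.+1 then nxt (m.+1, x m) else nxt (0%N, 0).
have v01 : v 0 < 1 by rewrite (v0 hv) ltr01.
have hx n : root (q n) (x n) /\ v (x n) < 1.
  elim: n => [|n [_ IH]]; first by have [? []] := Hnxt (0%N, 0) v01.
  by have [? []] := Hnxt (n.+1, x n) IH.
have xth n : v (x n) ^+ d.+1 <= theta.
  by have [h1 h2] := hx n; apply: (root_bound hv (hq n) (qd n) (@ql n) h2 h1).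
(* One factor [d.+1] comes from [near_root], the other from the bound of [x n ^+ d.+1] by [theta];
   keeping the powers avoids real roots. *)
have step n : v (x n.+1 - x n) ^+ (d.+1 * d.+1) <= theta ^+ n.
  have [h1 h2] := hx n.
  have H : v (x n - x n.+1) ^+ d.+1 <= v (q n.+1).[x n].
    by have [_ [_ H]] := Hnxt (n.+1, x n) h2.
  rewrite exprM (vB_sym hv).
  have {}H : v (x n - x n.+1) ^+ d.+1 <= v (x n) ^+ n.
    apply: le_trans H _.
    have -> : (q n.+1).[x n] = (q n.+1 - q n).[x n].
      by rewrite hornerD hornerN; move: h1; rewrite rootE => /eqP ->; rewrite subr0.
    apply: (v_horner_ord hv) => [k|k kn|]; last exact: ltW.
      by rewrite coefB; apply: (vB_le hv).
    by rewrite coefB !coef_ps_trunc !(leq_trans kn) ?subrr // ?leq_addr // addSn leqW ?leq_addr.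
  apply: le_trans (_ : (v (x n) ^+ n) ^+ d.+1 <= _).
    by rewrite lerXn2r // nnegrE ?exprn_ge0 ?(v_ge0 hv).
  by rewrite -exprM mulnC exprM lerXn2r // nnegrE ?exprn_ge0 ?(v_ge0 hv).
pose w n := i (x n).
have iso a : v' (i a) = v a by apply: (completion_isometry hC).
have cw : cauchy_abs v' w.
  apply: (ultrametric_cauchy hv') => e e0.
  have [N HN] := exp_small th0 th1 (exprn_gt0 (d.+1 * d.+1) e0).
  exists N => n Nn; rewrite /w -rmorphB iso ltNge; apply/negP => le.
  have : e ^+ (d.+1 * d.+1) <= theta ^+ N.
    apply: le_trans (_ : theta ^+ n <= _); last by rewrite ler_wiXn2l // ltW.
    apply: le_trans (step n).
    by rewrite lerXn2r // nnegrE ?(v_ge0 hv) // ltW.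
  by rewrite leNgt HN.
have [l Hl] := completion_complete hC cw.
have vl : v' l < 1.
  have [N HN] := Hl 1 ltr01.
  have -> : l = w N - (w N - l) by ring.
  apply: (vB_lt hv'); last exact: HN.
  by rewrite /w iso; case: (hx N).
exists l; split=> //; apply/(eval_toE v') => e e0.
have [N HN] := Hl e e0; exists (N + d.+2)%N => n Nn.
rewrite subr0.
have [m em Nm] : exists2 m, n = (m + d.+2)%N & (N <= m)%N by exists (n - d.+2)%N; lia.
set P := ps_trunc n _.
have PE : P = map_poly i (q m).
  by apply/polyP => k; rewrite coef_map /= /q -em !coef_ps_trunc; case: ifP; rewrite ?rmorph0.
have P0 : P.[w m] = 0.
  by rewrite PE horner_map; have [] := hx m; rewrite rootE => /eqP ->; rewrite rmorph0.
rewrite -[P.[l]]subr0 -P0; apply: le_lt_trans (HN m Nm); rewrite (vB_sym hv' (w m)).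
apply: (v_horner_lip hv') => [k||]; last 1 first.
- by rewrite /w iso ltW //; case: (hx m).
- by rewrite PE coef_map iso.
- exact: ltW.
Qed.
End RootInCompletion.

(** * The p-adic numbers and their finite extensions *)

Section PadicField.
Variables (R : realType) (p : nat).
Hypothesis hp : prime p.
Variables (Qp : fieldType) (vQp : Qp -> R) (iQ : {rmorphism rat -> Qp}).
Hypothesis hQp : completion (padic_abs R p) vQp iQ.
Let hq := completion_abs hQp.
Let r : R := p%:R^-1.

Lemma pR_gt0 : 0 < p%:R :> R. Proof. by rewrite ltr0n prime_gt0. Qed.
Lemma pR_gt1 : 1 < p%:R :> R. Proof. by rewrite ltr1n prime_gt1. Qed.
Lemma pinv_gt0 : 0 < r. Proof. by rewrite invr_gt0 pR_gt0. Qed.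
Lemma pinv_lt1 : r < 1. Proof. by rewrite invf_lt1 ?pR_gt1 ?pR_gt0. Qed.

(** The value group of [Q_p], the integral powers of [p]. *)
Definition pvalue (y : R) := exists a b : nat, y = p%:R ^+ a / p%:R ^+ b.

Lemma padic_abs_pvalue x : x != 0 -> pvalue (padic_abs R p x).
Proof. by move=> x0; rewrite /padic_abs (negbTE x0); do 2 eexists. Qed.

Lemma padic_abs_int (m : int) : m != 0 -> padic_abs R p m%:~R = r ^+ logn p `|m|.
Proof.
move=> m0; rewrite /padic_abs intr_eq0 (negbTE m0) numq_int denq_int.
by rewrite logn1 expr0 div1r exprVn.
Qed.

Lemma vQp_rat x : vQp (iQ x) = padic_abs R p x.
Proof. exact: (completion_isometry hQp). Qed.

Lemma vQp_int (m : int) : m != 0 -> vQp m%:~R = r ^+ logn p `|m|.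
Proof. by move=> m0; rewrite -(rmorph_int iQ) vQp_rat padic_abs_int. Qed.

Lemma vQp_nat n : (0 < n)%N -> vQp n%:R = r ^+ logn p n.
Proof.
by move=> n0; have := @vQp_int n; rewrite absz_nat pmulrn; apply; case: n n0.
Qed.

Lemma vQp_p : vQp p%:R = r.
Proof.
by rewrite vQp_nat ?prime_gt0 // -{2}[p]expn1 pfactorK.
Qed.

Lemma vQp_coprime n : ~~ (p %| n)%N -> vQp n%:R = 1.
Proof.
move=> nd; have n0 : (0 < n)%N by case: n nd => //; rewrite dvdn0.
by rewrite vQp_nat // lognE hp n0 (negbTE nd).
Qed.

Lemma approx_rat a : a != 0 -> forall e : R, 0 < e -> exists x,
  [/\ x != 0, vQp (a - iQ x) < e & padic_abs R p x = vQp a].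
Proof.
move=> a0 e e0; have va : 0 < vQp a by rewrite (v_gt0 hq).
have m0 : 0 < Num.min e (vQp a) by rewrite lt_min e0.
have [x] := completion_dense hQp a m0; rewrite lt_min => /andP[h1 h2].
have vx : padic_abs R p x = vQp a.
  rewrite -vQp_rat; have -> : iQ x = a + (iQ x - a) by ring.
  by rewrite (vD_eq hq) // (vB_sym hq).
exists x; split=> //; apply/eqP => x0; move: va.
by rewrite -vx x0 /padic_abs eqxx ltxx.
Qed.

Lemma vQp_pvalue a : a != 0 -> pvalue (vQp a).
Proof.
move=> a0; have [x [x0 _ <-]] := approx_rat a0 ltr01.
exact: padic_abs_pvalue.
Qed.

Lemma pvalue_le1 y : pvalue y -> y <= 1 -> exists m, y = r ^+ m.
Proof.
case=> [a [b ->]]; rewrite ler_pdivrMr ?exprn_gt0 ?pR_gt0 // mul1r.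
rewrite ler_eXn2l ?pR_gt1 // => ab; exists (b - a)%N.
rewrite /r exprVn -{1}(subnK ab) exprD invfM mulrCA divff ?mulr1 //.
by rewrite expf_neq0 // gt_eqF ?pR_gt0.
Qed.

Lemma vQp_le1 a : a != 0 -> vQp a <= 1 -> exists m, vQp a = r ^+ m.
Proof. by move=> a0; apply: pvalue_le1; apply: vQp_pvalue. Qed.

(** A close enough rational has the same absolute value, hence a denominator prime to [p]. Replacing
    the inverse of the denominator by a Bezout coefficient modulo [p] gives an integer, then its
    remainder. *)
Lemma vQp_residue a : vQp a <= 1 -> exists n : nat, vQp (a - n%:R) <= r.
Proof.
move=> va; have [->|a0] := eqVneq a 0.
  by exists 0%N; rewrite subrr (v0 hq) ?(ltW pinv_gt0).
have [x [x0 hx vx]] := approx_rat a0 pinv_gt0.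
have dn : ~~ (p %| `|denq x|)%N.
  apply/negP => pd.
  have pn : ~~ (p %| `|numq x|)%N.
    apply/negP => pn; have := coprime_num_den x; rewrite /coprime => /eqP g.
    have : (p %| gcdn `|numq x| `|denq x|)%N by rewrite dvdn_gcd pn.
    by rewrite g dvdn1; move: (prime_gt1 hp); case: (p) => [|[]].
  have l0 : logn p `|numq x| = 0%N.
    by apply/eqP; rewrite -leqn0 leqNgt logn_gt0 mem_primes hp (negbTE pn) !andbF.
  have l1 : (0 < logn p `|denq x|)%N.
    by rewrite logn_gt0 mem_primes hp pd absz_gt0 denq_neq0.
  move: va; rewrite -vx /padic_abs (negbTE x0) l0 expr0 divr1 leNgt.
  have gt1 : 1 < (p%:R : R) ^+ logn p `|denq x|.
    by rewrite -[1](expr0 (p%:R : R)) ltr_eXn2l ?pR_gt1.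
  by rewrite gt1.
have vd : vQp (denq x)%:~R = 1.
  rewrite vQp_int ?denq_neq0 // lognE hp absz_gt0 denq_neq0 (negbTE dn) //.
have /coprimezP[[s t] /= st] : coprimez p%:Z (denq x).
  by rewrite coprimezE absz_nat prime_coprime.
have dQ : (denq x)%:~R != 0 :> Qp by rewrite -(v_eq0 hq) vd oner_eq0.
have ix : iQ x = (numq x)%:~R / (denq x)%:~R.
  by rewrite -{1}(divq_num_den x) rmorphM fmorphV !rmorph_int.
pose m := numq x * t.
have h1 : vQp (iQ x - m%:~R) <= r.
  have -> : iQ x - m%:~R = (numq x)%:~R * s%:~R * p%:R / (denq x)%:~R.
    have e : (s%:~R * p%:R + t%:~R * (denq x)%:~R : Qp) = 1.
      by rewrite -[p%:R]/(p%:Z%:~R) -!intrM -intrD st.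
    rewrite ix /m intrM; apply: (mulIf dQ); rewrite divfK // mulrBl divfK //.
    have es := congr1 (fun z => z - t%:~R * (denq x)%:~R) e.
    rewrite addrK in es; rewrite -[RHS]mulrA es; ring.
  rewrite !(vM hq) (vV hq) vd invr1 mulr1 vQp_p ler_piMl ?(ltW pinv_gt0) //.
  by rewrite mulr_ile1 ?(v_ge0 hq) ?(v_int_int hq).
have [n hn] : exists n : nat, vQp (m%:~R - n%:R) <= r.
  have pz : p%:Z != 0 by rewrite eqz_nat -lt0n prime_gt0.
  exists `|(m %% p%:Z)%Z|%N.
  have -> : (`|(m %% p%:Z)%Z|%N%:R : Qp) = (m %% p%:Z)%Z%:~R.
    by rewrite -{2}(gez0_abs (modz_ge0 m pz)).
  rewrite -intrB; have -> : m - (m %% p%:Z)%Z = (m %/ p%:Z)%Z * p%:Z.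
    by rewrite {1}(divz_eq m p%:Z) addrK.
  rewrite intrM (vM hq) -[X in _ * vQp X]/(p%:R) vQp_p.
  by rewrite ler_piMl ?(ltW pinv_gt0) // (v_int_int hq).
exists n; have -> : a - n%:R = (a - iQ x) + (iQ x - m%:~R) + (m%:~R - n%:R) by ring.
apply: (vD_le hq) => //; apply: (vD_le hq) => //; exact: ltW.
Qed.

(** As [pi] divides [p], [|pi|] is at least [1/p], and the value group has nothing strictly between
    [1/p] and 1. *)
Lemma v_uniformizer pi : uniformizer vQp pi -> vQp pi = r.
Proof.
case=> pi1 H; have [|y hy e] := H p%:R; first by rewrite /vmax vQp_p pinv_lt1.
have le : r <= vQp pi.
  by rewrite -vQp_p e (vM hq) ler_piMl ?(v_ge0 hq).
apply/eqP; rewrite eq_le le andbT.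
have pi0 : pi != 0 by rewrite -(v_gt0 hq); apply: lt_le_trans le; exact: pinv_gt0.
have [m e'] := vQp_le1 pi0 (ltW pi1); rewrite e'.
case: m e' => [|m] e'; first by move: pi1; rewrite /vmax e' expr0 ltxx.
by rewrite exprS ler_piMr ?(ltW pinv_gt0) // exprn_ile1 ?(ltW pinv_gt0) ?(ltW pinv_lt1) ?pinv_lt1.
Qed.

Section Extension.
Variables (E : fieldType) (v : E -> R) (j : {rmorphism Qp -> E}).
Hypotheses (hv : nonarch_abs v) (hj : forall a, v (j a) = vQp a).

(** Applied to [K], where the logarithm is constructed, and to [Kbar], where the conjugations take
    place. *)
Lemma extension_zp_frame pi : uniformizer vQp pi ->
  zp_frame v p (fun z => exists2 a, vQp a <= 1 & z = j a) (j pi).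
Proof.
move=> hu; have vpi := v_uniformizer hu.
have pi0 : pi != 0 by rewrite -(v_gt0 hq) vpi pinv_gt0.
have subq := subring_vint hq.
split=> //.
- split; first by exists 1; rewrite ?rmorph1 ?(v1 hq).
    move=> _ _ [a ha ->] [b hb ->]; exists (a - b); last by rewrite rmorphB.
    exact: (spB subq).
  move=> _ _ [a ha ->] [b hb ->]; exists (a * b); last by rewrite rmorphM.
  exact: (spM subq).
- by move=> _ [a ha ->]; rewrite hj.
- by exists pi => //; rewrite vpi ltW // pinv_lt1.
- by rewrite hj vpi pinv_lt1.
- by rewrite fmorph_eq0.
- by rewrite -(rmorph_nat j) !hj vQp_p vpi.
- by move=> k nd; rewrite -(rmorph_nat j) hj vQp_coprime.
- move=> _ [a ha ->]; rewrite hj => va; exists a^-1; last by rewrite fmorphV.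
  by rewrite (vV hq) va invr1.
- move=> _ [a ha ->]; rewrite !hj => le; exists (a / pi); last by rewrite rmorphM fmorphV.
  by rewrite (vM hq) (vV hq) ler_pdivrMr ?mul1r // (v_gt0 hq).
- move=> _ [a ha ->]; have [n hn] := vQp_residue ha; exists n.
  by rewrite -(rmorph_nat j) -rmorphB !hj vpi.
Qed.
End Extension.

(** * Discreteness of the absolute value on a finite extension of [Q_p] *)

Section FiniteExtension.
Variables (K : fieldExtType Qp) (v : K -> R).
Hypotheses (hv : nonarch_abs v) (hj : forall a : Qp, v (a%:A) = vQp a).

Lemma pvalueM y z : pvalue y -> pvalue z -> pvalue (y * z).
Proof.
case=> [a [b ->]] [c [d ->]]; exists (a + c)%N, (b + d)%N.
by rewrite !exprD invfM mulrACA.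
Qed.
Lemma pvalueV y : pvalue y -> pvalue y^-1.
Proof. by case=> [a [b ->]]; exists b, a; rewrite invfM invrK mulrC. Qed.
Lemma pvalueX y n : pvalue y -> pvalue (y ^+ n).
Proof.
move=> hy; elim: n => [|n IH]; last by rewrite exprS; apply: pvalueM.
by exists 0%N, 0%N; rewrite !expr0 divr1.
Qed.

(* In a vanishing sum the maximal absolute value is reached twice. *)
Lemma two_equal_terms (n : nat) (F : 'I_n -> K) i0 : F i0 != 0 ->
  \sum_i F i = 0 -> exists i k, [/\ i != k, F i != 0 & v (F i) = v (F k)].
Proof.
move=> Fi0 s0; pose i := [arg max_(i > i0) v (F i)]%O.
have Hmax k : v (F k) <= v (F i).
  by rewrite /i; case: Order.TotalTheory.arg_maxP => // i1 _; apply.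
have Fi : F i != 0.
  by rewrite -(v_gt0 hv); apply: lt_le_trans (Hmax i0); rewrite (v_gt0 hv).
apply: contrapT => H.
have lt : v (\sum_(k | k != i) F k) < v (F i).
  apply: (big_ind (fun z => v z < v (F i))) => [|x y|k ki].
  - by rewrite (v0 hv) (v_gt0 hv).
  - exact: (vD_lt hv).
  rewrite lt_neqAle Hmax andbT; apply/eqP => e; apply: H.
  by exists i, k; rewrite eq_sym.
move: s0; rewrite (bigD1 i) //= => /(congr1 v).
by rewrite (vD_eq hv) // (v0 hv) => /eqP; rewrite (v_eq0 hv) (negbTE Fi).
Qed.

Let N := (\dim {:K})`!.

(** Two terms of the minimal polynomial of [x] have the same absolute value, so [|x|^(k-i)] is a
    power of [p] with [0 < k - i <= [K : Q_p]]. The factorial [N] is a multiple of all these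
    exponents. *)
Lemma v_fact_pvalue x : x != 0 -> pvalue (v x ^+ N).
Proof.
move=> x0; pose P := minPoly 1%AS x; pose n := size P.
have rootP : root P x by apply: root_minPoly.
have mP : P \is monic by apply: monic_minPoly.
have sP : n = (adjoin_degree 1%AS x).+1 by apply: size_minPoly.
have dle : (adjoin_degree 1%AS x <= \dim {:K})%N.
  rewrite adjoin_degreeE dimv1 divn1; apply: dimvS; exact: subvf.
have coefP k : exists a : Qp, P`_k = a%:A.
  have /polyOverP/(_ k) := minPolyOver 1%AS x.
  by move/vlineP => [a ->]; exists a.
pose F (k : 'I_n) := P`_k * x ^+ k.
have n1 : (n.-1 < n)%N by rewrite sP.
have F0 : F (Ordinal n1) != 0.
  rewrite /F /= mulf_neq0 ?expf_neq0 // -/(lead_coef P).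
  by rewrite lead_coef_eq0 monic_neq0.
have s0 : \sum_k F k = 0 by move: rootP; rewrite rootE horner_coef => /eqP.
have [i [k [ik Fi e]]] := two_equal_terms F0 s0.
wlog lt : i k ik Fi e / (i < k)%N.
  move=> H; have [h|h|h] := ltngtP i k; first exact: (H i k).
    apply: (H k i) => //; first by rewrite eq_sym.
    by rewrite -(v_eq0 hv) -e (v_eq0 hv).
  by case/eqP: ik; apply: val_inj.
have Fk : F k != 0 by rewrite -(v_eq0 hv) -e (v_eq0 hv).
have pv l : F l != 0 -> pvalue (v P`_l).
  rewrite /F mulf_eq0 negb_or => /andP[Pl _].
  have [a ea] := coefP l; rewrite ea hj; apply: vQp_pvalue.
  by apply: contraNneq Pl => a0; rewrite ea a0 scale0r.
have vx0 : v x != 0 by rewrite (v_eq0 hv).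
have vk0 : v P`_k != 0.
  by move: Fk; rewrite /F mulf_eq0 negb_or (v_eq0 hv) => /andP[].
have ex : v x ^+ (k - i) = v P`_i / v P`_k.
  apply: (mulfI vk0); apply: (mulIf (expf_neq0 i vx0)).
  rewrite -mulrA -exprD subnK ?(ltnW lt) // mulrCA divff // mulr1.
  by move: e; rewrite /F !(vM hv) !(vX hv) => ->.
have ki : (0 < k - i <= \dim {:K})%N.
  rewrite subn_gt0 lt /=; apply: leq_trans dle.
  have kn := leq_trans (ltn_ord k) (eq_leq sP).
  by rewrite -ltnS; apply: leq_trans kn; rewrite ltnS leq_subr.
have /dvdnP[l el] : (k - i %| N)%N by rewrite dvdn_fact.
rewrite el mulnC exprM ex; apply: pvalueX.
by apply: pvalueM; [apply: pv|apply/pvalueV/pv].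
Qed.

Lemma v_fact_le1 x : x != 0 -> v x <= 1 -> exists m, v x ^+ N = r ^+ m.
Proof.
move=> x0 vx; apply: pvalue_le1 (v_fact_pvalue x0) _.
by rewrite exprn_ile1 ?(v_ge0 hv).
Qed.

(** By discreteness the supremum of infinitely many absolute values is attained: the least exponent
    [m] with [|c k|^N = r^m] is realised. *)
Lemma max_coefficient (c : nat -> K) k0 : (forall k, v (c k) <= 1) -> c k0 != 0 ->
  exists d, v (c k0) <= v (c d) /\ forall k, v (c k) <= v (c d).
Proof.
move=> hc ck0.
have N0 : (0 < N)%N by apply: fact_gt0.
pose Q m := `[< exists k, c k != 0 /\ v (c k) ^+ N = r ^+ m >].
have exQ : exists m, Q m.
  by have [m e] := v_fact_le1 ck0 (hc k0); exists m; apply/asboolP; exists k0.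
case: (ex_minnP exQ) => m /asboolP[d [cd ed]] minm.
have H k : v (c k) <= v (c d).
  have [->|ck] := eqVneq (c k) 0; first by rewrite (v0 hv) (v_ge0 hv).
  have [m' e] := v_fact_le1 ck (hc k).
  have le : (m <= m')%N by apply: minm; apply/asboolP; exists k.
  rewrite -(ler_pXn2r N0) ?nnegrE ?(v_ge0 hv) // e ed.
  by rewrite ler_wiXn2l ?(ltW pinv_gt0) ?(ltW pinv_lt1) ?pinv_lt1.
by exists d.
Qed.
End FiniteExtension.
End PadicField.

(** * The theorem *)

Section Maps.
Variables (A B : comNzRingType) (g : {rmorphism A -> B}).

Definition ps_map (s : pseries A) : pseries B := fun k => g (s k).

Lemma ps_mapM s t : ps_map (s * t) = ps_map s * ps_map t.
Proof.
apply: psP => n; rewrite /ps_map !psM rmorph_sum; apply: eq_bigr => i _.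
by rewrite rmorphM.
Qed.
Lemma ps_mapX s k : ps_map (s ^+ k) = ps_map s ^+ k.
Proof.
elim: k => [|k IH]; last by rewrite !exprS ps_mapM IH.
by apply: psP => n; rewrite /ps_map !expr0 !ps1 rmorph_nat.
Qed.
Lemma ps_map_comp s t : t 0%N = 0 ->
  ps_map (ps_comp s t) = ps_comp (ps_map s) (ps_map t).
Proof.
move=> t0; apply: psP => n.
have gt0 : ps_map t 0%N = 0 by rewrite /ps_map t0 rmorph0.
rewrite ps_compE // {1}/ps_map ps_compE // rmorph_sum; apply: eq_bigr => i _.
by rewrite rmorphM -ps_mapX.
Qed.
Lemma ps_map_X : ps_map (ps_X A) = ps_X B.
Proof. by apply: psP => n; rewrite /ps_map /ps_X rmorph_nat. Qed.
Lemma ps_map_const c : ps_map (ps_const c) = ps_const (g c).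
Proof. by apply: psP => -[|n] //=; rewrite /ps_map /= rmorph0. Qed.
Lemma ps_map_deriv s : ps_map (ps_deriv s) = ps_deriv (ps_map s).
Proof. by apply: psP => n; rewrite /ps_map /ps_deriv rmorphMn. Qed.
Lemma ps_map_iter n s : s 0%N = 0 -> ps_map (ps_iter n s) = ps_iter n (ps_map s).
Proof.
move=> s0; elim: n => [|n IH]; first exact: ps_map_X.
by rewrite !ps_iterS ps_map_comp ?ps_iter0 // IH.
Qed.

Lemma map_ms_app1 n s (G : mseries A n) m : G 0%MM = 0 ->
  g (ms_app1 s G m) = ms_app1 (ps_map s) (fun m => g (G m)) m.
Proof.
move=> G0; have lt := ltnSn (mdeg m).
rewrite (ms_app1_subst s G0 lt) (ms_app1_subst _ _ lt) ?G0 ?rmorph0 //.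
rewrite -mcoeff_map_mpoly !(@mp_evalEw _ (mdeg m).+1) ?size_poly //.
rewrite rmorph_sum !raddf_sum /=; apply: eq_bigr => k _.
rewrite -!mul_mpolyC rmorphM rmorphXn /= map_mpolyC !coef_ps_trunc ltn_ord.
congr (_ * _ ^+ _)@_m; apply/mpolyP => m'.
rewrite mcoeff_map_mpoly !coef_ms_trunc; case: ifP => // _; exact: rmorph0.
Qed.

Lemma map_log_group (L Li : pseries A) m : L 0%N = 0 ->
  g (log_group L Li m) = log_group (ps_map L) (ps_map Li) m.
Proof.
move=> L0.
have x0 (i : 'I_2) : ms_var A i 0%MM = 0 by apply: ms_var0.
have e (i : 'I_2) m' : g (ms_app1 L (ms_var A i) m') = ms_app1 (ps_map L) (ms_var B i) m'.
  rewrite map_ms_app1 //; congr (ms_app1 _ _ m'); apply: funext => m''.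
  by rewrite /ms_var rmorph_nat.
rewrite !log_groupE map_ms_app1; last first.
  by rewrite /ms_add !ms_app10 // addr0.
have -> // : (fun m => g (ms_add (ms_app1 L (ms_var A (0 : 'I_2)))
    (ms_app1 L (ms_var A (1 : 'I_2))) m)) =
  ms_add (ms_app1 (ps_map L) (ms_var B (0 : 'I_2)))
    (ms_app1 (ps_map L) (ms_var B (1 : 'I_2))).
by apply: funext => m'; rewrite /ms_add rmorphD; congr (_ + _); apply: e.
Qed.
End Maps.

Section DynMap.
Variables (R : realType) (K E : fieldType) (vK : K -> R) (v : E -> R).
Variable g : {rmorphism K -> E}.
Hypothesis hg : forall x, v (g x) = vK x.

Lemma dyn_map (Z : K -> Prop) (Z' : E -> Prop) pi f u :
  (forall x, Z x -> Z' (g x)) -> dyn vK Z pi f u ->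
  dyn v Z' (g pi) (ps_map g f) (ps_map g u).
Proof.
move=> hZ hd; have f0 := dyn_f0 hd; have u0 := dyn_u0 hd; split.
- by rewrite /ps_map f0 rmorph0.
- by rewrite /ps_map u0 rmorph0.
- by move=> n; rewrite /ps_map hg; apply: dyn_f hd n.
- by move=> n; rewrite /ps_map hg; apply: dyn_u hd n.
- by rewrite /ps_map (dyn_f1 hd).
- by apply: hZ; apply: dyn_u1 hd.
- by rewrite /ps_map hg (dyn_vu1 hd).
- move=> n n0 e; apply: (dyn_nt hd n0); apply: (fmorph_inj g).
  by rewrite rmorphXn rmorph1.
- by rewrite -!ps_map_comp // (dyn_comm hd).
- by move=> n; rewrite -ps_map_deriv /ps_map !hg; apply: dyn_f' hd n.
Qed.

Lemma nonarch_pullback : nonarch_abs v -> nonarch_abs vK.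
Proof.
move=> hv; split=> [x|x|x y|x y]; rewrite -?hg ?rmorphM ?rmorphD.
- exact: v_ge0.
- rewrite (abs_eq0 hv); split=> [/eqP|->]; last exact: rmorph0.
  by rewrite fmorph_eq0 => /eqP.
- exact: vM.
- exact: abs_add.
Qed.
End DynMap.

Lemma finite_sup_lt1 (R : realType) (c : nat -> R) e : (forall k, (k <= e)%N -> c k < 1) ->
  exists2 theta : R, theta < 1 & forall k, (k <= e)%N -> c k <= theta.
Proof.
elim: e => [|e IH] H.
  by exists (c 0%N); [apply: H|move=> k; rewrite leqn0 => /eqP ->].
have [t t1 Ht] := IH (fun k h => H k (leqW h)).
exists (Num.max t (c e.+1)); first by rewrite gt_max t1 H.
move=> k; rewrite leq_eqVlt => /orP[/eqP ->|lt]; first by rewrite le_max lexx orbT.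
by rewrite le_max Ht.
Qed.

Theorem mainTheorem1 (R : realType) (p : nat) (hp : prime p)
  (* Qp is the completion of rat for the p-adic absolute value *)
  (Qp : fieldType) (vQp : Qp -> R) (iQ : {rmorphism rat -> Qp})
  (hQp : completion (padic_abs R p) vQp iQ)
  (* K is a finite extension of Qp, Kbar an algebraic closure containing K *)
  (K : fieldExtType Qp)
  (Kbar : fieldType) (vKbar : Kbar -> R) (iK : {rmorphism K -> Kbar})
  (hKbar : valued_alg_closure vQp vKbar iK)
  (* Cp is the completion of Kbar *)
  (Cp : fieldType) (vCp : Cp -> R) (iC : {rmorphism Kbar -> Cp})
  (hCp : completion vKbar vCp iC) :
  let vK (x : K) : R := vKbar (iK x) in
  let OK : K -> Prop := vring vK in
  let mK : K -> Prop := vmax vK in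
  forall f u : pseries K,
    ps_int0 OK f -> ps_int0 OK u ->
    ps_comp f u =1 ps_comp u f ->
    (exists2 pi : Qp, uniformizer vQp pi & f 1%N = pi%:A) ->
    (exists2 a : Qp, vQp a = 1 /\ (forall n, (0 < n)%N -> a ^+ n <> 1)
                   & u 1%N = a%:A) ->
    (forall n, (0 < n)%N ->
       simple_roots_in_disk vCp (fun k => iC (iK (ps_iter n f k)))) ->
    has_wideg mK f p ->
    exists F : mseries K 2,
      [/\ formal_group OK F, fg_End OK F f & fg_End OK F u].
Proof.
move=> vK OK mK f u [f0 fint] [u0 uint] comm [pi hpi f1] [a [va nta] u1] simple [_ hfp].
have hvB := vac_abs hKbar; have closed := vac_closed hKbar.
have hvC := completion_abs hCp; have hvQ := completion_abs hQp.
have hvK : nonarch_abs vK by apply: (nonarch_pullback (g := iK)) hvB.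
have hj (x : Qp) : vK (x%:A) = vQp x by apply: vac_extends hKbar x.
have vC x : vCp (iC (iK x)) = vK x by rewrite (completion_isometry hCp).
have frK := extension_zp_frame hp hQp (j := in_alg K) hj hpi.
have frB := extension_zp_frame hp hQp (j := iK \o in_alg K) hj hpi.
set ZK := (fun z => _) in frK; set ZB := (fun z => _) in frB.
have {}comm : ps_comp f u = ps_comp u f by apply: funext.
have vpi : vK (f 1%N) < 1 by rewrite f1 hj; case: hpi.
have vu1 : vK (u 1%N) = 1 by rewrite u1 hj.
have ntK n : (0 < n)%N -> u 1%N ^+ n <> 1.
  move=> n0; rewrite u1 => e; apply: (nta n n0); apply: (fmorph_inj (in_alg K)).
  by rewrite rmorphXn rmorph1.
pose gC : {rmorphism K -> Cp} := iC \o iK.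
have f' : ps_le vK (vK (f 1%N)) (ps_deriv f).
  move=> k0; rewrite leNgt; apply/negP => lt.
  have f'int k : vK (ps_deriv f k) <= 1 by apply: (ps_le_deriv hvK).
  have c0 : ps_deriv f k0 != 0.
    by rewrite -(v_gt0 hvK); apply: le_lt_trans lt; apply: v_ge0.
  (* Were [f'(0)] not a largest coefficient of [f'], dividing by one would give an integral [h] with
     a unit coefficient and a nonunit constant term. Such an [h] has a zero in the open disk, which
     [no_critical_point] excludes. *)
  have [d [hd0 hd]] := max_coefficient hp hQp hvK hj f'int c0.
  set c := ps_deriv f d in hd0 hd.
  have vc : vK (f 1%N) < vK c by apply: lt_le_trans hd0.
  have vc0 : 0 < vK c by apply: le_lt_trans vc; apply: v_ge0.
  have cn : c != 0 by rewrite -(v_gt0 hvK).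
  pose h : pseries K := ps_const c^-1 * ps_deriv f.
  have vh k : vK (h k) = vK (ps_deriv f k) / vK c.
    by rewrite /h ps_const_mul (vM hvK) (vV hvK) mulrC.
  have hint : ps_le vK 1 h by move=> k; rewrite vh ler_pdivrMr // mul1r.
  have f'h : ps_deriv f = ps_const c * h.
    by rewrite /h mulrA -ps_constMM divff // ps_const1 mul1r.
  have exd : exists k, vK (h k) == 1 by exists d; rewrite vh divff // gt_eqF.
  case: (ex_minnP exd) => -[|e] /eqP he mine.
    move: he; rewrite vh /ps_deriv mulr1n => /eqP; rewrite lt_eqF //.
    by rewrite ltr_pdivrMr // mul1r.
  have [theta th1 Hth] : exists2 theta : R, theta < 1 &
      forall k, (k <= e)%N -> vK (h k) <= theta.
    apply: finite_sup_lt1 => k ke; rewrite lt_neqAle hint andbT.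
    by apply/negP => /mine; lia.
  have [x [hx hx0]] := zero_exists hvB closed hCp (h := ps_map iK h) hint he th1 Hth.
  apply: (no_critical_point hvC (completion_complete hCp) (f := ps_map gC f)
    (u := ps_map gC u) _ _ _ _ _ _ _ _ _ (h := ps_map gC h) (c := gC c)
    (d := e.+1) _ _ _ _ hx hx0).
  - by rewrite /ps_map f0 rmorph0.
  - by rewrite /ps_map u0 rmorph0.
  - by move=> k; rewrite /ps_map vC; apply: fint.
  - by move=> k; rewrite /ps_map vC; apply: uint.
  - by rewrite -!ps_map_comp // comm.
  - by rewrite /ps_map vC.
  - by rewrite /ps_map vC.
  - move=> n n0 en; apply: (ntK n n0); apply: (fmorph_inj gC).
    by rewrite rmorphXn rmorph1.
  - by move=> n n0; rewrite -ps_map_iter //; apply: simple.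
  - by move=> k; rewrite /ps_map vC.
  - by rewrite /ps_map vC.
  - by rewrite fmorph_eq0.
  - by rewrite -ps_map_deriv f'h ps_mapM ps_map_const.
have dK : dyn vK ZK (pi%:A) f u.
  split=> //; last by rewrite -f1.
  by exists a; rewrite ?va.
have dB : dyn vKbar ZB (iK pi%:A) (ps_map iK f) (ps_map iK u).
  by apply: dyn_map dK => // _ [b hb ->]; exists b.
(* The logarithm is taken over [K], so [F] has its coefficients there; the field is enlarged to
   [Kbar] only to bound their absolute values. *)
have [L [L0 L1 _ Lf Lu]] := log_exists hvK frK dK.
have L1n : L 1%N != 0 by rewrite L1 oner_eq0.
have [Li [Li0 _ _ LiL LLi]] := ps_inv (@subring_predT K) (fun=> I) L0 L1n I.
have vfp : vKbar (ps_map iK f p) = 1.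
  apply/eqP; rewrite eq_le (fint p) /= leNgt; exact/negP.
have XB : ps_map iK (ps_X K) = ps_X Kbar by apply: ps_map_X.
have Fint m : OK (log_group L Li m).
  rewrite /OK /vring /vK map_log_group //.
  apply: (log_group_int hvB frB closed dB vfp).
  - by rewrite /ps_map L0 rmorph0.
  - by rewrite /ps_map Li0 rmorph0.
  - by rewrite -ps_map_comp // LLi XB.
  - by rewrite -ps_map_comp // LiL XB.
  - by rewrite -ps_map_comp // Lf ps_mapM ps_map_const.
exists (log_group L Li); split.
- exact: log_group_axioms.
- exact: (log_group_End L0 Li0 LLi LiL _ Lf).
- exact: (log_group_End L0 Li0 LLi LiL _ Lu).
Qed.
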